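(* Let $d\ge1$, let $\kappa:[-1,1]\to\mathbb{R}$ be given by $\kappa(t)=\sum_{q\ge 0}\frac{J_q^2}{q!}t^q$ with $J_q\in\mathbb{R}$, $J_q\neq0$ for infinitely many $q$, $\sum_{q\ge1}\frac{|J_q|}{(q-1)!}<\infty$, and $\kappa(1)=1$; let $\kappa_L$ denote the $L$-fold composition of $\kappa$. For each $L\ge1$ let $(T_L(x))_{x\in\mathbb{S}^d}$ be a continuous, isotropic, centered Gaussian random field on $\mathbb{S}^d$ with $\mathrm{Cov}(T_L(x),T_L(y))=\kappa_L(\langle x,y\rangle)$, and let $\overline{T}_L=\frac{1}{\omega_d}\int_{\mathbb{S}^d}T_L(y)\,\lambda(dy)$ be its spherical average, where $\lambda$ is the surface (Lebesgue) measure on $\mathbb{S}^d$ and $\omega_d=\lambda(\mathbb{S}^d)$. Let $m\ge1$, let $x_1,\dots,x_m\in\mathbb{S}^d$ be pairwise distinct, $\underline{x}=(x_1,\dots,x_m)$, $T_L(\underline{x})=(T_L(x_1),\dots,T_L(x_m))$, and $\boldsymbol{1}=(1,\dots,1)\in\mathbb{R}^m$. Assume $\kappa'(1)\le1$, and if $\kappa'(1)=1$ assume moreover that there exist $c\in\mathbb{R}\setminus\{0\}$ and $\rho>1$ with $1-\kappa(t)=\kappa'(1)(1-t)-c(1-t)^{\rho}+o((1-t)^{\rho})$ as $t\to1^-$. Define $v_L$ and $\mathfrak{g}$ by: \begin{itemize} \item if $\kappa'(1)<1$: $v_L=(\kappa'(1))^{-L}$ and $\mathfrak{g}(t)=\lim_{L\to\infty}(\kappa'(1))^{-L}(1-\kappa_L(t))$;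 \item if $\kappa'(1)=1$: $v_L=L^{1/(\rho-1)}$ and $\mathfrak{g}(t)=\lim_{L\to\infty}L^{1/(\rho-1)}(1-\kappa_L(t))$ \end{itemize} (these limits exist). Then the sequence $\{T_L(\underline{x})-\overline{T}_L\boldsymbol{1}\}_{L\ge1}$ satisfies a large deviation principle on $\mathbb{R}^m$ with speed $v_L$ and good rate function \[ I_{2;\mathfrak{g}}(\underline{y};\underline{x})=\sup_{\underline{\theta}\in\mathbb{R}^m}\Bigl\{\langle\underline{\theta},\underline{y}\rangle-\tfrac12\langle\underline{\theta},B_{2;\mathfrak{g}}(\underline{x})\underline{\theta}\rangle\Bigr\},\qquad\underline{y}\in\mathbb{R}^m, \] where $B_{2;\mathfrak{g}}(\underline{x})$ is the $m\times m$ matrix with entries \[ \frac{\int_{-1}^1\mathfrak{g}(t)(1-t^2)^{\frac d2-1}\,dt}{\int_{-1}^1(1-t^2)^{\frac d2-1}\,dt}-\mathfrak{g}(\langle x_i,x_j\rangle),\qquad i,j=1,\dots,m. \]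
   Context: A sequence $\{X_L\}$ of random vectors in $\mathbb{R}^m$ satisfies a large deviation principle (LDP) with speed $v_L\to\infty$ and rate function $I$ (lower semicontinuous, $[0,\infty]$-valued; good if its level sets are compact) if $\limsup_L v_L^{-1}\log P(X_L\in C)\le-\inf_C I$ for all closed $C$ and $\liminf_L v_L^{-1}\log P(X_L\in O)\ge-\inf_O I$ for all open $O$. *)

(* Defs.v *)
From HB Require Import structures.
From mathcomp Require Import all_boot all_order all_algebra.
From mathcomp Require Import all_classical all_reals all_analysis.
Unset Implicit Arguments.
Unset Strict Implicit.
Unset Printing Implicit Defensive.
Import Order.TTheory GRing.Theory Num.Theory.
Import numFieldNormedType.Exports.
Local Open Scope classical_set_scope.
Local Open Scope ring_scope.

Section Defs.
Context {R : realType}.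

Definition dotv {n : nat} (x y : 'rV[R]_n) : R := \sum_(i < n) x 0 i * y 0 i.

Definition sphere (n : nat) : set 'rV[R]_(n.+1) := [set x | dotv x x = 1].

Definition sph_lift {n : nat} (t : R) (u : 'rV[R]_(n.+1)) : 'rV[R]_(n.+2) :=
  row_mx (\row_(j < 1) t) (Num.sqrt (1 - t ^+ 2) *: u).

(* Integral over S^n with respect to the surface (n-dimensional Hausdorff)
   measure lambda, defined by the slice formula:
   S^0 = {1,-1} with counting measure, and
   int_{S^(n+1)} f = int_{-1}^{1} (1-t^2)^((n-1)/2) int_{S^n} f(t, sqrt(1-t^2) u) du dt. *)
Fixpoint sphere_int (n : nat) : ('rV[R]_(n.+1) -> R) -> R :=
  match n return ('rV[R]_(n.+1) -> R) -> R with
  | 0 => fun f => f (const_mx 1) + f (const_mx (-1))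
  | n'.+1 => fun f =>
      Rintegral (@lebesgue_measure R) `[-1, 1]
        (fun t => (1 - t ^+ 2) `^ ((n'%:R - 1) / 2) *
                  @sphere_int n' (fun u => f (sph_lift t u)))
  end.

Definition centered_gauss_law (v : R) : set R -> \bar R :=
  if v == 0 then @dirac _ R 0 R else normal_prob 0 (Num.sqrt v).

Definition continuous_centered_gaussian_field_on_sphere (d : nat)
  {dO} {Omega : measurableType dO} (P : probability Omega R)
  (T : 'rV[R]_(d.+1) -> Omega -> R) (K : R -> R) : Prop :=
  [/\ forall w, {within @sphere d, continuous (fun x => T x w)},
      forall x, @sphere d x -> measurable_fun setT (T x) &
      forall (n : nat) (xs : 'I_n -> 'rV[R]_(d.+1)) (a : 'I_n -> R),
        (forall i, @sphere d (xs i)) ->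
        forall A : set R, measurable A ->
          P ((fun w => \sum_(i < n) a i * T (xs i) w) @^-1` A) =
          centered_gauss_law (\sum_(i < n) \sum_(j < n)
                                a i * a j * K (dotv (xs i) (xs j))) A].

Definition elog (p : \bar R) : \bar R :=
  if p == 0%E then -oo%E else (ln (fine p))%:E.

Definition good_rate_function {m : nat} (I : 'rV[R]_m -> \bar R) : Prop :=
  [/\ forall y, (0 <= I y)%E, lower_semicontinuous I &
      forall a : R, compact [set y | (I y <= a%:E)%E]].

Definition LDP {m : nat} (dO : nat -> measure_display)
  (Omega : forall L, measurableType (dO L)) (P : forall L, probability (Omega L) R)
  (X : forall L, Omega L -> 'rV[R]_m) (v : nat -> R) (I : 'rV[R]_m -> \bar R) : Prop :=
  (forall C : set 'rV[R]_m, closed C ->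
     (limn_esup (fun L => elog (P L (X L @^-1` C)) * ((v L)^-1)%:E)
        <= - ereal_inf (I @` C))%E) /\
  (forall O : set 'rV[R]_m, open O ->
     (- ereal_inf (I @` O)
        <= limn_einf (fun L => elog (P L (X L @^-1` O)) * ((v L)^-1)%:E))%E).


Definition kappa_of (J : nat -> R) (t : R) : R :=
  limn (series (fun q => J q ^+ 2 / (q`!)%:R * t ^+ q)).

Definition sphere_avg (d : nat) (f : 'rV[R]_(d.+1) -> R) : R :=
  @sphere_int d f / @sphere_int d (fun _ => 1).

Definition speed (k1 rho : R) (L : nat) : R :=
  if k1 < 1 then k1 ^- L else L%:R `^ (rho - 1)^-1.

Definition g_of (kappa : R -> R) (v : nat -> R) (t : R) : R :=
  limn (fun L => v L * (1 - iter L kappa t)).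

Definition gegen_avg (d : nat) (g : R -> R) : R :=
  Rintegral (@lebesgue_measure R) `[-1, 1]
    (fun t => g t * (1 - t ^+ 2) `^ (d%:R / 2 - 1)) /
  Rintegral (@lebesgue_measure R) `[-1, 1]
    (fun t => (1 - t ^+ 2) `^ (d%:R / 2 - 1)).

Definition B2 (d : nat) (g : R -> R) {m : nat} (xs : 'I_m -> 'rV[R]_(d.+1))
  : 'M[R]_m :=
  \matrix_(i < m, j < m) (gegen_avg d g - g (dotv (xs i) (xs j))).

Definition I2 (d : nat) (g : R -> R) {m : nat} (xs : 'I_m -> 'rV[R]_(d.+1))
  (y : 'rV[R]_m) : \bar R :=
  ereal_sup (range (fun theta : 'rV[R]_m =>
    (dotv theta y - 2^-1 * (theta *m B2 d g xs *m theta^T) 0 0)%:E)).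

End Defs.
Arguments sphere {R} n.

(* Main.v *)
Require Import Defs.
From HB Require Import structures.
From mathcomp Require Import all_boot all_order all_algebra.
From mathcomp Require Import all_classical all_reals all_analysis.
From mathcomp Require Import measurable_realfun zify ring lra.
Import Order.TTheory GRing.Theory Num.Theory.
Import numFieldNormedType.Exports.
Local Open Scope classical_set_scope.
Local Open Scope ring_scope.
Set Implicit Arguments.
Unset Strict Implicit.
Unset Printing Implicit Defensive.

(* The vector T_L(x) - mean is Gaussian: its moment generating function is
   computed by replacing the spherical average by finite quadrature sums, whose
   variances converge.  By the Funk-Hecke formula (moments of <x, .> on the
   sphere, extended to uniform limits of polynomials), the average of
   kappa_L(<x, .>) does not depend on x, so the covariance matrix Sigma_L has
   entries kappa_L(<x_i, x_j>) - A_L with A_L the weighted mean of kappa_L on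
   [-1, 1].  The gap u_L = 1 - kappa_L(t) obeys u_{L+1} = 1 - kappa(1 - u_L),
   whose asymptotics (geometric if kappa'(1) < 1, like L^(-1/(rho-1)) if
   kappa'(1) = 1) give v_L u_L -> g(t), boundedly in t; by dominated
   convergence v_L Sigma_L -> B.  Since
   v_L^{-1} log E exp(v_L <theta, X_L>) = v_L <theta, Sigma_L theta> / 2
   converges to <theta, B theta> / 2, the upper bound follows from exponential
   Chebyshev bounds for finitely many half-spaces covering the closed set.  For
   the lower bound, the rate is finite only at points y = t B; tilting by t, the
   tilted mass outside a small ball around y is bounded by exponential moments. *)

(** * Iterates of the covariance function *)

(** Two obstacles shape the argument. The Gaussian hypothesis speaks of finite linear combinations
    only, so the law of the spherical average is not given; instead of identifying the law of the
    centered vector, only its exponential moments are computed, and both large deviation bounds are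
    drawn from them. And [sphere_int] slices along a chosen axis, so rotation invariance is not
    visible: it enters as the fact that the moments of <x, .> depend on x through |x|^2 alone,
    proved by induction on the dimension, where an identity between binomial coefficients and
    moments resums the slices. The limit matrix may be singular (antipodal points, even kappa),
    hence no densities and no inverses. For kappa, the key is one positive coefficient of index at
    least 2: it makes 1 the only fixed point in [-1, 1] and pushes negative points up at a uniform
    rate, so that bounds on [0, 1], where kappa is monotone, become bounds on [-1, 1]. *)

Section PowerSeries.
Context {R : realType} (a : nat -> R).
Context (a_ge0 : forall q, 0 <= a q) (a_sum1 : series a @ \oo --> (1 : R)).

(** With [a q] equal to J_q^2/q! this is [kappa_of J] by conversion. Nonnegative coefficients of sum
    1 make it a probability generating function. *)
Definition pser (t : R) : R := limn (series (fun q => a q * t ^+ q)).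

Lemma series_norm_cvg_le (u : nat -> R) :
  (forall q, `|u q| <= a q) -> cvgn (series u).
Proof.
move=> ua; apply: normed_cvg; apply: (series_le_cvg _ a_ge0 ua) => //.
by apply/cvg_ex; exists 1.
Qed.

Lemma normrX_le1 (t : R) q : `|t| <= 1 -> `|t ^+ q| <= 1.
Proof. by move=> t1; rewrite normrX exprn_ile1. Qed.

Lemma pser_cvg (t : R) : `|t| <= 1 ->
  series (fun q => a q * t ^+ q) @ \oo --> pser t.
Proof.
move=> t1; apply: series_norm_cvg_le => q.
by rewrite normrM (ger0_norm (a_ge0 q)) ler_piMr// normrX_le1.
Qed.

Lemma pser1 : pser 1 = 1.
Proof.
rewrite /pser (_ : (fun q => _) = a); first exact: (cvg_lim _ a_sum1).
by apply/funext => q; rewrite expr1n mulr1.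
Qed.

Lemma pser_le1 (t : R) : `|t| <= 1 -> `|pser t| <= 1.
Proof.
move=> t1; have h : (fun n => `|series (fun q => a q * t ^+ q) n|) @ \oo --> `|pser t|.
  by apply: cvg_norm; exact: pser_cvg.
apply: (ler_cvg_to h a_sum1); near=> n.
rewrite /series /=; apply: (le_trans (ler_norm_sum _ _ _)); apply: ler_sum => q _.
by rewrite normrM (ger0_norm (a_ge0 q)) ler_piMr// normrX_le1.
Unshelve. all: by end_near. Qed.

(** The bound is free of [t]: partial sums converge uniformly on [-1, 1], which later makes the
    iterates uniform limits of polynomials. *)
Lemma pser_tail (t : R) n : `|t| <= 1 ->
  `|pser t - series (fun q => a q * t ^+ q) n| <= 1 - series a n.
Proof.
move=> t1.
have h : (fun N => `|series (fun q => a q * t ^+ q) N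
   - series (fun q => a q * t ^+ q) n|) @ \oo
   --> `|pser t - series (fun q => a q * t ^+ q) n|.
  by apply: cvg_norm; apply: cvgB; [exact: pser_cvg|exact: cvg_cst].
have h' : (fun N => series a N - series a n) @ \oo --> 1 - series a n.
  by apply: cvgB; [exact: a_sum1|exact: cvg_cst].
apply: (ler_cvg_to h h'); near=> N.
have nN : (n <= N)%N by near: N; exact: nbhs_infty_ge.
rewrite !sub_series_geq//.
apply: (le_trans (ler_norm_sum _ _ _)); apply: ler_sum => q _.
by rewrite normrM (ger0_norm (a_ge0 q)) ler_piMr// normrX_le1.
Unshelve. all: by end_near. Qed.

Lemma pser_homo (s t : R) : 0 <= s -> s <= t -> t <= 1 -> pser s <= pser t.
Proof.
move=> s0 st t1.
have hs : `|s| <= 1 by rewrite ger0_norm// (le_trans st).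
have ht : `|t| <= 1 by rewrite ger0_norm// (le_trans s0).
apply: (ler_cvg_to (pser_cvg hs) (pser_cvg ht)); near=> n.
rewrite /series /=; apply: ler_sum => q _.
by rewrite ler_wpM2l// lerXn2r ?nnegrE// (le_trans s0).
Unshelve. all: by end_near. Qed.

Lemma normr_subXX (s t : R) q : `|s| <= 1 -> `|t| <= 1 ->
  `|s ^+ q - t ^+ q| <= q%:R * `|s - t|.
Proof.
move=> s1 t1; rewrite subrXX normrM mulrC ler_wpM2r//.
apply: (le_trans (ler_norm_sum _ _ _)).
apply: (@le_trans _ _ (\sum_(i < q) 1)).
  apply: ler_sum => i _; rewrite normrM.
  by rewrite mulr_ile1// normrX_le1.
by rewrite sumr_const card_ord.
Qed.

Context (k1 : R)
  (hk1 : (fun t : R => (1 - pser t) / (1 - t)) @ (1 : R)^'- --> k1).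

Lemma geometric_sumE (t : R) q : (\sum_(i < q) t ^+ i) * (1 - t) = 1 - t ^+ q.
Proof.
rewrite -opprB mulrN mulrC -subrX1 opprB //.
Qed.

Lemma pser_geom_cvg (t : R) : `|t| <= 1 ->
  series (fun q => a q * (\sum_(i < q) t ^+ i) * (1 - t)) @ \oo --> 1 - pser t.
Proof.
move=> t1.
have h : (fun N => series a N - series (fun q => a q * t ^+ q) N) @ \oo --> 1 - pser t.
  by apply: cvgB; [exact: a_sum1|exact: pser_cvg].
apply: cvg_trans h; apply: near_eq_cvg; near=> N.
rewrite /series /= -sumrB; apply: eq_bigr => q _.
by rewrite -mulrA geometric_sumE mulrBr mulr1.
Unshelve. all: by end_near. Qed.

(** [k1] is given only as a left limit of difference quotients. For t in (0, 1) the quotient is the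
    series of a_q (1 + ... + t^(q-1)), so it dominates each of its partial sums; then let t tend to
    1. *)
Lemma derivative_partial_sum n : \sum_(0 <= q < n) q%:R * a q <= k1.
Proof.
have h1 : (fun t : R => \sum_(0 <= q < n) a q * \sum_(i < q) t ^+ i) @ (1 : R)^'-
    --> \sum_(0 <= q < n) a q * \sum_(i < q) (1 : R) ^+ i.
  apply: cvg_at_left_filter.
  apply: cvg_big; first exact: add_continuous.
  move=> q _; apply: cvgM; first exact: cvg_cst.
  apply: cvg_big; first exact: add_continuous.
  by move=> i _; exact: exprn_continuous.
have -> : \sum_(0 <= q < n) q%:R * a q =
    \sum_(0 <= q < n) a q * \sum_(i < q) (1 : R) ^+ i.
  apply: eq_bigr => q _; rewrite mulrC; congr (_ * _).
  by under eq_bigr do rewrite expr1n; rewrite sumr_const card_ord.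
apply: (ler_cvg_to h1 hk1); near=> t.
have t1 : t < 1 by near: t; exact: nbhs_left_lt.
have t0 : 0 < t by near: t; exact: nbhs_left_gt.
rewrite ler_pdivlMr ?subr_gt0// big_distrl /=.
have tn : `|t| <= 1 by rewrite ger0_norm ltW.
apply: (ler_cvg_to (cvg_cst _) (pser_geom_cvg tn)); near=> N.
have nN : (n <= N)%N by near: N; exact: nbhs_infty_ge.
rewrite /series /= [leRHS](big_cat_nat _ nN)//= lerDl sumr_ge0// => q _.
by rewrite mulr_ge0 ?subr_ge0 ?(ltW t1)// mulr_ge0// sumr_ge0// => i _; rewrite exprn_ge0 ?ltW.
Unshelve. all: by end_near. Qed.

Lemma k1_ge0 : 0 <= k1.
Proof. by have := derivative_partial_sum 0; rewrite big_nil. Qed.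

Lemma pser_lip (s t : R) : `|s| <= 1 -> `|t| <= 1 ->
  `|pser s - pser t| <= k1 * `|s - t|.
Proof.
move=> s1 t1.
have h : (fun n => `|series (fun q => a q * s ^+ q) n - series (fun q => a q * t ^+ q) n|)
    @ \oo --> `|pser s - pser t|.
  by apply: cvg_norm; apply: cvgB; exact: pser_cvg.
apply: (ler_cvg_to h (cvg_cst (k1 * `|s - t|))); near=> n.
rewrite /series /= -sumrB; apply: (le_trans (ler_norm_sum _ _ _)).
apply: le_trans (ler_wpM2r (normr_ge0 _) (derivative_partial_sum n)).
rewrite big_distrl /=; apply: ler_sum => q _.
rewrite -mulrBr normrM (ger0_norm (a_ge0 q)) mulrAC mulrC.
by rewrite ler_wpM2r// normr_subXX.
Unshelve. all: by end_near. Qed.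

(** In the series of a_r (1 + ... + t^(r-1)) (1 - t) every geometric sum is bounded by r, except the
    one of index [q], which is kept exactly. What it lacks from [q] is the gain over the linear
    bound [k1 * (1 - t)]. *)
Lemma pser_gap (t : R) q : `|t| <= 1 ->
  1 - pser t <= (k1 - a q * (q%:R - \sum_(i < q) t ^+ i)) * (1 - t).
Proof.
move=> t1.
apply: (ler_cvg_to (pser_geom_cvg t1) (cvg_cst _)); near=> N.
have qN : (q < N)%N by near: N; exact: nbhs_infty_gt.
have t1' : t <= 1 by rewrite (le_trans (ler_norm _)).
rewrite /series /= -big_distrl /= ler_wpM2r ?subr_ge0//.
rewrite lerBrDr; apply: le_trans (derivative_partial_sum N).
rewrite -lerBrDl -sumrB !big_mkord (bigD1 (Ordinal qN))//= (mulrC _ (a q)) -mulrBr.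
rewrite lerDl sumr_ge0// => i _; rewrite (mulrC _ (a i)) -mulrBr mulr_ge0// subr_ge0.
apply: (@le_trans _ _ (\sum_(j < i) 1)); last by rewrite sumr_const card_ord.
by apply: ler_sum => j _; rewrite (le_trans (ler_norm _))// normrX_le1.
Unshelve. all: by end_near. Qed.

Context (k1_le1 : k1 <= 1) (q0 : nat) (q0_ge2 : (2 <= q0)%N) (aq0 : 0 < a q0).

Lemma k1_gt0 : 0 < k1.
Proof.
apply: lt_le_trans (derivative_partial_sum q0.+1).
rewrite big_nat_recr//= ltr_wpDl ?sumr_ge0//.
  by move=> i _; rewrite mulr_ge0.
by rewrite mulr_gt0// ltr0n (leq_trans _ q0_ge2).
Qed.

(** The geometric sum of length [q0] contains the term t < 1 because [q0 >= 2], so the gain in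
    [pser_gap] is strictly positive. Hence 1 is the only fixed point in [-1, 1]. *)
Lemma pser_gt (t : R) : -1 <= t < 1 -> t < pser t.
Proof.
move=> /andP[tm1 t1]; have tn : `|t| <= 1 by rewrite ler_norml tm1 ltW.
have := pser_gap q0 tn.
have h : \sum_(i < q0) t ^+ i < q0%:R.
  move: q0_ge2; case: (q0) => [//|[//|q]] _.
  rewrite 2!big_ord_recl /= expr0 expr1 -natr1 -natr1 addrC -addrA.
  have : \sum_(i < q) t ^+ (bump 0 (bump 0 i)) <= q%:R.
    apply: (@le_trans _ _ (\sum_(j < q) 1)); last by rewrite sumr_const card_ord.
    by apply: ler_sum => j _; rewrite (le_trans (ler_norm _))// normrX_le1.
  by move: t1; lra.
have : 0 < a q0 * (q0%:R - \sum_(i < q0) t ^+ i) by rewrite mulr_gt0 ?subr_gt0.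
set y := a q0 * _ => y0.
have : (k1 - y) * (1 - t) < 1 - t.
  by rewrite gtr_pMl ?subr_gt0//; move: k1_le1; lra.
by lra.
Qed.

(** On [-1, 0] the gain is bounded below: the geometric sum is at most 1 while [q0 >= 2], so the gap
    to 1 shrinks by a fixed factor. *)
Lemma pser_contract (t : R) : -1 <= t <= 0 -> 1 - pser t <= (1 - a q0) * (1 - t).
Proof.
move=> /andP[tm1 t0]; have tn : `|t| <= 1 by rewrite ler_norml tm1 (le_trans t0).
apply: (le_trans (pser_gap q0 tn)); rewrite ler_wpM2r//; first lra.
(* After multiplying by 1 - t > 0 this reads t <= t^q0, true for t in [-1, 0] and q0 >= 1. *)
have h : \sum_(i < q0) t ^+ i <= 1.
  have t1 : 0 < 1 - t by lra.
  rewrite -(ler_pM2r t1) geometric_sumE mul1r lerD2l lerN2.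
  move: q0_ge2; case: (q0) => [//|q] _.
  rewrite exprS; have : `|t ^+ q| <= 1 by exact: normrX_le1.
  by rewrite ler_norml => /andP[h1 h2]; nra.
have : 1 <= q0%:R - \sum_(i < q0) t ^+ i.
  have : 2 <= q0%:R :> R by rewrite ler_nat.
  by lra.
by move: k1_le1 aq0 => ? ? ?; nra.
Qed.

Lemma iter_pser_le1 L (t : R) : `|t| <= 1 -> `|iter L pser t| <= 1.
Proof. by move=> t1; elim: L => //= L; exact: pser_le1. Qed.

Lemma iter_pser_lip L (s t : R) : `|s| <= 1 -> `|t| <= 1 ->
  `|iter L pser s - iter L pser t| <= `|s - t|.
Proof.
move=> s1 t1; elim: L => //= L IH.
apply: (le_trans (pser_lip (iter_pser_le1 L s1) (iter_pser_le1 L t1))).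
by apply: le_trans IH; rewrite ler_piMl.
Qed.

Lemma iter_pser_gap_ge0 L (t : R) : `|t| <= 1 -> 0 <= 1 - iter L pser t.
Proof.
by move=> /(iter_pser_le1 L); rewrite ler_norml subr_ge0 => /andP[].
Qed.

Lemma iter_pser_gapS L (t : R) : `|t| <= 1 ->
  1 - iter L.+1 pser t <= k1 * (1 - iter L pser t).
Proof.
move=> t1; have h := iter_pser_le1 L t1.
rewrite -(ger0_norm (iter_pser_gap_ge0 L t1)).
have := @pser_lip 1 _ _ h; rewrite normr1 lexx pser1 => /(_ isT).
by apply: le_trans; rewrite ler_norm.
Qed.

(** The gaps decrease to some [l]; by continuity 1 - l is a fixed point, so [pser_gt] excludes l >
    0. *)
Lemma iter_pser_gap_cvg0 (t : R) : `|t| <= 1 ->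
  (fun L => 1 - iter L pser t) @ \oo --> (0 : R).
Proof.
move=> t1; set u := fun L => _.
have ucv : cvgn u.
  apply: nonincreasing_is_cvgn; last first.
    by exists 0 => _ [L _ <-]; exact: iter_pser_gap_ge0.
  apply/nonincreasing_seqP => L; apply: (le_trans (iter_pser_gapS L t1)).
  by rewrite ler_piMl// iter_pser_gap_ge0.
suff -> : 0 = limn u :> R by [].
set l := limn u.
have l0 : 0 <= l by apply: limr_ge => //; near=> L; exact: iter_pser_gap_ge0.
have l2 : l <= 2.
  apply: limr_le => //; near=> L; rewrite /u.
  by have := iter_pser_le1 L t1; rewrite ler_norml; lra.
have l1 : `|1 - l| <= 1 by rewrite ler_norml; lra.
have cv : (fun L => iter L pser t) @ \oo --> 1 - l.
  rewrite (_ : (fun L => _) = fun L => 1 - u L); last first.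
    by apply/funext => L; rewrite /u subKr.
  by apply: cvgB; [exact: cvg_cst|exact: ucv].
have cvS : (fun L => iter L.+1 pser t) @ \oo --> 1 - l.
  by rewrite (cvg_shiftS (fun L => iter L pser t)).
have cvP : (fun L => iter L.+1 pser t) @ \oo --> pser (1 - l).
  apply/cvgrPdist_le => e e0; near=> L.
  apply: (le_trans (pser_lip l1 (iter_pser_le1 L t1))).
  apply: (@le_trans _ _ (`|(1 - l) - iter L pser t|)); first by rewrite ler_piMl.
  by near: L; move/cvgrPdist_le : cv; exact.
have fix_l : pser (1 - l) = 1 - l by exact: (cvg_unique _ cvP cvS).
apply/eqP; rewrite eq_le l0 /= leNgt; apply/negP => lp.
have : 1 - l < pser (1 - l) by apply: pser_gt; lra.
by rewrite fix_l ltxx.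
Unshelve. all: by end_near. Qed.

Lemma pser_bnd0_1 (t : R) : `|t| <= 1 -> 0 <= t -> 0 <= pser t <= 1.
Proof.
move=> t1 t0; have := iter_pser_gapS 0 t1; rewrite /=.
have := pser_le1 t1; rewrite ler_norml => /andP[_ ->] h; rewrite andbT.
have : k1 * (1 - t) <= 1 - t.
  by rewrite ler_piMl// subr_ge0 (le_trans (ler_norm _)).
by lra.
Qed.

Lemma iter_pser_homo0 L (t : R) : 0 <= t <= 1 ->
  iter L pser 0 <= iter L pser t /\ 0 <= iter L pser 0.
Proof.
move=> /andP[t0 t1]; elim: L => [//|L [IH1 IH2]] /=.
have h0 : `|iter L pser 0| <= 1 by apply: iter_pser_le1; rewrite normr0.
have ht : `|iter L pser t| <= 1 by apply: iter_pser_le1; rewrite ger0_norm.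
split; last by have /andP[] := pser_bnd0_1 h0 IH2.
by apply: pser_homo => //; rewrite (le_trans (ler_norm _)).
Qed.

(** The number of steps is uniform in [t]. This gives access to monotonicity, available on [0, 1]
    only, when bounding all orbits by the orbit of 0. *)
Lemma iter_pser_unif_ge0 : exists N, forall t : R, `|t| <= 1 -> 0 <= iter N pser t.
Proof.
have a1 : a q0 <= 1.
  have := derivative_partial_sum q0.+1; rewrite big_nat_recr//= => h.
  have h0 : 0 <= \sum_(0 <= i < q0) i%:R * a i.
    by rewrite sumr_ge0// => i _; rewrite mulr_ge0.
  have : 1 <= q0%:R :> R by rewrite ler1n (leq_trans _ q0_ge2).
  by move: k1_le1 aq0 => ? ? ?; nra.
(* As long as an orbit stays negative, its gap, initially at most 2, is multiplied by at most 1 - a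
   q0 at each step; once the gap is at most 1, the orbit is nonnegative and stays so. *)
have hb N (t : R) : `|t| <= 1 ->
    0 <= iter N pser t \/ 1 - iter N pser t <= (1 - a q0) ^+ N * 2.
  move=> t1; elim: N => [|N IH] /=.
    by right; rewrite expr0 mul1r; move: t1; rewrite ler_norml; lra.
  have h1 := iter_pser_le1 N t1.
  have [h|h] := leP 0 (iter N pser t).
    by left; have /andP[] := pser_bnd0_1 h1 h.
  case: IH => [h'|IH]; first by move: h; lra.
  right; apply: (@le_trans _ _ ((1 - a q0) * (1 - iter N pser t))).
    apply: pser_contract; rewrite (ltW h) andbT.
    by move: h1; rewrite ler_norml => /andP[].
  by rewrite exprS -mulrA ler_wpM2l// subr_ge0.
have : (fun N => (1 - a q0) ^+ N * 2) @ \oo --> (0 * 2 : R).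
  apply: cvgM; last exact: cvg_cst.
  by apply: cvg_expr; rewrite ger0_norm ?subr_ge0//; move: aq0; lra.
rewrite mul0r => /cvgrPdist_le /(_ 1 ltr01) [N _ /(_ N (leqnn _)) /= hN].
exists N => t t1; case: (hb N t t1) => // h.
have : (1 - a q0) ^+ N * 2 <= 1.
  by apply: le_trans hN; rewrite sub0r normrN ler_norm.
by lra.
Qed.

End PowerSeries.

(** * Asymptotics of slowly decreasing recursive sequences *)

Section Recursion.
Context {R : realType}.

Lemma powR_continuous_pos (p x : R) : 0 < x -> {for x, continuous (fun y => y `^ p)}.
Proof.
move=> x0; apply: differentiable_continuous; apply/derivable1_diffP.
by have [] := is_derive1_powR p x0.
Qed.

Lemma powR_seq_cvg0 (u : nat -> R) (s : R) : 0 < s -> (forall n, 0 <= u n) ->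
  u @ \oo --> (0 : R) -> (fun n => u n `^ s) @ \oo --> (0 : R).
Proof.
move=> s0 u0 ucv; have s0' : s != 0 by rewrite gt_eqF.
apply/cvgrPdist_le => e e0; near=> n.
rewrite sub0r normrN ger0_norm ?powR_ge0//.
have -> : e = (e `^ s^-1) `^ s by rewrite -powRrM mulVf// powRr1// ltW.
rewrite ge0_ler_powR ?nnegrE ?powR_ge0// ?ltW//.
near: n; have /cvgrPdist_lt /(_ (e `^ s^-1)) := ucv.
rewrite powR_gt0// => /(_ isT); apply: filterS => n.
by rewrite sub0r normrN ger0_norm// ltW.
Unshelve. all: by end_near. Qed.

Lemma powR_diff_quotient (p : R) (r : nat -> R) :
  (forall n, r n < 1) -> r @ \oo --> (1 : R) ->
  (fun n => (r n `^ p - 1) / (r n - 1)) @ \oo --> p.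
Proof.
move=> r1 rcv.
have [dp] := is_derive1_powR p (@ltr01 R).
rewrite powR1 mulr1 => Dp.
have h : (fun t : R => (t `^ p - 1) / (t - 1)) @ (1 : R)^'- --> p.
  have : (fun h : R => h^-1 *: ((h *: 1 + 1) `^ p - 1 `^ p)) @ (0 : R)^' --> p.
    move: dp => /cvg_ex[l dl].
    have pl : p = l by rewrite -Dp; exact: cvg_lim dl.
    by rewrite [X in _ --> X]pl; exact: dl.
  move=> /cvgrPdist_le dd; apply/cvgrPdist_le => e e0.
  have [d /= d0 dP] := dd _ e0; near=> t.
  have t1 : t < 1 by near: t; exact: nbhs_left_lt.
  have := dP (t - 1); rewrite /= powR1 /GRing.scale /= mulr1 subrK mulrC.
  apply; last by rewrite lt_eqF// subr_lt0.
  rewrite sub0r normrN distrC.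
  rewrite ger0_norm ?subr_ge0 ?ltW//.
  by near: t; exact: nbhs_left_ltBl.
by move/cvg_at_leftP : h; apply.
Unshelve. all: by end_near. Qed.

(** The substitution z = u^(-s) linearizes the recursion: u_n - u_{n+1} ~ c u_n^(1+s) gives z_{n+1}
    - z_n -> c s, so z_n / n -> c s by Cesaro means, and the power -1/s returns to u. *)
Lemma recursion_asymptotics (u : nat -> R) (c s : R) : 0 < c -> 0 < s ->
  (forall n, 0 < u n) -> (forall n, u n.+1 < u n) -> u @ \oo --> (0 : R) ->
  (fun n => (u n - u n.+1) / u n `^ (1 + s)) @ \oo --> c ->
  (fun n => n%:R `^ s^-1 * u n) @ \oo --> (c * s) `^ (- s^-1).
Proof.
move=> c0 s0 u0 udec ucv ccv.
have s0' : s != 0 by rewrite gt_eqF.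
set cn := fun n => _ in ccv.
pose r n := u n.+1 / u n.
have rE n : r n - 1 = - (u n `^ s * cn n).
  rewrite /r /cn powRD ?powRr1 ?(ltW (u0 n))//; last first.
    by apply/implyP => _; rewrite gt_eqF.
  have uu : u n `^ s != 0 by rewrite gt_eqF// powR_gt0.
  have un : u n != 0 by rewrite gt_eqF.
  by field; rewrite un uu.
have us0 : (fun n => u n `^ s) @ \oo --> (0 : R).
  by apply: powR_seq_cvg0 => // n; rewrite ltW.
have rcv : r @ \oo --> (1 : R).
  have : (fun n => 1 - u n `^ s * cn n) @ \oo --> (1 - 0 * c : R).
    by apply: cvgB; [exact: cvg_cst|exact: cvgM].
  rewrite mul0r subr0; apply: cvg_trans; apply: near_eq_cvg; near=> n.
  by rewrite -rE addrC subrK.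
have r1 n : r n < 1 by rewrite /r ltr_pdivrMr// mul1r.
have r0 n : 0 < r n by rewrite /r divr_gt0.
have qcv := powR_diff_quotient (p := - s) r1 rcv.
pose z n := u n `^ (- s).
(* With r = u_{n+1}/u_n, the increment of z is u_n^(-s) (r^(-s) - 1), and r - 1 = - u_n^s [cn]. So
   it equals minus the difference quotient of x^(-s) at 1, which tends to -s, times [cn n]. *)
have zcv : telescope z @ \oo --> c * s.
  have : (fun n => - ((r n `^ (- s) - 1) / (r n - 1)) * cn n) @ \oo --> - (- s) * c.
    by apply: cvgM => //; exact: cvgN.
  rewrite opprK mulrC; apply: cvg_trans; apply: near_eq_cvg; near=> n.
  have uE : u n.+1 = r n * u n by rewrite /r mulfVK// gt_eqF.
  have rn : r n - 1 != 0 by rewrite lt_eqF// subr_lt0.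
  have uu : u n `^ s != 0 by rewrite gt_eqF// powR_gt0.
  have -> : cn n = - (r n - 1) / u n `^ s by rewrite rE; field.
  have -> : telescope z n = z n.+1 - z n by [].
  rewrite /z uE powRM ?(ltW (r0 n)) ?(ltW (u0 n))// powRN.
  have rr : r n `^ s != 0 by rewrite gt_eqF// powR_gt0.
  by rewrite (powRN (u n)); field; rewrite rn uu rr.
have zn : (fun n => z n.+1 / n.+1%:R) @ \oo --> c * s.
  have := cesaro zcv; rewrite /arithmetic_mean telescopeK => h.
  have h2 : (fun n => z 0%N * n.+1%:R^-1) @ \oo --> z 0%N * 0.
    by apply: cvgM; [exact: cvg_cst|exact: cvg_harmonic].
  have : (fun n => n.+1%:R^-1 * (z n.+1 - z 0%N) + z 0%N * n.+1%:R^-1) @ \oo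
      --> c * s + z 0%N * 0 by exact: cvgD.
  rewrite mulr0 addr0; apply: cvg_trans.
  by apply: near_eq_cvg; near=> n; ring.
have cs0 : 0 < c * s by rewrite mulr_gt0.
rewrite -(cvg_shiftS (fun n => n%:R `^ s^-1 * u n)) /=.
have := cvg_comp _ _ zn (powR_continuous_pos (p := - s^-1) cs0).
apply: cvg_trans; apply: near_eq_cvg; near=> n => /=.
rewrite powRM ?powR_ge0 ?invr_ge0//.
rewrite /z -powRrM mulrNN divff// powRr1 ?ltW//.
by rewrite -powR_inv1// -powRrM mulN1r opprK mulrC.
Unshelve. all: by end_near. Qed.

End Recursion.

(** * Rescaled gaps in the subcritical and critical cases *)

Section Speed.
Context {R : realType} (a : nat -> R).
Context (a_ge0 : forall q, 0 <= a q) (a_sum1 : series a @ \oo --> (1 : R)).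
Context (k1 : R)
  (hk1 : (fun t : R => (1 - pser a t) / (1 - t)) @ (1 : R)^'- --> k1).
Context (k1_le1 : k1 <= 1) (q0 : nat) (q0_ge2 : (2 <= q0)%N) (aq0 : 0 < a q0).
Context (c rho : R) (hcrho : k1 = 1 ->
     [/\ c != 0, 1 < rho &
         (fun t : R => (1 - pser a t - (k1 * (1 - t) - c * (1 - t) `^ rho))
                       / (1 - t) `^ rho) @ (1 : R)^'- --> (0 : R)]).

Lemma critical_coef_cvg : k1 = 1 ->
  (fun t : R => (pser a t - t) / (1 - t) `^ rho) @ (1 : R)^'- --> c.
Proof.
move=> k11; have [_ _ h] := hcrho k11.
have : (fun t : R => c - (1 - pser a t - (k1 * (1 - t) - c * (1 - t) `^ rho))
                       / (1 - t) `^ rho) @ (1 : R)^'- --> c - 0.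
  by apply: cvgB; [exact: cvg_cst|exact: h].
rewrite subr0; apply: cvg_trans; apply: near_eq_cvg; near=> t.
have t1 : t < 1 by near: t; exact: nbhs_left_lt.
have tn : (1 - t) `^ rho != 0 by rewrite gt_eqF// powR_gt0// subr_gt0.
by rewrite k11; field.
Unshelve. all: by end_near. Qed.

(** The expansion gives c as the limit of (kappa(t) - t)/(1 - t)^rho, and kappa(t) > t forces the
    sign. *)
Lemma critical_coef_gt0 : k1 = 1 -> 0 < c.
Proof.
move=> k11; have [c0 _ _] := hcrho k11.
rewrite lt_neqAle eq_sym c0 /=.
apply: (ler_cvg_to (cvg_cst 0) (critical_coef_cvg k11)); near=> t.
have t1 : t < 1 by near: t; exact: nbhs_left_lt.
have tm1 : 0 < t by near: t; exact: nbhs_left_gt.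
rewrite divr_ge0 ?powR_ge0// subr_ge0 ltW//.
by apply: (pser_gt a_ge0 a_sum1 hk1 k1_le1 q0_ge2 aq0); rewrite t1; lra.
Unshelve. all: by end_near. Qed.

(** For k1 < 1 the rescaled gap is nonincreasing, because u_{L+1} <= k1 u_L. For k1 = 1 the
    expansion at 1 is the recursion of [recursion_asymptotics] with s = rho - 1. *)
Lemma speed_gap_cvg (t : R) : `|t| <= 1 ->
  cvgn (fun L => speed k1 rho L * (1 - iter L (pser a) t)).
Proof.
move=> t1; have k10 := k1_gt0 a_ge0 a_sum1 hk1 q0_ge2 aq0.
rewrite /speed; case: ltP => k1l.
  apply: nonincreasing_is_cvgn; last first.
    exists 0 => _ [L _ <-]; rewrite mulr_ge0 ?(iter_pser_gap_ge0 a_ge0 a_sum1)//.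
    by rewrite invr_ge0 exprn_ge0// ltW.
  apply/nonincreasing_seqP => L.
  rewrite exprS invfM mulrAC mulrC ler_wpM2l ?invr_ge0 ?exprn_ge0 ?(ltW k10)//.
  rewrite ler_pdivrMl//.
  exact: (iter_pser_gapS a_ge0 a_sum1 hk1).
have k11 : k1 = 1 by apply/eqP; rewrite eq_le k1_le1.
have [c0 rho1 hc] := hcrho k11.
(* An orbit may reach 1 exactly, at t = 1 or at t = -1 when kappa(-1) = 1; it then stays there and
   the limit is 0. Otherwise all gaps are positive, as the recursion lemma requires. *)
have [[N uN]|u0] := pselect (exists N, 1 - iter N (pser a) t = 0).
  apply/cvg_ex; exists 0; apply: cvg_near_cst; near=> L.
  have NL : (N <= L)%N by near: L; exact: nbhs_infty_ge.
  rewrite -(subnK NL) iterD (_ : iter N _ t = 1); last by move: uN; lra.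
  rewrite (_ : iter _ _ 1 = 1) ?subrr ?mulr0//.
  by elim: (L - N)%N => //= n ->; exact: pser1.
pose u L := 1 - iter L (pser a) t.
have up L : 0 < u L.
  rewrite lt_neqAle (iter_pser_gap_ge0 a_ge0 a_sum1)// andbT eq_sym.
  by apply/eqP => uL; apply: u0; exists L.
have tb L : -1 <= iter L (pser a) t < 1.
  have := iter_pser_le1 a_ge0 a_sum1 L t1; rewrite ler_norml => /andP[-> _] /=.
  by rewrite -subr_gt0; exact: up.
have ud L : u L.+1 < u L.
  rewrite /u ltrD2l ltrN2 /=.
  by apply: (pser_gt a_ge0 a_sum1 hk1 k1_le1 q0_ge2 aq0).
have ucv : u @ \oo --> (0 : R).
  exact: (iter_pser_gap_cvg0 a_ge0 a_sum1 hk1 k1_le1 q0_ge2 aq0).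
apply/cvg_ex; eexists.
apply: (recursion_asymptotics (critical_coef_gt0 k11) _ up ud ucv).
  by rewrite subr_gt0.
have /cvg_at_leftP hl := critical_coef_cvg k11.
have : (fun L => iter L (pser a) t) @ \oo --> (1 : R).
  have : (fun L => 1 - u L) @ \oo --> (1 - 0 : R).
    by apply: cvgB => //; exact: cvg_cst.
  rewrite subr0; apply: cvg_trans; apply: near_eq_cvg; near=> L.
  by rewrite /u subKr.
move=> tcv; have := hl (fun L => iter L (pser a) t) (conj (fun L => proj2 (andP (tb L))) tcv).
rewrite (_ : 1 + (rho - 1) = rho); last by ring.
apply: cvg_trans; apply: near_eq_cvg; near=> L.
by rewrite /u /=; congr (_ / _); ring.
Unshelve. all: by end_near. Qed.

Lemma speed_ge0 L : 0 <= speed k1 rho L.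
Proof.
have k10 := k1_ge0 a_ge0 a_sum1 hk1.
by rewrite /speed; case: ifP => _; rewrite ?powR_ge0// invr_ge0 exprn_ge0.
Qed.

(** Supplies the constant majorant for dominated convergence over [-1, 1]. *)
Lemma speed_gap_bounded : exists M, forall L (t : R), `|t| <= 1 ->
  speed k1 rho L * (1 - iter L (pser a) t) <= M.
Proof.
have k10 := k1_gt0 a_ge0 a_sum1 hk1 q0_ge2 aq0.
have h2 L (t : R) : `|t| <= 1 -> 1 - iter L (pser a) t <= 2.
  by move=> /(iter_pser_le1 a_ge0 a_sum1 L); rewrite ler_norml; lra.
have [k1l|k1l] := ltP k1 1.
  exists 2 => L t t1; rewrite /speed k1l.
  apply: le_trans (h2 0%N t t1).
  elim: L => [|L IH]; first by rewrite expr0 invr1 mul1r.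
  apply: le_trans IH.
  rewrite exprS invfM mulrAC mulrC ler_wpM2l ?invr_ge0 ?exprn_ge0 ?(ltW k10)//.
  rewrite ler_pdivrMl//.
  exact: (iter_pser_gapS a_ge0 a_sum1 hk1).
have k11 : k1 = 1 by apply/eqP; rewrite eq_le k1_le1.
have [c0 rho1 hc] := hcrho k11.
(* After [N] steps every orbit lies in [0, 1], so by monotonicity its gap is at most that of the
   orbit of 0, whose rescaled gaps converge and hence are bounded by [M0]. *)
have [N hN] := iter_pser_unif_ge0 a_ge0 a_sum1 hk1 k1_le1 q0_ge2 aq0.
have n0 : `|0 : R| <= 1 by rewrite normr0.
have [M0 hM0'] := cvg_has_ub (speed_gap_cvg n0).
have hM0 K : `|speed k1 rho K * (1 - iter K (pser a) 0)| <= M0.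
  by apply: hM0'; exists K.
have M00 : 0 <= M0 by apply: le_trans (hM0 0%N).
have e0 : 0 <= (rho - 1)^-1 by rewrite invr_ge0 subr_ge0 ltW.
have N1 : 1 <= (N.+1%:R : R) `^ (rho - 1)^-1.
  rewrite [leLHS](_ : _ = 1 `^ (rho - 1)^-1); last by rewrite powR1.
  by rewrite ge0_ler_powR ?nnegrE ?ler1n.
exists (N.+1%:R `^ (rho - 1)^-1 * (M0 + 2)) => L t t1.
have ug := iter_pser_gap_ge0 a_ge0 a_sum1 L t1.
rewrite /speed ltNge k1l /=.
have [LN|NL] := leqP L N.
  apply: ler_pM; rewrite ?powR_ge0//.
    by rewrite ge0_ler_powR ?nnegrE// ler_nat leqW.
  by apply: (le_trans (h2 L t t1)); rewrite lerDr.
have -> : L = ((L - N) + N)%N by rewrite subnK// ltnW.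
have : (0 < L - N)%N by rewrite subn_gt0.
move: (L - N)%N => K K0.
rewrite iterD; set s := iter N _ t.
have s01 : 0 <= s <= 1.
  rewrite hN//=; have := iter_pser_le1 a_ge0 a_sum1 N t1.
  by rewrite ler_norml => /andP[].
have [h _] := iter_pser_homo0 a_ge0 a_sum1 hk1 k1_le1 K s01.
have h0 := iter_pser_gap_ge0 a_ge0 a_sum1 K n0.
(* With L = N + K and K >= 1, L <= (N + 1) K, so the delay of [N] steps costs only a constant factor
   in the speed. *)
apply: (@le_trans _ _ ((N.+1%:R * K%:R) `^ (rho - 1)^-1 * (1 - iter K (pser a) 0))).
  apply: ler_pM; rewrite ?powR_ge0//.
  - apply: (iter_pser_gap_ge0 a_ge0 a_sum1 K).
    by have /andP[s0 s1] := s01; rewrite ger0_norm.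
  - rewrite ge0_ler_powR ?nnegrE ?mulr_ge0// -natrM ler_nat mulSn leq_add2l.
    by rewrite -{1}[N]muln1 leq_mul2l K0 orbT.
  - by lra.
rewrite powRM// -mulrA ler_wpM2l ?powR_ge0//.
have := hM0 K; rewrite /speed ltNge k1l /= ger0_norm ?mulr_ge0 ?powR_ge0//.
by lra.
Unshelve. all: by end_near. Qed.

Lemma speed_cvgy : speed k1 rho @ \oo --> +oo.
Proof.
have k10 := k1_gt0 a_ge0 a_sum1 hk1 q0_ge2 aq0.
have [k1l|k1l] := ltP k1 1.
  rewrite (_ : speed k1 rho = fun L => k1 ^- L); last first.
    by apply/funext => L; rewrite /speed k1l.
  apply/cvgryPge => A.
  have A0 : 0 < Num.max A 1 by rewrite lt_max ltr01 orbT.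
  near=> L.
  apply: (@le_trans _ _ (Num.max A 1)); first by rewrite le_max lexx.
  rewrite -[leLHS]invrK lef_pV2 ?posrE ?invr_gt0// ?exprn_gt0//.
  near: L; have : `|k1| < 1 by rewrite gtr0_norm.
  move=> /cvg_expr /cvgrPdist_le /(_ (Num.max A 1)^-1).
  rewrite invr_gt0 => /(_ A0); apply: filterS => L.
  by rewrite sub0r normrN ger0_norm// exprn_ge0// ltW.
have k11 : k1 = 1 by apply/eqP; rewrite eq_le k1_le1.
have [c0 rho1 hc] := hcrho k11.
rewrite (_ : speed k1 rho = fun L => L%:R `^ (rho - 1)^-1); last first.
  by apply/funext => L; rewrite /speed ltNge k1l.
apply/cvgryPge => A; near=> L.
have A0 : 0 < Num.max A 1 by rewrite lt_max ltr01 orbT.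
apply: (@le_trans _ _ (Num.max A 1)); first by rewrite le_max lexx.
have r0 : rho - 1 != 0 by rewrite gt_eqF// subr_gt0.
have -> : Num.max A 1 = (Num.max A 1 `^ (rho - 1)) `^ (rho - 1)^-1.
  by rewrite -powRrM divff// powRr1// ltW.
rewrite ge0_ler_powR ?nnegrE ?invr_ge0 ?subr_ge0 ?(ltW rho1) ?powR_ge0//.
near: L; exact: nbhs_infty_ger.
Unshelve. all: by end_near. Qed.

End Speed.

(** * Weighted integrals on [-1, 1] *)

Section Weight.
Context {R : realType}.
Notation mu := (@lebesgue_measure R).
Notation D := (`[-1, 1]%classic : set R).

(** The slice weight of the sphere of dimension d = n + 1; the exponent is d/2 - 1, as in
    [gegen_avg]. *)
Definition sph_weight (n : nat) (t : R) : R := (1 - t ^+ 2) `^ ((n%:R - 1) / 2).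

Lemma sph_weight_ge0 n t : 0 <= sph_weight n t.
Proof. exact: powR_ge0. Qed.

Lemma measurable_sph_weight n (A : set R) : measurable_fun A (sph_weight n).
Proof.
apply: (measurableT_comp (measurable_powR _)).
by apply: measurable_funB => //; exact: measurable_funX.
Qed.

Lemma is_derive_sph_weight (p t : R) : -1 < t < 1 ->
  is_derive t 1 (fun s => (1 - s ^+ 2) `^ p)
    (p * (1 - t ^+ 2) `^ (p - 1) * (- (2 * t))).
Proof.
move=> t1; apply: (@is_derive1_comp _ (fun x => x `^ p) (fun s => 1 - s ^+ 2)).
  by apply: is_derive1_powR; rewrite subr_gt0; nra.
have -> : (fun s : R => 1 - s ^+ 2) = cst 1 - (@id R) ^+ 2 by [].
by apply: is_derive_eq; rewrite /= sub0r /GRing.scale /= mulr1 expr1.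
Qed.

(** For n = 0 the weight is unbounded near the endpoints; on these closed subintervals it is smooth
    and the fundamental theorem of calculus applies. *)
Definition inner_itv (k : nat) : set R := `[-1 + k.+2%:R^-1, 1 - k.+2%:R^-1]%classic.

Lemma inner_itv_homo : {homo inner_itv : m n / (m <= n)%N >-> (m <= n)%O}.
Proof.
move=> m n mn; apply/subsetPset => x; rewrite /inner_itv /= !in_itv /=.
have : n.+2%:R^-1 <= m.+2%:R^-1 :> R by rewrite lef_pV2 ?posrE// ler_nat.
by move: (_^-1) (_^-1) => u v; lra.
Qed.

Lemma bigcup_inner_itv : \bigcup_k inner_itv k = `]-1, 1[%classic.
Proof.
apply/seteqP; split=> [x [k _]|x]; rewrite /inner_itv /= !in_itv /=.
  have : 0 < k.+2%:R^-1 :> R by rewrite invr_gt0.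
  by move: (_^-1) => u; lra.
move=> /andP[x1 x2].
have [k k1] : exists k, k.+1%:R^-1 < Num.min (x + 1) (1 - x).
  have : 0 < Num.min (x + 1) (1 - x) by rewrite lt_min; lra.
  by move=> /ltr_add_invr[k]; rewrite add0r; exists k.
exists k => //=; rewrite in_itv /=.
have : k.+2%:R^-1 <= k.+1%:R^-1 :> R by rewrite lef_pV2 ?posrE// ler_nat.
by move: k1; rewrite lt_min; move: (k.+1%:R^-1) (k.+2%:R^-1) => u v; lra.
Qed.

Lemma integrable_oo_cc (f : R -> R) : measurable_fun D f ->
  mu.-integrable `]-1, 1[ (EFin \o f) -> mu.-integrable D (EFin \o f).
Proof.
move=> mf /integrableP[_ h]; apply/integrableP; split; first exact/measurable_EFinP.
rewrite -integral_itv_bndo_bndc; last first.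
  apply: measurableT_comp => //; apply/measurable_EFinP.
  apply: measurable_funS mf => //; exact: subset_itv_co_cc.
rewrite -integral_itv_obnd_cbnd//.
apply: measurableT_comp => //; apply/measurable_EFinP.
apply: measurable_funS mf => //; exact: subset_itv_oo_cc.
Qed.

(** For n >= 1 the weight is at most 1. For n = 0 it is the derivative of arcsine, so its integrals
    over the inner intervals are at most pi, and monotone convergence concludes. *)
Lemma integrable_sph_weight n : mu.-integrable D (EFin \o sph_weight n).
Proof.
have mw := measurable_sph_weight n.
apply: integrable_oo_cc => //.
case: n mw => [|n] mw; last first.
  apply: (@le_integrable _ _ _ _ _ _ _ (EFin \o cst 1)) => //.
  - by apply/measurable_EFinP; exact: mw.
  - move=> x /=; rewrite in_itv /= lee_fin normr1 => x1.
    rewrite ger0_norm ?sph_weight_ge0// /sph_weight.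
    have e1 : 1 = 1 `^ ((n.+1%:R - 1) / 2) :> R by rewrite powR1.
    rewrite [leRHS]e1 ge0_ler_powR ?nnegrE//; nra.
  - apply: (@integrableS _ _ _ mu D) => //; first exact: subset_itv_oo_cc.
    apply: continuous_compact_integrable; first exact: segment_compact.
    by apply: continuous_subspaceT => x; exact: cvg_cst.
apply/integrableP; split; first by apply/measurable_EFinP; exact: mw.
under eq_integral do rewrite /= ger0_norm ?sph_weight_ge0//.
rewrite -bigcup_inner_itv.
have h := @ge0_nondecreasing_set_cvg_integral _ (measurableTypeR R) R inner_itv (EFin \o sph_weight 0) mu.
apply: (@le_lt_trans _ _ (pi : R)%:E); last exact: ltry.
apply: (cvge_le _ (h _ _ _ _)); last 4 first.
- exact: inner_itv_homo.
- by move=> k; exact: measurable_itv.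
- by move=> k; apply/measurable_EFinP; exact: mw.
- by move=> k x _; rewrite lee_fin sph_weight_ge0.
near=> k.
have k0 : 0 < k.+2%:R^-1 :> R by rewrite invr_gt0.
have k1 : k.+2%:R^-1 <= 2^-1 :> R by rewrite lef_pV2 ?posrE// ler_nat.
rewrite /inner_itv; move: (_^-1) k0 k1 => e k0 k1.
set b := 1 - _; set a := -1 + _.
have ab (x : R) : a <= x <= b -> -1 < x < 1 by rewrite /a /b; lra.
have dasin (x : R) : a <= x <= b -> is_derive x 1 asin (sph_weight 0 x).
  move=> /ab x1.
  have -> : sph_weight 0 x = (Num.sqrt (1 - x ^+ 2))^-1.
    rewrite /sph_weight sub0r mulNr mul1r powRN powR12_sqrt//.
    by rewrite subr_ge0; nra.
  exact: is_derive1_asin.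
have cas (x : R) : a <= x <= b -> {for x, continuous (@asin R)}.
  move=> /dasin dx; apply: differentiable_continuous; apply/derivable1_diffP.
  by have [] := dx.
rewrite (@continuous_FTC2 _ _ (@asin R)).
- rewrite -EFinD lee_fin.
  have : asin b <= pi / 2 by apply: asin_lepi2; rewrite /b; lra.
  have : - (pi / 2) <= asin a by apply: asin_geNpi2; rewrite /a; lra.
  by lra.
- by rewrite /a /b; lra.
- apply: derivable_within_continuous => x; rewrite in_itv /= => /ab x1.
  by have [] := is_derive_sph_weight ((0%:R - 1) / 2) x1.
- split.
  + move=> x; rewrite in_itv /= => x1.
    have x2 : a <= x <= b by lra.
    by have [] := dasin _ x2.
  + apply: cvg_at_right_filter; apply: cas; rewrite lexx /a /b; lra.
  + apply: cvg_at_left_filter; apply: cas; rewrite lexx /a /b; lra.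
- move=> x; rewrite in_itv /= => x1; rewrite derive1E.
  have x2 : a <= x <= b by lra.
  by have [_ ->] := dasin _ x2.
Unshelve. all: by end_near. Qed.

Lemma inner_itv_cvg (f : R -> R) : mu.-integrable D (EFin \o f) ->
  (fun k => \int[mu]_(x in inner_itv k) f x) @ \oo --> \int[mu]_(x in D) f x.
Proof.
move=> fi.
have foo : mu.-integrable `]-1, 1[ (EFin \o f).
  by apply: integrableS fi => //; exact: subset_itv_oo_cc.
have -> : \int[mu]_(x in D) f x = \int[mu]_(x in `]-1, 1[) f x.
  rewrite Rintegral_itv_obnd_cbnd// Rintegral_itv_bndo_bndc//.
  by apply: integrableS fi => //; exact: subset_itv_co_cc.
have mE : measurable_fun (`]-1, 1[%classic : set R) (EFin \o f) by have /integrableP[] := foo.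
have [] := @dominated_convergence _ _ R mu `]-1, 1[ _
  (fun k => (EFin \o f) \_ (inner_itv k)) (EFin \o f) (abse \o (EFin \o f)).
- exact: measurable_itv.
- move=> k; apply/(measurable_restrict _ _ _).1 => //; first exact: measurable_itv.
  by apply: measurable_funS mE => //; exact: subIsetl.
- exact: mE.
- apply: aeW => x x1; apply: cvg_near_cst.
  move: x1; rewrite -bigcup_inner_itv => -[k _ kx]; near=> n.
  rewrite patchE mem_set//.
  have kn : (k <= n)%N by near: n; exact: nbhs_infty_ge.
  by have /subsetPset := inner_itv_homo kn; apply.
- exact: integrable_abse.
- apply: aeW => x k _ /=; rewrite patchE; case: ifPn => // _.
  by rewrite abse0.
move=> _ _ h; apply: fine_cvg.
rewrite fineK; last by apply: integrable_fin_num.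
move: h; apply: cvg_trans; apply: near_eq_cvg; near=> k.
rewrite /= -integral_mkcondr; congr (integral _ _ _); apply/setIidr.
by rewrite -bigcup_inner_itv; exact: bigcup_sup.
Unshelve. all: by end_near. Qed.

(** The integrand is the derivative of t^i (1 - t^2)^((n+1)/2), which vanishes at both ends. All
    moment relations derive from this one integration by parts. *)
Lemma sph_weight_ibp n i :
  \int[mu]_(t in D) (sph_weight n t *
    (i%:R * t ^+ i.-1 * (1 - t ^+ 2) - n.+1%:R * t ^+ i.+1)) = 0.
Proof.
pose h t := sph_weight n t *
  (i%:R * t ^+ i.-1 * (1 - t ^+ 2) - n.+1%:R * t ^+ i.+1).
rewrite -/(h _).
pose p : R := (n.+1%:R) / 2.
have p1 : p - 1 = (n%:R - 1) / 2 by rewrite /p -natr1; lra.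
have p0 : 0 < p by rewrite /p divr_gt0.
pose F (t : R) := t ^+ i * (1 - t ^+ 2) `^ p.
have dF (t : R) : -1 < t < 1 -> is_derive t 1 F (h t).
  move=> t1; have dw := is_derive_sph_weight p t1.
  have -> : F = (@id R) ^+ i * (fun s => (1 - s ^+ 2) `^ p).
    by rewrite exprfctE.
  apply: is_derive_eq; rewrite /= /GRing.scale /= !mulr1.
  have t2 : 0 <= 1 - t ^+ 2 by nra.
  have -> : (1 - t ^+ 2) `^ p = (1 - t ^+ 2) * sph_weight n t.
    by rewrite -(mulr_powRB1 t2 p0) p1.
  rewrite exprfctE /= p1 -/(sph_weight n t) /h /= !exprS /p.
  by field.
have hi : mu.-integrable D (EFin \o h).
  apply: (@le_integrable _ _ _ mu D _ _ (EFin \o (fun t => (i%:R + n.+1%:R) * sph_weight n t))).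
  - exact: measurable_itv.
  - apply/measurable_EFinP; apply: measurable_funM; first exact: measurable_sph_weight.
    have mX k : measurable_fun D (fun x : R => x ^+ k) by exact: measurable_funX.
    apply: measurable_funB; apply: measurable_funM.
    - by apply: measurable_funM; [exact: measurable_cst|exact: mX].
    - by apply: measurable_funB; [exact: measurable_cst|exact: mX].
    - exact: measurable_cst.
    - exact: mX.
  - move=> t /=; rewrite in_itv /= lee_fin => t1.
    have tn : `|t| <= 1 by rewrite ler_norml.
    rewrite normrM [leRHS]ger0_norm ?mulr_ge0 ?addr_ge0 ?sph_weight_ge0//.
    rewrite ger0_norm ?sph_weight_ge0// mulrC ler_wpM2r ?sph_weight_ge0//.
    apply: (le_trans (ler_normB _ _)); apply: lerD; rewrite normrM.
      rewrite normrM normrX (ger0_norm (ler0n _ _)) -mulrA ler_piMr//.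
      by rewrite mulr_ile1// ?exprn_ile1// ger0_norm; nra.
    by rewrite normrX (ger0_norm (ler0n _ _)) ler_piMr// exprn_ile1.
  - by have := integrableZl _ (i%:R + n.+1%:R) (integrable_sph_weight n); apply; exact: measurable_itv.
(* The limit is also 0: on an inner interval the integral is F(b) - F(a), and each boundary value is
   at most (1 - b^2)^p, which tends to 0 as b tends to 1. *)
have hc := inner_itv_cvg hi.
apply: (cvg_unique (@norm_hausdorff _ _) hc).
pose y (k : nat) : R := 1 - (1 - k.+2%:R^-1) ^+ 2.
have y0 k : 0 <= y k.
  have : 0 < k.+2%:R^-1 :> R by rewrite invr_gt0.
  have : k.+2%:R^-1 <= 2^-1 :> R by rewrite lef_pV2 ?posrE// ler_nat.
  by rewrite /y; move: (_^-1) => e; nra.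
have ycv : y @ \oo --> (0 : R).
  have h0 : (fun k => k.+2%:R^-1 : R) @ \oo --> (0 : R).
    have := @cvg_harmonic R.
    by rewrite -(cvg_shiftS (harmonic : nat -> R)).
  have : y @ \oo --> (1 - (1 - 0) * (1 - 0) : R).
    apply: cvgB; first exact: cvg_cst.
    under eq_fun do rewrite expr2.
    by apply: cvgM; apply: cvgB => //; exact: cvg_cst.
  by rewrite subr0 mulr1 subrr.
have b00 := powR_seq_cvg0 p0 y0 ycv.
have b0 : (fun k => y k `^ p + y k `^ p) @ \oo --> (0 : R).
  by rewrite -[X in _ --> X]addr0; exact: cvgD.
apply: norm_cvg0; apply: (squeeze_cvgr _ (cvg_cst 0) b0).
near=> k; rewrite normr_ge0 /= /y.
have k0 : 0 < k.+2%:R^-1 :> R by rewrite invr_gt0.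
have k1 : k.+2%:R^-1 <= 2^-1 :> R by rewrite lef_pV2 ?posrE// ler_nat.
rewrite /inner_itv; move: (_^-1) k0 k1 => e k0 k1.
set b := 1 - e; set a := -1 + e.
have ab (x : R) : a <= x <= b -> -1 < x < 1 by rewrite /a /b; lra.
have cF (x : R) : a <= x <= b -> {for x, continuous F}.
  move=> /ab /dF dx; apply: differentiable_continuous; apply/derivable1_diffP.
  by have [] := dx.
have bF : `|F b| <= (1 - b ^+ 2) `^ p.
  rewrite normrM (ger0_norm (powR_ge0 _ _)) ler_piMl ?powR_ge0//.
  by rewrite normrX exprn_ile1// ger0_norm /b; lra.
have aF : `|F a| <= (1 - b ^+ 2) `^ p.
  rewrite /F (_ : a ^+ 2 = b ^+ 2); last by rewrite /a /b; ring.
  rewrite normrM (ger0_norm (powR_ge0 _ _)) ler_piMl ?powR_ge0//.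
  by rewrite normrX exprn_ile1// ler0_norm /a; lra.
rewrite /Rintegral (@continuous_FTC2 _ _ F).
- rewrite -EFinD /= (le_trans (ler_normB _ _))// lerD//.
- by rewrite /a /b; lra.
- apply: derivable_within_continuous => x; rewrite in_itv /= => /ab x1.
  have dw : derivable (sph_weight n) x 1.
    by have [] := is_derive_sph_weight ((n%:R - 1) / 2) x1.
  have -> : h = sph_weight n * (((i%:R \*o ((@id R) ^+ i.-1)) * (cst 1 - (@id R) ^+ 2))
     - n.+1%:R \*o ((@id R) ^+ i.+1)) by rewrite !exprfctE.
  apply: derivableM => //.
- split.
  + move=> x; rewrite in_itv /= => x1.
    have /ab /dF dx : a <= x <= b by lra.
    by have [] := dx.
  + apply: cvg_at_right_filter; apply: cF; rewrite lexx /a /b; lra.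
  + apply: cvg_at_left_filter; apply: cF; rewrite lexx /a /b; lra.
- move=> x; rewrite in_itv /= => x1; rewrite derive1E.
  have /ab /dF dx : a <= x <= b by lra.
  by have [_ ->] := dx.
Unshelve. all: by end_near. Qed.

End Weight.

(** * Integration and quadrature against an integrable weight on [-1, 1] *)

Section WeightedIntegral.
Context {R : realType}.
Notation mu := (@lebesgue_measure R).
Notation D := (`[-1, 1]%classic : set R).
Context (w : R -> R) (w_ge0 : forall t, 0 <= w t)
  (w_int : mu.-integrable D (EFin \o w)).

Definition bmeas (f : R -> R) :=
  measurable_fun D f /\ exists M, forall t, D t -> `|f t| <= M.

Lemma bmeas_cst (a : R) : bmeas (cst a).
Proof. by split; [exact: measurable_cst|exists `|a|]. Qed.

Lemma bmeasD f g : bmeas f -> bmeas g -> bmeas (fun t => f t + g t).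
Proof.
move=> [mf [M fM]] [mg [N gN]]; split; first exact: measurable_funD.
by exists (M + N) => t Dt; rewrite (le_trans (ler_normD _ _))// lerD ?fM ?gN.
Qed.

Lemma bmeasM f g : bmeas f -> bmeas g -> bmeas (fun t => f t * g t).
Proof.
move=> [mf [M fM]] [mg [N gN]]; split; first exact: measurable_funM.
by exists (M * N) => t Dt; rewrite normrM ler_pM ?fM ?gN.
Qed.

Lemma bmeas_sum (I : Type) (r : seq I) (F : I -> R -> R) :
  (forall i, bmeas (F i)) -> bmeas (fun t => \sum_(i <- r) F i t).
Proof.
move=> h; elim: r => [|i r IH].
  by under eq_fun do rewrite big_nil; exact: bmeas_cst.
by under eq_fun do rewrite big_cons; exact: bmeasD.
Qed.

Lemma bmeas_unif_cont (h : R -> R) :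
  (forall e, 0 < e -> exists2 d, 0 < d & forall s t, D s -> D t ->
     `|s - t| <= d -> `|h s - h t| <= e) -> bmeas h.
Proof.
move=> uc.
have hc : {within D, continuous h}.
  apply/subspace_continuousP => x Dx; apply/cvgrPdist_le => e e0.
  have [d d0 hd] := uc _ e0; near=> y.
  have Dy : D y by near: y; exact: withinT.
  apply: hd => //; near: y; apply: cvg_within.
  by apply: (@cvgr_dist_le _ _ _ (nbhs x) _ id x) => //; exact: cvg_id.
split; first by apply: subspace_continuous_measurable_fun => //; exact: measurable_itv.
have [M [_ hM]] := compact_bounded (continuous_compact hc (@segment_compact R (-1) 1)).
exists (M + 1) => t Dt; apply: hM; first by rewrite ltrDl.
by exists t.
Unshelve. all: by end_near. Qed.

Definition wint (f : R -> R) : R := \int[mu]_(t in D) (w t * f t).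

Lemma wint_integrable f : bmeas f -> mu.-integrable D (EFin \o (fun t => w t * f t)).
Proof.
move=> [mf [M fM]].
apply: (@le_integrable _ _ _ mu D _ _ (EFin \o (fun t => M * w t))).
- exact: measurable_itv.
- apply/measurable_EFinP; apply: measurable_funM => //.
  by have /integrableP[/measurable_EFinP] := w_int.
- move=> t Dt /=; rewrite lee_fin normrM (ger0_norm (w_ge0 t)) mulrC.
  have M0 : 0 <= M by apply: le_trans (fM t Dt).
  by rewrite [leRHS]ger0_norm ?mulr_ge0// ler_wpM2r// fM.
- by have := @integrableZl _ _ _ mu D _ M _ w_int; apply; exact: measurable_itv.
Qed.

Lemma wintD f g : bmeas f -> bmeas g -> wint (fun t => f t + g t) = wint f + wint g.
Proof.
move=> bf bg; rewrite /wint; under eq_Rintegral do rewrite mulrDr.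
by rewrite RintegralD//; exact: wint_integrable.
Qed.

Lemma wintZ a f : bmeas f -> wint (fun t => a * f t) = a * wint f.
Proof.
move=> bf; rewrite /wint; under eq_Rintegral do rewrite mulrCA.
by rewrite RintegralZl//; exact: wint_integrable.
Qed.

Lemma eq_wint f g : (forall t, D t -> f t = g t) -> wint f = wint g.
Proof. by move=> fg; apply: eq_Rintegral => t /set_mem Dt; rewrite fg. Qed.

Lemma wint_le f g : bmeas f -> bmeas g -> (forall t, D t -> f t <= g t) ->
  wint f <= wint g.
Proof.
move=> bf bg fg; apply: le_Rintegral => //; try exact: wint_integrable.
by move=> t Dt; rewrite ler_wpM2l// fg.
Qed.

Lemma wint_sum (I : Type) (r : seq I) (F : I -> R -> R) :
  (forall i, bmeas (F i)) ->
  wint (fun t => \sum_(i <- r) F i t) = \sum_(i <- r) wint (F i).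
Proof.
move=> h; elim: r => [|i r IH].
  under eq_wint do rewrite big_nil.
  by rewrite big_nil /wint; under eq_Rintegral do rewrite mulr0; rewrite /Rintegral integral0.
under eq_wint do rewrite big_cons.
by rewrite wintD// ?IH ?big_cons//; exact: bmeas_sum.
Qed.

Lemma wint_dist e f g : bmeas f -> bmeas g -> (forall t, D t -> `|f t - g t| <= e) ->
  `|wint f - wint g| <= e * wint (cst 1).
Proof.
move=> bf bg fg.
have bc := bmeas_cst 1.
have be := bmeasM (bmeas_cst e) bc.
rewrite -(wintZ e bc) ler_norml lerBlDr lerNl opprB lerBlDr -!wintD//.
apply/andP; split; apply: wint_le; try exact: bmeasD; move=> // t Dt;
  by have := fg t Dt; rewrite ler_norml /=; lra.
Qed.

Lemma wint_ge0 f : (forall t, D t -> 0 <= f t) -> 0 <= wint f.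
Proof. by move=> f0; apply: Rintegral_ge0 => t Dt; rewrite mulr_ge0// f0. Qed.

(** The nodes are left ends of cells of length [d], each carrying the weight of its cell. They
    depend on [d] only, so one list serves every integrand with the given modulus. *)
Lemma wint_discretize (d : R) : 0 < d -> exists s : seq (R * R),
  (forall p, p \in s -> 0 <= p.1 /\ D p.2) /\
  forall h e, bmeas h -> 0 <= e ->
    (forall s t, D s -> D t -> `|s - t| <= d -> `|h s - h t| <= e) ->
    `|wint h - \sum_(p <- s) p.1 * h p.2| <= e * wint (cst 1).
Proof.
move=> d0.
pose x (k : nat) : R := -1 + k%:R * d.
have [N hN] : exists N : nat, 1 < x N.
  exists (Num.truncn (2 / d)).+1; rewrite /x.
  have := truncnS_gt (2 / d); rewrite ltr_pdivrMr//; lra.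
pose z k := Num.min (x k) 1.
(* The indicator of the cell [x k, x k.+1[, written as a difference so that the sum over cells
   telescopes; [1 < x N] ensures that the point 1 lies in a cell. *)
pose e_ (k : nat) (t : R) : R := ((t < x k.+1)%R : nat)%:R - ((t < x k)%R : nat)%:R.
have xS k : x k.+1 = x k + d by rewrite /x -natr1; lra.
have eP k t : e_ k t = ((x k <= t < x k.+1)%R : nat)%:R.
  rewrite /e_ xS; case: (ltP t (x k)) => h1; case: (ltP t (x k + d)) => h2 /=;
    rewrite ?subrr ?subr0//; lra.
have e1 t : D t -> \sum_(0 <= k < N) e_ k t = 1.
  rewrite /= in_itv /= => t1; rewrite telescope_sumr//.
  have -> : t < x N by lra.
  have -> : (t < x 0%N) = false.
    by apply/negbTE; rewrite -leNgt /x mul0r; lra.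
  by rewrite subr0.
have be k : bmeas (e_ k).
  split.
    rewrite (_ : e_ k = \1_(`[x k, x k.+1[%classic)); last first.
      by apply/funext => t; rewrite eP indicE mem_setE in_itv.
    exact: measurable_indic.
  exists 1 => t _; rewrite eP; case: (_ <= _ < _) => /=; rewrite ?normr1 ?normr0//.
exists [seq (wint (e_ k), z k) | k <- index_iota 0 N]; split.
  move=> p /mapP[k _ ->] /=; split.
    by apply: wint_ge0 => t _; rewrite eP.
  rewrite in_itv /= /z le_min ge_min lexx orbT andbT; apply/andP; split; last lra.
  by rewrite /x lerDl mulr_ge0// ltW.
move=> h e bh e0 hd; rewrite big_map /=.
have -> : \sum_(0 <= k < N) wint (e_ k) * h (z k) =
    wint (fun t => \sum_(0 <= k < N) h (z k) * e_ k t).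
  rewrite wint_sum; last by move=> k; exact: (bmeasM (bmeas_cst _)).
  by apply: eq_bigr => k _; rewrite wintZ// mulrC.
apply: wint_dist => //; first by apply: bmeas_sum => k; exact: (bmeasM (bmeas_cst _)).
move=> t Dt; rewrite -[h t]mul1r -(e1 t Dt) big_distrl /= -sumrB.
apply: (le_trans (ler_norm_sum _ _ _)).
rewrite -[leRHS]mul1r -(e1 t Dt) big_distrl /=; apply: ler_sum => k _.
rewrite (mulrC (h _)) -mulrBr normrM eP.
have [/andP[h1 h2]|_] := boolP (x k <= t < x k.+1); last by rewrite normr0 !mul0r.
rewrite normr1 !mul1r; have := Dt; rewrite /= in_itv /= => t1.
have -> : z k = x k by rewrite /z; apply/min_idPl; lra.
have xk : -1 <= x k by rewrite /x lerDl mulr_ge0// ltW.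
apply: hd => //; first by rewrite /= in_itv /=; lra.
by rewrite ger0_norm; move: h2; rewrite xS; lra.
Qed.

End WeightedIntegral.

(** * Integration over the sphere *)

Section SphereIntegral.
Context {R : realType}.
Notation D := (`[-1, 1]%classic : set R).

Lemma sph_lift0 n (t : R) (u : 'rV[R]_(n.+1)) : sph_lift t u 0 ord0 = t.
Proof.
rewrite /sph_lift mxE; case: splitP => j.
  by rewrite mxE.
by move=> /= h.
Qed.

Lemma sph_liftS n (t : R) (u : 'rV[R]_(n.+1)) (i : 'I_n.+1) :
  sph_lift t u 0 (lift ord0 i) = Num.sqrt (1 - t ^+ 2) * u 0 i.
Proof.
rewrite /sph_lift mxE; case: splitP => j.
  by case: j => [[|j] hj].
move=> /= h; rewrite mxE; congr (_ * u _ _); apply/val_inj => /=.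
by move: h; rewrite /bump leq0n /= add1n add1n => -[].
Qed.

Lemma dotv_lift n (x : 'rV[R]_(n.+2)) (t : R) (u : 'rV[R]_(n.+1)) :
  dotv x (sph_lift t u) =
  x 0 ord0 * t + Num.sqrt (1 - t ^+ 2) * dotv (\row_i x 0 (lift ord0 i)) u.
Proof.
rewrite /dotv big_ord_recl sph_lift0; congr (_ + _).
rewrite big_distrr /=; apply: eq_bigr => i _.
by rewrite sph_liftS mxE mulrCA.
Qed.

Lemma sphere_lift n (t : R) (u : 'rV[R]_(n.+1)) : D t -> sphere n u ->
  sphere n.+1 (sph_lift t u).
Proof.
rewrite /= in_itv /= /sphere /= => t1 us.
rewrite /dotv big_ord_recl sph_lift0.
under eq_bigr do rewrite sph_liftS mulrACA.
rewrite -mulr_sumr; move: us; rewrite /dotv => ->.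
rewrite mulr1 -(expr2 (Num.sqrt _)) sqr_sqrtr; last by nra.
by rewrite -expr2 addrC subrK.
Qed.

Lemma sphere_coord n (u : 'rV[R]_(n.+1)) i : sphere n u -> `|u 0 i| <= 1.
Proof.
rewrite /sphere /= /dotv (bigD1 i) //= => h.
have : 0 <= \sum_(j < n.+1 | j != i) u 0 j * u 0 j.
  by apply: sumr_ge0 => j _; rewrite -expr2 sqr_ge0.
by move=> h0; rewrite ler_norml; nra.
Qed.

Lemma sphere_dotv n (x y : 'rV[R]_(n.+1)) : sphere n x -> sphere n y ->
  `|dotv x y| <= 1.
Proof.
rewrite /sphere /= => hx hy.
have h (e : R) : e ^+ 2 = 1 -> 0 <= 2 + 2 * e * dotv x y.
  move=> e2.
  have -> : 2 + 2 * e * dotv x y = \sum_(i < n.+1) (x 0 i + e * y 0 i) ^+ 2.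
    transitivity (dotv x x + e ^+ 2 * dotv y y + 2 * e * dotv x y).
      by rewrite hx hy e2; ring.
    rewrite /dotv !big_distrr /= -!big_split /=.
    by apply: eq_bigr => i _; ring.
  by apply: sumr_ge0 => i _; rewrite sqr_ge0.
have h1 := h 1 (expr1n _ _).
have h2 : 0 <= 2 + 2 * (-1) * dotv x y by apply: h; rewrite sqrrN expr1n.
by rewrite ler_norml; lra.
Qed.

Definition usph n (f : 'rV[R]_(n.+1) -> R) := forall e, 0 < e ->
  exists2 d, 0 < d & forall p q, sphere n p -> sphere n q ->
    (forall i, `|p 0 i - q 0 i| <= d) -> `|f p - f q| <= e.

Lemma usph_cst n (a : R) : usph (fun _ : 'rV[R]_(n.+1) => a).
Proof.
by move=> e e0; exists 1 => // p q _ _ _; rewrite subrr normr0 ltW.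
Qed.

Lemma usphD n (f g : 'rV[R]_(n.+1) -> R) : usph f -> usph g ->
  usph (fun p => f p + g p).
Proof.
move=> uf ug e e0; have e2 : 0 < e / 2 by rewrite divr_gt0.
have [d1 d10 h1] := uf _ e2; have [d2 d20 h2] := ug _ e2.
exists (Num.min d1 d2); first by rewrite lt_min d10.
move=> p q ps qs hi.
have h1' : `|f p - f q| <= e / 2.
  by apply: h1 => // i; rewrite (le_trans (hi i))// ge_min lexx.
have h2' : `|g p - g q| <= e / 2.
  by apply: h2 => // i; rewrite (le_trans (hi i))// ge_min lexx orbT.
rewrite opprD addrACA (le_trans (ler_normD _ _))//.
by move: h1' h2'; lra.
Qed.

Lemma usphZ n a (f : 'rV[R]_(n.+1) -> R) : usph f -> usph (fun p => a * f p).
Proof.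
move=> uf e e0; have e2 : 0 < e / (`|a| + 1) by rewrite divr_gt0// ltr_wpDl.
have [d d0 h] := uf _ e2; exists d => // p q ps qs hi.
rewrite -mulrBr normrM; apply: (@le_trans _ _ ((`|a| + 1) * `|f p - f q|)).
  by rewrite ler_wpM2r// lerDl.
by rewrite mulrC -ler_pdivlMr ?ltr_wpDl//; exact: h.
Qed.

Lemma usph_sum n (I : Type) (r : seq I) (F : I -> 'rV[R]_(n.+1) -> R) :
  (forall i, usph (F i)) -> usph (fun p => \sum_(i <- r) F i p).
Proof.
move=> h; elim: r => [|i r IH].
  by under eq_fun do rewrite big_nil; exact: usph_cst.
by under eq_fun do rewrite big_cons; exact: usphD.
Qed.

Definition slice n (f : 'rV[R]_(n.+2) -> R) (t : R) (u : 'rV[R]_(n.+1)) : R :=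
  f (sph_lift t u).

Lemma sqrt_1subX2_le1 (t : R) : Num.sqrt (1 - t ^+ 2) <= 1.
Proof.
rewrite -[leRHS]sqrtr1 ler_wsqrtr// lerBlDr lerDl sqr_ge0//.
Qed.

Lemma usph_slice n (f : 'rV[R]_(n.+2) -> R) t : D t -> usph f -> usph (slice f t).
Proof.
move=> Dt uf e e0; have [d d0 h] := uf _ e0; exists d => // p q ps qs hi.
apply: h; try exact: sphere_lift.
move=> i; case: (unliftP ord0 i) => [j ->|->]; last first.
  by rewrite !sph_lift0 subrr normr0 ltW.
rewrite !sph_liftS -mulrBr normrM ger0_norm ?sqrtr_ge0//.
apply: le_trans (hi j); rewrite ler_piMl//; exact: sqrt_1subX2_le1.
Qed.

(** How far the height may move if the lifted point is to move by at most [d]: near the poles sqrt(1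
    - t^2) is only Hölder of exponent 1/2, whence the quadratic term. *)
Definition slice_mod (d : R) : R := Num.min d (d ^+ 2 / 2).

Lemma slice_mod_gt0 d : 0 < d -> 0 < slice_mod d.
Proof. by move=> d0; rewrite lt_min d0 divr_gt0// exprn_gt0. Qed.

Lemma sph_lift_close n (s t d : R) (u : 'rV[R]_(n.+1)) : 0 < d -> D s -> D t ->
  sphere n u -> `|s - t| <= slice_mod d ->
  forall i, `|sph_lift s u 0 i - sph_lift t u 0 i| <= d.
Proof.
move=> d0 Ds Dt us st i.
have st1 : `|s - t| <= d by rewrite (le_trans st)// ge_min lexx.
have st2 : `|s - t| <= d ^+ 2 / 2 by rewrite (le_trans st)// ge_min lexx orbT.
case: (unliftP ord0 i) => [j ->|->]; last by rewrite !sph_lift0.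
rewrite !sph_liftS -mulrBl normrM.
apply: (@le_trans _ _ `|Num.sqrt (1 - s ^+ 2) - Num.sqrt (1 - t ^+ 2)|).
  by rewrite ler_piMr// sphere_coord.
move: Ds Dt; rewrite /= !in_itv /= => Ds Dt.
have hs : Num.sqrt (1 - s ^+ 2) ^+ 2 = 1 - s ^+ 2 by rewrite sqr_sqrtr//; nra.
have ht : Num.sqrt (1 - t ^+ 2) ^+ 2 = 1 - t ^+ 2 by rewrite sqr_sqrtr//; nra.
have x0 := sqrtr_ge0 (1 - s ^+ 2); have y0 := sqrtr_ge0 (1 - t ^+ 2).
set x := Num.sqrt (1 - s ^+ 2) in hs x0 *; set y := Num.sqrt (1 - t ^+ 2) in ht y0 *.
rewrite -[leRHS]ger0_norm ?(ltW d0)// -ler_sqr ?nnegrE// !real_normK ?num_real//.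
(* For nonnegative x and y, (x - y)^2 <= |x^2 - y^2|, which here is |s - t| |s + t| <= 2 |s - t|. *)
have h2 : `|x ^+ 2 - y ^+ 2| <= d ^+ 2.
  rewrite hs ht (_ : _ - _ = (t - s) * (s + t)); last by ring.
  rewrite normrM distrC; have : `|s + t| <= 2 by rewrite ler_norml; lra.
  have := normr_ge0 (s - t); have := normr_ge0 (s + t); nra.
apply: le_trans h2; rewrite (_ : (x - y) ^+ 2 = `|x - y| * `|x - y|); last first.
  by rewrite -normrM -expr2 ger0_norm ?sqr_ge0.
rewrite subr_sqr normrM ler_wpM2l//.
by rewrite [leRHS]ger0_norm ?addr_ge0// ler_norml; lra.
Qed.

Definition sph_mass n : R := sphere_int n (fun _ => 1).

(* Stated together because monotonicity in dimension n is what makes the slice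
   integrals continuous, hence integrable, in dimension n + 1. *)
Definition sphere_int_good n := [/\ 
  forall f g : 'rV[R]_(n.+1) -> R, usph f -> usph g ->
    sphere_int n (fun p => f p + g p) = sphere_int n f + sphere_int n g,
  forall a (f : 'rV[R]_(n.+1) -> R), usph f ->
    sphere_int n (fun p => a * f p) = a * sphere_int n f &
  forall f g : 'rV[R]_(n.+1) -> R, usph f -> usph g ->
    (forall p, sphere n p -> f p <= g p) -> sphere_int n f <= sphere_int n g].

Lemma sphere_int_dist_of n : sphere_int_good n -> forall e (f g : 'rV[R]_(n.+1) -> R),
  usph f -> usph g -> (forall p, sphere n p -> `|f p - g p| <= e) ->
  `|sphere_int n f - sphere_int n g| <= e * sph_mass n.
Proof.
move=> [SD SZ Sle] e f g uf ug fg.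
have uc := @usph_cst n 1; have ue := usphZ e uc.
rewrite -(SZ e _ uc) ler_norml lerBlDr lerNl opprB lerBlDr -!SD//.
apply/andP; split; apply: Sle; try exact: usphD; move=> // p ps;
  by have := fg p ps; rewrite ler_norml /=; lra.
Qed.

Lemma slice_int_mod n : sphere_int_good n ->
  forall (f : 'rV[R]_(n.+2) -> R) d e, 0 < d -> usph f ->
  (forall p q, sphere n.+1 p -> sphere n.+1 q ->
    (forall i, `|p 0 i - q 0 i| <= d) -> `|f p - f q| <= e) ->
  forall s t, D s -> D t -> `|s - t| <= slice_mod d ->
  `|sphere_int n (slice f s) - sphere_int n (slice f t)| <= e * sph_mass n.
Proof.
move=> gn f d e d0 uf fd s t Ds Dt st.
apply: (sphere_int_dist_of gn); try exact: usph_slice.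
move=> u us; apply: fd; try exact: sphere_lift.
exact: sph_lift_close.
Qed.

Lemma bmeas_slice_int n : sphere_int_good n -> forall f : 'rV[R]_(n.+2) -> R,
  usph f -> bmeas (fun t => sphere_int n (slice f t)).
Proof.
move=> gn f uf; apply: bmeas_unif_cont => e e0.
have m0 : 0 <= sph_mass n.
  have [_ SZ Sle] := gn.
  have <- : sphere_int n (fun p : 'rV[R]_n.+1 => 0 * 1) = 0.
    by rewrite SZ ?mul0r//; exact: usph_cst.
  apply: Sle => [||p _]; rewrite ?mul0r//; exact: usph_cst.
have e1 : 0 < e / (sph_mass n + 1) by rewrite divr_gt0// ltr_wpDl.
have [d d0 h] := uf _ e1; exists (slice_mod d); first exact: slice_mod_gt0.
move=> s t Ds Dt st; apply: (le_trans (slice_int_mod gn d0 uf h Ds Dt st)).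
by rewrite mulrAC ler_pdivrMr ?ltr_wpDl// ler_wpM2l ?(ltW e0)// lerDl.
Qed.

Lemma sphere_intS n (f : 'rV[R]_(n.+2) -> R) :
  sphere_int n.+1 f = wint (sph_weight n) (fun t => sphere_int n (slice f t)).
Proof. by []. Qed.

Lemma sphere_int_goodP n : sphere_int_good n.
Proof.
elim: n => [|n gn].
  split=> [f g _ _|a f _|f g _ _ fg] /=; first by rewrite addrACA.
    by rewrite mulrDr.
  by apply: lerD; apply: fg; rewrite /sphere /= /dotv big_ord1 !mxE ?mulr1 ?mulrNN ?mulr1.
have [SD SZ Sle] := gn; have wi := @integrable_sph_weight R n.
have w0 := @sph_weight_ge0 R n.
split=> [f g uf ug|a f uf|f g uf ug fg]; rewrite !sphere_intS.
- rewrite -wintD//; try exact: bmeas_slice_int.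
  by apply: eq_wint => t Dt; rewrite -SD//; exact: usph_slice.
- rewrite -wintZ//; try exact: bmeas_slice_int.
  by apply: eq_wint => t Dt; rewrite -SZ//; exact: usph_slice.
- apply: wint_le => //; try exact: bmeas_slice_int.
  move=> t Dt; apply: Sle; try exact: usph_slice.
  by move=> u us; apply: fg; exact: sphere_lift.
Qed.

Lemma sphere_intD n (f g : 'rV[R]_(n.+1) -> R) : usph f -> usph g ->
  sphere_int n (fun p => f p + g p) = sphere_int n f + sphere_int n g.
Proof. by have [h _ _] := sphere_int_goodP n; exact: h. Qed.

Lemma sphere_intZ n a (f : 'rV[R]_(n.+1) -> R) : usph f ->
  sphere_int n (fun p => a * f p) = a * sphere_int n f.
Proof. by have [_ h _] := sphere_int_goodP n; exact: h. Qed.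

Lemma sphere_int_dist n e (f g : 'rV[R]_(n.+1) -> R) :
  usph f -> usph g -> (forall p, sphere n p -> `|f p - g p| <= e) ->
  `|sphere_int n f - sphere_int n g| <= e * sph_mass n.
Proof. exact: (sphere_int_dist_of (sphere_int_goodP n)). Qed.

Lemma eq_sphere_int n (f g : 'rV[R]_(n.+1) -> R) :
  (forall p, sphere n p -> f p = g p) -> sphere_int n f = sphere_int n g.
Proof.
elim: n f g => [|n IH] f g fg.
  by rewrite /= !fg// /sphere /= /dotv big_ord1 !mxE ?mulr1 ?mulrNN ?mulr1.
rewrite !sphere_intS; apply: eq_wint => t Dt; apply: IH => u us.
by apply: fg; exact: sphere_lift.
Qed.

Lemma sphere_int_sum n (I : Type) (r : seq I) (F : I -> 'rV[R]_(n.+1) -> R) :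
  (forall i, usph (F i)) ->
  sphere_int n (fun p => \sum_(i <- r) F i p) = \sum_(i <- r) sphere_int n (F i).
Proof.
move=> h; elim: r => [|i r IH].
  rewrite big_nil; transitivity (sphere_int n (fun p : 'rV[R]_n.+1 => 0 * 1)).
    by apply: eq_sphere_int => p _; rewrite big_nil mul0r.
  by rewrite sphere_intZ ?mul0r//; exact: usph_cst.
rewrite big_cons -IH -sphere_intD//; last exact: usph_sum.
by apply: eq_sphere_int => p _; rewrite big_cons.
Qed.

Lemma sph_mass_ge0 n : 0 <= sph_mass n.
Proof.
have [_ SZ Sle] := sphere_int_goodP n.
have <- : sphere_int n (fun p : 'rV[R]_n.+1 => 0 * 1) = 0.
  by rewrite SZ ?mul0r//; exact: usph_cst.
apply: Sle => [||p _]; rewrite ?mul0r//; exact: usph_cst.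
Qed.

End SphereIntegral.

(** * Quadrature on the sphere and uniform continuity *)

Section Discretization.
Context {R : realType}.
Notation D := (`[-1, 1]%classic : set R).

(** Nodes are products of the quadrature in the height with that of the slice. The constant [C]
    depends on the dimension alone: its first summand pays for moving the slice, the second for the
    quadrature inside a slice. *)
Lemma sphere_discretize n : exists2 C : R, 0 <= C & forall d, 0 < d ->
  exists s : seq (R * 'rV[R]_(n.+1)),
  (forall p, p \in s -> 0 <= p.1 /\ sphere n p.2) /\
  forall (f : 'rV[R]_(n.+1) -> R) e, usph f -> 0 <= e ->
    (forall p q, sphere n p -> sphere n q ->
      (forall i, `|p 0 i - q 0 i| <= d) -> `|f p - f q| <= e) ->
    `|sphere_int n f - \sum_(p <- s) p.1 * f p.2| <= e * C.
Proof.
elim: n => [|n [C C0 IH]].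
  exists 0 => // d d0; exists [:: (1, const_mx 1); (1, const_mx (-1))]; split.
    move=> p; rewrite !inE => /orP[]/eqP -> /=; split => //;
      by rewrite /sphere /= /dotv big_ord1 !mxE ?mulr1 ?mulrNN ?mulr1.
  by move=> f e _ e0 _; rewrite 2!big_cons big_nil /= !mul1r addr0 subrr normr0 mulr0.
pose w := @sph_weight R n; have wi := @integrable_sph_weight R n.
have w0 := @sph_weight_ge0 R n.
pose W := wint w (cst 1).
have W0 : 0 <= W by apply: wint_ge0.
exists (sph_mass n * W + C * W).
  by rewrite addr_ge0// mulr_ge0// sph_mass_ge0.
move=> d d0; have [s [sP sd]] := IH d d0.
have [s1 [s1P s1d]] := wint_discretize w0 wi (slice_mod_gt0 d0).
exists [seq (p.1 * q.1, sph_lift p.2 q.2) | p <- s1, q <- s]; split.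
  move=> p /allpairsP[[a b] /= [/s1P[a0 aD] /sP[b0 bS] ->]] /=.
  by split; [exact: mulr_ge0|exact: sphere_lift].
move=> f e uf e0 fd.
have -> : \sum_(p <- [seq (p.1 * q.1, sph_lift p.2 q.2) | p <- s1, q <- s]) p.1 * f p.2
    = \sum_(p <- s1) p.1 * (\sum_(q <- s) q.1 * slice f p.2 q.2).
  rewrite big_allpairs_dep /=; apply: eq_bigr => p _; rewrite mulr_sumr.
  by apply: eq_bigr => q _; rewrite mulrA.
rewrite sphere_intS -/w.
set S := wint w _; set X := \sum_(p <- s1) _.
pose Y := \sum_(p <- s1) p.1 * sphere_int n (slice f p.2).
have -> : S - X = (S - Y) + (Y - X) by ring.
apply: (le_trans (ler_normD _ _)); rewrite mulrDr; apply: lerD.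
  rewrite mulrA; apply: s1d.
  - exact: (bmeas_slice_int (sphere_int_goodP n)).
  - by rewrite mulr_ge0// sph_mass_ge0.
  - exact: (slice_int_mod (sphere_int_goodP n) d0 uf fd).
(* The quadrature is exact on constants: apply its error bound with e = 0. *)
have sW : \sum_(p <- s1) p.1 = W.
  have := s1d (cst 1) 0 (bmeas_cst 1) (lexx _).
  rewrite mul0r normr_le0 subr_eq0 => /(_ _)/eqP; rewrite -/W => -> //.
    by apply: eq_bigr => p _; rewrite mulr1.
  by move=> x y _ _ _; rewrite subrr normr0.
rewrite /Y /X -sumrB; apply: (le_trans (ler_norm_sum _ _ _)).
rewrite mulrA -sW mulr_sumr big_seq [leRHS]big_seq.
apply: ler_sum => p ps; have [p0 pD] := s1P _ ps.
rewrite -mulrBr normrM (ger0_norm p0) mulrC ler_wpM2r//.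
apply: sd => //; first exact: usph_slice.
move=> u v us vs uv; apply: fd; try exact: sphere_lift.
move=> i; case: (unliftP ord0 i) => [j ->|->]; last first.
  by rewrite !sph_lift0 subrr normr0 ltW.
rewrite !sph_liftS -mulrBr normrM ger0_norm ?sqrtr_ge0//.
by apply: le_trans (uv j); rewrite ler_piMl// sqrt_1subX2_le1.
Qed.

Lemma sum_continuous (T : topologicalType) (I : Type) (r : seq I) (F : I -> T -> R) :
  (forall i, continuous (F i)) -> continuous (fun x => \sum_(i <- r) F i x).
Proof.
move=> Fc x; apply: cvg_big; first exact: add_continuous.
by move=> i _; exact: Fc.
Qed.

Lemma dotv_continuous n (x : 'rV[R]_n) : continuous (dotv x).
Proof.
apply: sum_continuous => i p; apply: (@continuousM _ _ (fun=> x 0 i)).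
  exact: cst_continuous.
exact: coord_continuous.
Qed.

Lemma dotvv_continuous n : continuous (fun p : 'rV[R]_n => dotv p p).
Proof.
apply: sum_continuous => i p; apply: continuousM; exact: coord_continuous.
Qed.

Lemma sphere_compact n : compact (sphere n : set 'rV[R]_(n.+1)).
Proof.
apply: (@subclosed_compact _ _ [set v : 'rV[R]_(n.+1) | forall i, D (v ord0 i)]).
- have -> : sphere n = (fun p : 'rV[R]_(n.+1) => dotv p p) @^-1` [set 1] by [].
  apply: closed_comp; last exact: closed_eq.
  by move=> p _; exact: dotvv_continuous.
- by apply: (@rV_compact R n.+1 (fun=> D)) => i; exact: segment_compact.
- move=> p ps i /=; rewrite in_itv /= -ler_norml; exact: sphere_coord.
Qed.

(** Heine-Cantor: pairs violating uniformity at scale 1/(k+1) accumulate at a point of the compact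
    sphere, which contradicts continuity there. *)
Lemma within_continuous_usph n (f : 'rV[R]_(n.+1) -> R) :
  {within sphere n, continuous f} -> usph f.
Proof.
move=> /subspace_continuousP fc e e0; apply: contrapT => hn.
have ex k : exists pq : 'rV[R]_(n.+1) * 'rV[R]_(n.+1), [/\ sphere n pq.1, sphere n pq.2,
    forall i, `|pq.1 0 i - pq.2 0 i| <= k.+1%:R^-1 & e < `|f pq.1 - f pq.2| ].
  apply: contrapT => hk; apply: hn; exists k.+1%:R^-1; first by rewrite invr_gt0.
  move=> p q ps qs pq; rewrite leNgt; apply/negP => fpq.
  by apply: hk; exists (p, q).
have [u uP] := choice ex.
have us : fmap (fun k => (u k).1) \oo (sphere n).
  by exists 0%N => // k _; have [] := uP k.
have [x [xs xc]] := @sphere_compact n _ _ us.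
have e2 : 0 < e / 2 by rewrite divr_gt0.
have := fc x xs; move=> /cvgrPdist_lt /(_ _ e2); rewrite /within /=.
move=> /nbhs_ballP[r r0 /= hr].
have r2 : 0 < r / 2 by rewrite divr_gt0.
have [N hN] : exists N : nat, N.+1%:R^-1 < r / 2.
  by have /ltr_add_invr[k] := r2; rewrite add0r => ?; exists k.
have [y [[k Nk <-] yx]] := xc [set (u k).1 | k in [set k | (N <= k)%N]] (ball x (r / 2))
  (ex_intro2 _ _ N I (fun k Nk => ex_intro2 _ _ k Nk erefl)) (nbhsx_ballx _ _ r2).
have [ps qs pq] := uP k.
have h1 : ball x r (u k).1.
  by apply: le_ball yx; move: r0 => /=; lra.
have h2 : ball x r (u k).2.
  have -> : r = r / 2 + r / 2 by lra.
  apply: (ball_triangle yx); split => // i j; rewrite ord1 /ball /=.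
  apply: le_lt_trans (pq j) _; apply: le_lt_trans hN.
  by rewrite lef_pV2 ?posrE// ler_nat ltnS.
have := hr _ h1 ps; have := hr _ h2 qs; move=> g2 g1.
apply/negP; rewrite -leNgt.
have -> : f (u k).1 - f (u k).2 = (f x - f (u k).2) - (f x - f (u k).1) by ring.
by apply: (le_trans (ler_normB _ _)); move: g1 g2; lra.
Qed.

Lemma usph_dotvX n (x : 'rV[R]_(n.+1)) q : usph (fun p => dotv x p ^+ q).
Proof.
apply: within_continuous_usph; apply: continuous_subspaceT => p.
apply: (@continuous_comp _ _ _ (dotv x) (fun t => t ^+ q)).
  exact: dotv_continuous.
exact: exprn_continuous.
Qed.

End Discretization.

(** * Zonal functions *)

Section Moments.
Context {R : realType}.
Notation mu := (@lebesgue_measure R).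
Notation D := (`[-1, 1]%classic : set R).

Lemma bmeasX (i : nat) : bmeas (fun t : R => t ^+ i).
Proof.
split; first exact: measurable_funX.
by exists 1 => t; rewrite /= in_itv /= -ler_norml normrX => t1; rewrite exprn_ile1.
Qed.

Lemma bmeas_1subX2X (l : nat) : bmeas (fun t : R => (1 - t ^+ 2) ^+ l).
Proof.
split.
  apply: measurable_funX; apply: measurable_funB; first exact: measurable_cst.
  exact: measurable_funX.
exists 1 => t; rewrite /= in_itv /= => t1.
by rewrite normrX exprn_ile1// ger0_norm; nra.
Qed.

Definition smoment n (i l : nat) : R :=
  wint (sph_weight n) (fun t => t ^+ i * (1 - t ^+ 2) ^+ l).

Let wi n := @integrable_sph_weight R n.
Let w0 n := @sph_weight_ge0 R n.

Lemma bmeas_smoment i l : bmeas (fun t : R => t ^+ i * (1 - t ^+ 2) ^+ l).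
Proof. by apply: bmeasM; [exact: bmeasX|exact: bmeas_1subX2X]. Qed.

Lemma smomentS n i l : smoment n i l.+1 = smoment n i l - smoment n i.+2 l.
Proof.
rewrite -mulN1r /smoment -wintZ//; last exact: bmeas_smoment.
rewrite -wintD//; try exact: bmeas_smoment; last first.
  by apply: bmeasM; [exact: bmeas_cst|exact: bmeas_smoment].
by apply: eq_wint => t _; rewrite !exprS; ring.
Qed.

Lemma smoment_ibp0 n i : i%:R * smoment n i.-1 1 = n.+1%:R * smoment n i.+1 0.
Proof.
apply/eqP; rewrite -subr_eq0 -mulNr /smoment -!wintZ//; try exact: bmeas_smoment.
rewrite -wintD//; try by apply: bmeasM; [exact: bmeas_cst|exact: bmeas_smoment].
rewrite -[X in _ == X](@sph_weight_ibp R n i); apply/eqP.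
by apply: eq_wint => t _; rewrite expr1 expr0; ring.
Qed.

(** Integration by parts for the weight times (1 - t^2)^l. It follows algebraically from l = 0 by
    splitting off 1 - t^2, so no further boundary analysis arises. *)
Lemma smoment_ibp n i l :
  i.+1%:R * smoment n i l.+1 = (l.*2 + n.+1)%:R * smoment n i.+2 l.
Proof.
elim: l i => [|l IH] i; first by rewrite double0 add0n (smoment_ibp0 n i.+1).
rewrite smomentS mulrBr IH.
have h : smoment n i.+2 l = smoment n i.+2 l.+1 + smoment n i.+4 l.
  by rewrite smomentS subrK.
rewrite h mulrDr -(IH i.+2) doubleS !addSn -!natr1; ring.
Qed.

Lemma smoment_step n i :
  (i + n.+2)%:R * smoment n i.+2 0 = i.+1%:R * smoment n i 0.
Proof.
have := smoment_ibp0 n i.+1; rewrite /= smomentS mulrBr => /eqP.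
rewrite subr_eq => /eqP ->.
by rewrite addnS -addSn natrD; ring.
Qed.

Lemma smoment_odd n i l : smoment n i.*2.+1 l = 0.
Proof.
elim: l i => [|l IH] i; last first.
  by rewrite smomentS -doubleS !IH subrr.
elim: i => [|i IH].
  have := smoment_ibp0 n 0; rewrite mul0r => /esym/eqP.
  by rewrite mulf_eq0 pnatr_eq0 /= => /eqP.
have := smoment_step n i.*2.+1; rewrite IH mulr0 => /eqP.
by rewrite mulf_eq0 pnatr_eq0 /= => /eqP.
Qed.

Lemma smoment00_gt0 n : 0 < smoment n 0 0.
Proof.
have wpos (t : R) : -1 < t < 1 -> 0 < sph_weight n t.
  by move=> t1; apply: powR_gt0; rewrite subr_gt0; nra.
have -> : smoment n 0 0 = \int[mu]_(t in D) sph_weight n t.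
  by apply: eq_Rintegral => t _; rewrite !expr0 !mulr1.
rewrite lt_neqAle Rintegral_ge0 ?andbT; last by move=> t _; exact: w0.
apply/eqP => h0.
have h1 : (\int[mu]_(t in D) `|(sph_weight n t)%:E| = 0)%E.
  under eq_integral do rewrite gee0_abs ?lee_fin ?w0//.
  rewrite -(@fineK _ (integral _ _ _)) ?[fine _](esym h0)//.
  apply: integrable_fin_num; first exact: measurable_itv.
  exact: wi.
have /integrableP[mw _] := wi n.
have [/(_ h1) hae _] := ae_eq_integral_abs mu (measurable_itv `[-1, 1]) mw.
have : mu.-negligible (`]-1, 1[ : set R).
  apply: negligibleS hae => t /=; rewrite in_itv /= => t1 /(_ _).
  rewrite in_itv /= => hh; have := wpos t t1.
  have : (sph_weight n t)%:E = 0%E by apply: hh; lra.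
  by move=> [->]; rewrite ltxx.
have mI : measurable (`]-1, 1[%classic : set (measurableTypeR R)).
  exact: measurable_itv.
move=> hneg; have m0 : mu `]-1, 1[%classic = 0%E := (negligibleP _ mI).1 hneg.
move: m0; rewrite lebesgue_measure_itv /= lte_fin.
have -> : (-1 < 1 :> R) by lra.
by rewrite -EFinD => -[]; lra.
Qed.

Lemma sph_massS n : sph_mass n.+1 = sph_mass n * smoment n 0 0.
Proof.
rewrite /sph_mass sphere_intS /smoment -wintZ//; last exact: bmeas_smoment.
by apply: eq_wint => t _; rewrite /slice !expr0 !mulr1.
Qed.

Lemma sph_mass_gt0 n : 0 < sph_mass n :> R.
Proof.
elim: n => [|n IH]; first by rewrite /sph_mass /= addr_gt0.
by rewrite sph_massS mulr_gt0// smoment00_gt0.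
Qed.

Lemma sum_even (F : nat -> R) p : (forall l, F l.*2.+1 = 0) ->
  \sum_(j < p.*2.+1) F j = \sum_(l < p.+1) F l.*2.
Proof.
move=> F0; elim: p => [|p IH]; first by rewrite !big_ord1.
rewrite doubleS 2!big_ord_recr /= IH F0 addr0 [RHS]big_ord_recr /=.
by rewrite doubleS.
Qed.

(** Rotation invariance in the form that survives the induction: moments depend on x through |x|^2
    only. Vectors of any norm are allowed because the projection of a unit vector to the slice is
    not a unit vector. The recursion on [c] feeds the binomial identity of the next dimension. *)
Definition even_moments n (c : nat -> R) := [/\ c 0%N = sph_mass n,
  forall l, (l.*2 + n.+1)%:R * c l.+1 = l.*2.+1%:R * c l,
  forall (x : 'rV[R]_(n.+1)) l,
    sphere_int n (fun p => dotv x p ^+ l.*2) = c l * dotv x x ^+ l &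
  forall (x : 'rV[R]_(n.+1)) l, sphere_int n (fun p => dotv x p ^+ l.*2.+1) = 0].

(** Says that the l-th term of the slice expansion has the coefficient needed to resum to (a^2 +
    |y|^2)^p. Both sides satisfy the same recursion in l, by [smoment_ibp], the recursion on [c] and
    ratios of neighbouring binomials. *)
Lemma even_moments_binomial n c p l : even_moments n c -> (l <= p)%N ->
  'C(p.*2, l.*2)%:R * c l * smoment n (p - l).*2 l =
  'C(p, l)%:R * (c 0%N * smoment n p.*2 0).
Proof.
move=> [_ cS _ _]; elim: l => [|l IH] lp; first by rewrite !bin0 subn0 !mul1r.
have {}IH := IH (ltnW lp).
have r0 : (p - l.+1).*2.+1%:R != 0 :> R by rewrite pnatr_eq0.
have hX : (p - l.+1).*2.+1%:R * smoment n (p - l.+1).*2 l.+1 =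
    (l.*2 + n.+1)%:R * smoment n (p - l).*2 l.
  by rewrite smoment_ibp -doubleS subnSK.
have b1 : (l.*2.+2)%:R * 'C(p.*2, l.*2.+2)%:R =
    (p - l.+1).*2.+1%:R * 'C(p.*2, l.*2.+1)%:R :> R.
  rewrite -!natrM; congr (_%:R); rewrite mul_bin_left; congr (_ * _)%N.
  by move: lp; lia.
have b2 : (l.*2.+1)%:R * 'C(p.*2, l.*2.+1)%:R =
    (p - l).*2%:R * 'C(p.*2, l.*2)%:R :> R.
  rewrite -!natrM; congr (_%:R); rewrite mul_bin_left; congr (_ * _)%N.
  by move: lp; lia.
have b3 : l.*2.+2%:R * 'C(p, l.+1)%:R = (p - l).*2%:R * 'C(p, l)%:R :> R.
  rewrite -!natrM; congr (_%:R); rewrite -doubleS -!doubleMl mul_bin_left.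
  by [].
have l0 : l.*2.+2%:R != 0 :> R by rewrite pnatr_eq0.
apply: (mulfI l0).
transitivity ((p - l).*2%:R * ('C(p, l)%:R * (c 0%N * smoment n p.*2 0))); last first.
  by rewrite mulrA -b3; ring.
rewrite -IH doubleS !mulrA b1.
transitivity ((p - l.+1).*2.+1%:R * smoment n (p - l.+1).*2 l.+1
   * ('C(p.*2, l.*2.+1)%:R * c l.+1)); first by ring.
rewrite hX.
transitivity ('C(p.*2, l.*2.+1)%:R * ((l.*2 + n.+1)%:R * c l.+1) *
   smoment n (p - l).*2 l); first by ring.
rewrite cS.
transitivity ((l.*2.+1)%:R * 'C(p.*2, l.*2.+1)%:R * c l * smoment n (p - l).*2 l).
  by ring.
by rewrite b2; ring.
Qed.

Lemma even_moments0 : even_moments 0 (fun=> 2).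
Proof.
split.
- by rewrite /sph_mass /= -mulr2n.
- by move=> l; rewrite addn1.
- move=> x l /=; rewrite /dotv !big_ord1 !mxE mulr1 mulrN1 -mul2n !exprM sqrrN expr2.
  by ring.
- move=> x l /=; rewrite /dotv !big_ord1 !mxE mulr1 mulrN1 !exprS -mul2n !exprM sqrrN.
  by ring.
Qed.

Lemma sphere_int_dotvX_slice n c (x : 'rV[R]_(n.+2)) q : even_moments n c ->
  sphere_int n.+1 (fun p => dotv x p ^+ q) =
  \sum_(j < q.+1) (if odd j then 0 else
    'C(q, j)%:R * x 0 ord0 ^+ (q - j) *
    (c j./2 * dotv (\row_i x 0 (lift ord0 i)) (\row_i x 0 (lift ord0 i)) ^+ j./2) *
    smoment n (q - j) j./2).
Proof.
move=> [_ _ ce co]; rewrite sphere_intS.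
set a := x 0 ord0; set y := \row_i _.
pose F (j : nat) (t : R) : R := if odd j then 0 else
   'C(q, j)%:R * a ^+ (q - j) * (c j./2 * dotv y y ^+ j./2) *
   (t ^+ (q - j) * (1 - t ^+ 2) ^+ j./2).
transitivity (wint (sph_weight n) (fun t => \sum_(j < q.+1) F j t)).
  apply: eq_wint => t; rewrite /= in_itv /= => t1.
  have t2 : 0 <= 1 - t ^+ 2 by nra.
  set s := Num.sqrt (1 - t ^+ 2).
  have s2 : s ^+ 2 = 1 - t ^+ 2 by rewrite sqr_sqrtr.
  transitivity (sphere_int n (fun u => \sum_(j < q.+1)
     ('C(q, j)%:R * (a * t) ^+ (q - j) * s ^+ j) * dotv y u ^+ j)).
    apply: eq_sphere_int => u us; rewrite /slice dotv_lift -/a -/y -/s exprDn.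
    by apply: eq_bigr => j _; rewrite -[LHS]mulr_natl (exprMn _ s) !mulrA.
  rewrite sphere_int_sum; last by move=> j; apply: usphZ; exact: usph_dotvX.
  apply: eq_bigr => j _; rewrite sphere_intZ; last exact: usph_dotvX.
  rewrite /F; case: ifPn => oj.
    have jE : (j : nat) = j./2.*2.+1 by rewrite -[LHS]odd_double_half oj.
    have -> : sphere_int n (fun p => dotv y p ^+ j) = 0 by rewrite jE; exact: co.
    by rewrite mulr0.
  have jE : (j : nat) = j./2.*2 by rewrite -[LHS]odd_double_half (negbTE oj).
  have -> : sphere_int n (fun p => dotv y p ^+ j) = c j./2 * dotv y y ^+ j./2.
    by rewrite {1}jE; exact: ce.
  have -> : s ^+ j = (1 - t ^+ 2) ^+ j./2 by rewrite {1}jE -mul2n exprM s2.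
  rewrite exprMn.
  have E (A B C G H : R) : A * (B * C) * G * H = A * B * H * (C * G) by ring.
  exact: E.
rewrite wint_sum//; last first.
  move=> j; rewrite /F; case: (odd j); first exact: bmeas_cst.
  by apply: bmeasM; [exact: bmeas_cst|exact: bmeas_smoment].
apply: eq_bigr => j _; rewrite /F; case: ifPn => oj.
  by rewrite /wint; under eq_Rintegral do rewrite mulr0; rewrite /Rintegral integral0.
by rewrite wintZ//; exact: bmeas_smoment.
Qed.

(** The new constants are the moments of <x, .> when x is the pole of the slicing, where <x, p> is
    just the height. *)
Lemma even_momentsS n c : even_moments n c ->
  even_moments n.+1 (fun l => c 0%N * smoment n l.*2 0).
Proof.
move=> ec; have [c0 cS ce co] := ec; split.
- by rewrite c0 -sph_massS.
- move=> l; rewrite mulrCA doubleS smoment_step; ring.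
- move=> x p; rewrite (sphere_int_dotvX_slice _ _ ec).
  set a := x 0 ord0; set y := \row_i _.
  have -> : dotv x x = a ^+ 2 + dotv y y.
    rewrite /dotv big_ord_recl -expr2; congr (_ + _).
    by apply: eq_bigr => i _; rewrite !mxE.
  set G := fun j : nat => if odd j then 0 else
    'C(p.*2, j)%:R * a ^+ (p.*2 - j) * (c j./2 * dotv y y ^+ j./2) *
    smoment n (p.*2 - j) j./2.
  rewrite -/(G _) (@sum_even G p); last by move=> l; rewrite /G /= odd_double.
  rewrite exprDn mulr_sumr; apply: eq_bigr => l _.
  rewrite /G odd_double doubleK -doubleB -!mul2n exprM !mul2n.
  have := even_moments_binomial ec (ltnSE (ltn_ord l)).
  move=> h.
  transitivity ('C(p.*2, l.*2)%:R * c l * smoment n (p - l).*2 l *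
     ((a ^+ 2) ^+ (p - l) * dotv y y ^+ l)); first by ring.
  by rewrite h -[X in _ = _ * X]mulr_natl; ring.
- move=> x p; rewrite (sphere_int_dotvX_slice _ _ ec).
  apply: big1 => j _; case: ifPn => // oj.
  have jE : (j : nat) = j./2.*2 by rewrite -[LHS]odd_double_half (negbTE oj).
  have -> : (p.*2.+1 - j)%N = (p - j./2).*2.+1.
    by have := ltn_ord j; lia.
  by rewrite smoment_odd mulr0.
Qed.

Lemma even_moments_ex n : exists c, even_moments n c.
Proof.
elim: n => [|n [c ec]]; first by exists (fun=> 2); exact: even_moments0.
by eexists; exact: even_momentsS ec.
Qed.

Lemma funk_hecke_monomial n (x : 'rV[R]_(n.+2)) q : sphere n.+1 x ->
  sphere_int n.+1 (fun p => dotv x p ^+ q) = sph_mass n * smoment n q 0.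
Proof.
move=> xs; have xx : dotv x x = 1 by exact: xs.
have [c ec] := even_moments_ex n.
have [c0 _ _ _] := ec; have [_ _ ce co] := even_momentsS ec.
rewrite -(odd_double_half q); case: (odd q).
  by rewrite add1n co smoment_odd mulr0.
by rewrite add0n ce xx expr1n mulr1 c0.
Qed.

Lemma funk_hecke_poly n (x : 'rV[R]_(n.+2)) (P : {poly R}) : sphere n.+1 x ->
  sphere_int n.+1 (fun p => P.[dotv x p]) =
  sph_mass n * wint (sph_weight n) (fun t => P.[t]).
Proof.
move=> xs.
transitivity (sphere_int n.+1 (fun p => \sum_(i < size P) P`_i * dotv x p ^+ i)).
  by apply: eq_sphere_int => p _; rewrite horner_coef.
rewrite sphere_int_sum; last by move=> i; apply: usphZ; exact: usph_dotvX.
transitivity (sph_mass n * wint (sph_weight n)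
    (fun t => \sum_(i < size P) P`_i * t ^+ i)); last first.
  by congr (_ * _); apply: eq_wint => p _; rewrite horner_coef.
rewrite wint_sum//; last first.
  by move=> i; apply: bmeasM; [exact: bmeas_cst|exact: bmeasX].
rewrite mulr_sumr; apply: eq_bigr => i _.
rewrite sphere_intZ; last exact: usph_dotvX.
rewrite wintZ//; last exact: bmeasX.
rewrite funk_hecke_monomial// mulrCA; congr (_ * (_ * _)).
by apply: eq_wint => t _; rewrite expr0 mulr1.
Qed.

Definition poly_approx (K : R -> R) := forall e, 0 < e ->
  exists P : {poly R}, forall t, D t -> `|K t - P.[t]| <= e.

(** Both sides are linear and bounded for the uniform norm, with total bound [M], and they agree on
    polynomials. *)
Lemma funk_hecke n (x : 'rV[R]_(n.+2)) (K : R -> R) : sphere n.+1 x ->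
  poly_approx K -> bmeas K -> usph (fun p => K (dotv x p)) ->
  sphere_int n.+1 (fun p => K (dotv x p)) =
  sph_mass n * wint (sph_weight n) K.
Proof.
move=> xs Ka bK uK; apply/eqP; rewrite -subr_eq0 -normr_le0; apply/ler_addgt0Pr => e e0.
rewrite add0r.
have m0 := @sph_mass_ge0 R n; have m1 := @sph_mass_ge0 R n.+1.
pose M : R := sph_mass n.+1 + sph_mass n * wint (sph_weight n) (cst 1).
have M0 : 0 <= M.
  by rewrite addr_ge0// mulr_ge0//; apply: wint_ge0 => //; exact: w0.
have e1 : 0 < e / (M + 1) by rewrite divr_gt0// ltr_wpDl.
have [P hP] := Ka _ e1.
have uP : usph (fun p : 'rV[R]_(n.+2) => P.[dotv x p]).
  have -> : (fun p : 'rV[R]_(n.+2) => P.[dotv x p]) =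
      fun p => \sum_(i < size P) P`_i * dotv x p ^+ i.
    by apply/funext => p; rewrite horner_coef.
  by apply: usph_sum => i; apply: usphZ; exact: usph_dotvX.
have bP : bmeas (fun t => P.[t]).
  have -> : (fun t => P.[t]) = fun t => \sum_(i < size P) P`_i * t ^+ i.
    by apply/funext => p; rewrite horner_coef.
  by apply: bmeas_sum => i; apply: bmeasM; [exact: bmeas_cst|exact: bmeasX].
have h1 : `|sphere_int n.+1 (fun p => K (dotv x p)) -
    sphere_int n.+1 (fun p => P.[dotv x p])| <= e / (M + 1) * sph_mass n.+1.
  apply: sphere_int_dist => // p ps; apply: hP.
  by rewrite /= in_itv /= -ler_norml; exact: sphere_dotv.
have h2 : `|wint (sph_weight n) (fun t => P.[t]) - wint (sph_weight n) K| <=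
    e / (M + 1) * wint (sph_weight n) (cst 1).
  by apply: wint_dist => // t Dt; rewrite distrC hP.
rewrite (funk_hecke_poly P xs) in h1.
move: h1 h2; set A := sphere_int _ _; set B := wint _ _; set C := wint _ _ => h1 h2.
have -> : A - sph_mass n * C = (A - sph_mass n * B) + sph_mass n * (B - C) by ring.
apply: (le_trans (ler_normD _ _)); rewrite normrM (ger0_norm m0).
apply: (@le_trans _ _ (e / (M + 1) * M)).
  by rewrite /M mulrDr lerD// mulrCA ler_wpM2l.
by rewrite mulrAC ler_pdivrMr ?ltr_wpDl// ler_wpM2l ?(ltW e0)// lerDl.
Qed.

Lemma poly_approx_bounded K : poly_approx K -> exists M, forall t, D t -> `|K t| <= M.
Proof.
move=> /(_ 1 ltr01)[P hP]; exists (1 + \sum_(i < size P) `|P`_i|) => t Dt.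
rewrite -[K t](subrK P.[t]) (le_trans (ler_normD _ _))// lerD ?hP//.
rewrite horner_coef (le_trans (ler_norm_sum _ _ _))//; apply: ler_sum => i _.
rewrite normrM ler_piMr// normrX exprn_ile1//.
by move: Dt; rewrite /= in_itv /= -ler_norml.
Qed.

Lemma poly_approxD K1 K2 : poly_approx K1 -> poly_approx K2 ->
  poly_approx (fun t => K1 t + K2 t).
Proof.
move=> h1 h2 e e0; have e2 : 0 < e / 2 by rewrite divr_gt0.
have [P hP] := h1 _ e2; have [Q hQ] := h2 _ e2; exists (P + Q) => t Dt.
rewrite hornerD opprD addrACA (le_trans (ler_normD _ _))//.
by have := hP t Dt; have := hQ t Dt; lra.
Qed.

Lemma poly_approxM K1 K2 : poly_approx K1 -> poly_approx K2 ->
  poly_approx (fun t => K1 t * K2 t).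
Proof.
move=> h1 h2 e e0.
have [M1 hM1] := poly_approx_bounded h1; have [M2 hM2] := poly_approx_bounded h2.
have D0 : D 0 by rewrite /= in_itv /=; lra.
have M10 : 0 <= M1 by apply: le_trans (hM1 0 D0).
have M20 : 0 <= M2 by apply: le_trans (hM2 0 D0).
have M0 : 0 < M1 + M2 + 1 by lra.
pose d := Num.min 1 (e / (M1 + M2 + 1)).
have d0 : 0 < d by rewrite lt_min ltr01 divr_gt0.
have de : d * (M1 + M2 + 1) <= e.
  by rewrite -ler_pdivlMr// ge_min lexx orbT.
have d1 : d <= 1 by rewrite ge_min lexx.
have [P hP] := h1 _ d0; have [Q hQ] := h2 _ d0; exists (P * Q) => t Dt.
rewrite hornerM (_ : _ - _ = K1 t * (K2 t - Q.[t]) + (K1 t - P.[t]) * Q.[t]); last by ring.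
have hq : `|Q.[t]| <= M2 + 1.
  rewrite -[Q.[t]](subKr (K2 t)) (le_trans (ler_normB _ _))// lerD ?hM2//.
  by rewrite (le_trans (hQ t Dt)).
rewrite (le_trans (ler_normD _ _))// !normrM (le_trans _ de)//.
have a1 : `|K1 t| * `|K2 t - Q.[t]| <= M1 * d by rewrite ler_pM ?hM1 ?hQ.
have a2 : `|K1 t - P.[t]| * `|Q.[t]| <= d * (M2 + 1) by rewrite ler_pM ?hP.
by move: a1 a2; lra.
Qed.

Lemma poly_approx_cst a : poly_approx (cst a).
Proof.
by move=> e e0; exists a%:P => t _; rewrite hornerC subrr normr0 ltW.
Qed.

Lemma poly_approxX K q : poly_approx K -> poly_approx (fun t => K t ^+ q).
Proof.
move=> h; elim: q => [|q IH]; first by under eq_fun do rewrite expr0; exact: poly_approx_cst.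
by under eq_fun do rewrite exprS; exact: poly_approxM.
Qed.

Lemma poly_approx_id : poly_approx id.
Proof.
by move=> e e0; exists 'X => t _; rewrite hornerX subrr normr0 ltW.
Qed.

Lemma poly_approx_lim K : (forall e, 0 < e -> exists2 K', poly_approx K' &
  forall t, D t -> `|K t - K' t| <= e) -> poly_approx K.
Proof.
move=> h e e0; have e2 : 0 < e / 2 by rewrite divr_gt0.
have [K' /(_ _ e2)[P hP] hK] := h _ e2; exists P => t Dt.
rewrite -[K t](subrK (K' t)) -addrA (le_trans (ler_normD _ _))//.
by have := hP t Dt; have := hK t Dt; lra.
Qed.

(** Truncating the outer series gives a polynomial in the previous iterate, with an error uniform in
    t by [pser_tail]; sums and products preserve approximability. *)
Lemma poly_approx_iter_pser (a : nat -> R) L : (forall q, 0 <= a q) ->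
  series a @ \oo --> (1 : R) -> poly_approx (iter L (pser a)).
Proof.
move=> a0 a1; elim: L => [|L IH]; first exact: poly_approx_id.
apply: poly_approx_lim => e e0.
move/cvgrPdist_le : (a1) => /(_ e e0) [N _ /(_ N (leqnn _)) /= hN].
exists (fun t => \sum_(0 <= q < N) a q * iter L (pser a) t ^+ q).
  elim: (index_iota 0 N) => [|q r IHr].
    by under eq_fun do rewrite big_nil; exact: poly_approx_cst.
  under eq_fun do rewrite big_cons.
  apply: poly_approxD => //; apply: poly_approxM; first exact: poly_approx_cst.
  exact: poly_approxX.
move=> t; rewrite /= in_itv /= -ler_norml => t1.
apply: (le_trans (pser_tail a0 a1 N (iter_pser_le1 a0 a1 L t1))).
exact: le_trans (ler_norm _) hN.
Qed.

End Moments.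

(** * Moment generating functions of Gaussian fields *)

Section GaussianMGF.
Context {R : realType}.
Notation mu := (@lebesgue_measure R).

Lemma integral_normal_prob_ge0 (m s : R) (f : R -> \bar R) :
  (forall x, (0 <= f x)%E) -> measurable_fun setT f ->
  (\int[normal_prob m s]_x f x = \int[mu]_x (f x * (normal_pdf m s x)%:E))%E.
Proof.
move=> f0 mf; have dom := normal_prob_dominates m s.
rewrite -(Radon_Nikodym_SigmaFinite.change_of_variables dom)//.
have hi := Radon_Nikodym_SigmaFinite.f_integrable dom.
have mp : measurable_fun setT (fun x => (normal_pdf m s x)%:E).
  by apply/measurable_EFinP; exact: measurable_normal_pdf.
apply: ae_eq_integral => //.
- by apply: emeasurable_funM => //; exact: (measurable_int mu).
- exact: emeasurable_funM.
- apply: ae_eqe_mul2l; apply: integral_ae_eq => //.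
  by move=> E _ mE; rewrite -Radon_Nikodym_SigmaFinite.f_integral.
Qed.

Lemma normal_mgf (s : R) : s != 0 ->
  (\int[normal_prob 0 s]_x (expR x)%:E = (expR (s ^+ 2 / 2))%:E)%E.
Proof.
move=> s0.
rewrite integral_normal_prob_ge0; last 2 first.
- by move=> x; rewrite lee_fin expR_ge0.
- by apply/measurable_EFinP; exact: measurable_expR.
(* Completing the square: e^x times the centered density is e^(s^2/2) times the density centered at
   s^2. *)
transitivity (\int[mu]_x ((expR (s ^+ 2 / 2))%:E * (normal_pdf (s ^+ 2) s x)%:E))%E.
  apply: eq_integral => x _; rewrite -!EFinM !normal_pdfE//; congr (_%:E).
  rewrite /normal_fun mulrCA [RHS]mulrCA -!expRD; congr (_ * expR _).
  by field.
rewrite ge0_integralZl//.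
- by rewrite integral_normal_pdf mule1.
- by apply/measurable_EFinP; exact: measurable_normal_pdf.
- by move=> x _; rewrite lee_fin normal_pdf_ge0.
Qed.

Context {d : measure_display} {Omega : measurableType d} (P : probability Omega R).

Lemma gauss_law_mgf (Z : Omega -> R) (v : R) : measurable_fun setT Z -> 0 <= v ->
  (forall A : set R, measurable A -> P (Z @^-1` A) = centered_gauss_law v A) ->
  (\int[P]_w (expR (Z w))%:E = (expR (v / 2))%:E)%E.
Proof.
move=> mZ v0 hZ.
have mexp : measurable_fun setT (fun x : R => (expR x)%:E).
  by apply/measurable_EFinP; exact: measurable_expR.
rewrite /centered_gauss_law in hZ.
transitivity (\int[pushforward P (Z : Omega -> measurableTypeR R)]_x (expR x)%:E)%E.
  rewrite (@ge0_integral_pushforward _ _ _ (measurableTypeR R))//.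
have [v00|vn0] := eqVneq v 0.
  rewrite v00 eqxx in hZ.
  rewrite (eq_measure_integral (@dirac _ (measurableTypeR R) 0 R)); last first.
    by move=> A mA _; exact: hZ.
  by rewrite integral_dirac// diracT mul1e v00 mul0r.
rewrite (negbTE vn0) in hZ.
have s0 : Num.sqrt v != 0 by rewrite sqrtr_eq0 -ltNge lt_neqAle eq_sym vn0.
transitivity (\int[normal_prob 0 (Num.sqrt v)]_x (expR x)%:E)%E.
  by apply: eq_measure_integral => A mA _; exact: hZ.
by rewrite normal_mgf// sqr_sqrtr.
Qed.

(** Rules out a junk value. For v < 0, [Num.sqrt v] is 0 and [normal_prob 0 0] is the uniform law on
    [0, 1]; then Z and -Z would both lie in ]0, 1] almost surely, which is impossible. *)
Lemma gauss_law_var_ge0 (Z : Omega -> R) (v : R) : measurable_fun setT Z ->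
  (forall A : set R, measurable A -> P (Z @^-1` A) = centered_gauss_law v A) ->
  (forall A : set R, measurable A -> P ((fun w => - Z w) @^-1` A) = centered_gauss_law v A) ->
  0 <= v.
Proof.
move=> mZ h1 h2; rewrite leNgt; apply/negP => v0.
have mI : measurable (`]0, 1]%classic : set R) by exact: measurable_itv.
have lI : centered_gauss_law v `]0, 1]%classic = 1%E.
  rewrite /centered_gauss_law lt_eqF// (ler0_sqrtr (ltW v0)) /normal_prob /normal_pdf eqxx.
  rewrite (@integral_indic _ (measurableTypeR R) R mu `]0, 1]%classic _ `[0, 1]%classic);
    try exact: measurable_itv.
  have -> : `[0, 1]%classic `&` `]0, 1]%classic = `]0, 1]%classic :> set R.
    by apply/setIidr; exact: subset_itv_oc_cc.
  transitivity (@lebesgue_measure R `]0, 1]%classic) => //.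
  by rewrite lebesgue_measure_itv /= lte_fin ltr01 oppr0 adde0.
have := h1 _ mI; have := h2 _ mI; rewrite lI => p2 p1.
set A1 := (X in P X = _) in p1; set A2 := (X in P X = _) in p2.
have mA1 : measurable A1 by rewrite -[A1]setTI; exact: mZ.
have mA2 : measurable A2.
  have mN : measurable_fun setT (fun w => - Z w).
    under eq_fun do rewrite -mulN1r.
    by apply: measurable_funM => //; exact: measurable_cst.
  by rewrite -[A2]setTI; exact: mN.
have : (P (A1 `|` A2) <= 1)%E by apply: probability_le1; exact: measurableU.
rewrite measureU//.
  by rewrite [X in (X + _)%E]p1 [X in (_ + X)%E]p2 -EFinD lee_fin; lra.
rewrite -subset0 => w [] /=; rewrite /A1 /A2 /= !in_itv /=; lra.
Qed.

(** Fatou gives the upper bound. For the lower one, the exponential is truncated at K, where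
    dominated convergence applies, and the exponential moment of 2 Zn bounds what the truncation
    removes. *)
Lemma mgf_limit (Z : Omega -> R) (Zn : nat -> Omega -> R) (sn : nat -> R) (s : R) :
  (forall n, measurable_fun setT (Zn n)) ->
  (forall w, Zn ^~ w @ \oo --> Z w) ->
  (forall n, \int[P]_w (expR (Zn n w))%:E = (expR (sn n / 2))%:E)%E ->
  (forall n, \int[P]_w (expR (2 * Zn n w))%:E = (expR (2 * sn n))%:E)%E ->
  sn @ \oo --> s ->
  (\int[P]_w (expR (Z w))%:E = (expR (s / 2))%:E)%E.
Proof.
move=> mZn Zcv h1 h2 scv.
have mZ : measurable_fun setT Z by apply: (measurable_fun_cvg mZn) => w _; exact: Zcv.
have mexp (Y : Omega -> R) : measurable_fun setT Y ->
    measurable_fun setT (fun w => (expR (Y w))%:E).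
  by move=> mY; apply/measurable_EFinP; exact: measurableT_comp.
have Ecv w : (fun n => (expR (Zn n w))%:E) @ \oo --> (expR (Z w))%:E.
  apply: cvg_EFin; first by near=> n.
  by apply: (cvg_comp _ _ (Zcv w)); exact: continuous_expR.
have scv1 : (fun n => (expR (sn n / 2))%:E) @ \oo --> (expR (s / 2))%:E.
  apply: cvg_EFin; first by near=> n.
  apply: (cvg_comp (fun n => sn n / 2) (@expR R)); last exact: continuous_expR.
  by apply: cvgM => //; exact: cvg_cst.
apply/eqP; rewrite eq_le; apply/andP; split.
  have pos n w : [set: Omega] w -> (0 <= (expR (Zn n w))%:E)%E.
    by rewrite lee_fin expR_ge0.
  have := @fatou _ _ R P setT measurableT (fun n w => (expR (Zn n w))%:E)
    (fun n => mexp _ (mZn n)) pos.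
  under eq_integral do rewrite (cvg_limn_einf_sup (Ecv _)).1.
  under [in X in (_ <= X)%E]eq_fun do rewrite h1.
  by rewrite (cvg_limn_einf_sup scv1).1.
apply/lee_addgt0Pr => e e0.
(* Chosen so that the truncation loss e^(2s)/K in the limit is at most e. *)
pose K := expR (2 * s + 1) / e.
have K0 : 0 < K by rewrite divr_gt0// expR_gt0.
pose f (x : R) : R := Num.min (expR x) K.
have f0 x : 0 <= f x by rewrite le_min expR_ge0 ltW.
have mf (Y : Omega -> R) : measurable_fun setT Y -> measurable_fun setT (fun w => f (Y w)).
  move=> mY; apply: measurable_minr; last exact: measurable_cst.
  exact: measurableT_comp.
have fcv w : (fun n => (f (Zn n w))%:E) @ \oo --> (f (Z w))%:E.
  apply: cvg_EFin; first by near=> n.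
  apply: (cvg_comp _ _ (Zcv w)); apply: continuous_min; last exact: cst_continuous.
  exact: continuous_expR.
have [] := @dominated_convergence _ _ R P setT measurableT
  (fun n w => (f (Zn n w))%:E) (fun w => (f (Z w))%:E) (cst K%:E).
- by move=> n; apply/measurable_EFinP; exact: mf.
- by apply/measurable_EFinP; exact: mf.
- by apply: aeW => w _; exact: fcv.
- by apply: finite_measure_integrable_cst.
- by apply: aeW => w n _ /=; rewrite lee_fin ger0_norm// ge_min lexx orbT.
move=> _ _ dct.
(* Integrates the pointwise inequality y <= min(y, K) + y^2/K at y = e^(Zn). *)
have key n : ((expR (sn n / 2) - expR (2 * sn n) / K)%:E <= \int[P]_w (f (Zn n w))%:E)%E.
  rewrite EFinB leeBlDr// -h1.
  have -> : ((expR (2 * sn n) / K)%:E = \int[P]_w ((K^-1)%:E * (expR (2 * Zn n w))%:E))%E.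
    rewrite ge0_integralZl//.
    - by rewrite h2 -EFinM mulrC.
    - by apply: mexp; apply: measurable_funM => //; exact: measurable_cst.
    - by rewrite lee_fin invr_ge0 ltW.
  have mfn : measurable_fun setT (fun w => (f (Zn n w))%:E).
    by apply/measurable_EFinP; exact: mf.
  have mK : measurable_fun setT (fun w => (K^-1)%:E * (expR (2 * Zn n w))%:E)%E.
    apply: emeasurable_funM; first exact: measurable_cst.
    by apply: mexp; apply: measurable_funM => //; exact: measurable_cst.
  have p1 w : [set: Omega] w -> (0 <= (f (Zn n w))%:E)%E by rewrite lee_fin.
  have p2 w : [set: Omega] w -> (0 <= (K^-1)%:E * (expR (2 * Zn n w))%:E)%E.
    by move=> _; rewrite -EFinM lee_fin mulr_ge0 ?expR_ge0// invr_ge0 ltW.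
  rewrite -(ge0_integralD P measurableT p1 mfn p2 mK).
  apply: ge0_le_integral => //.
  - exact: mexp.
  - exact: emeasurable_funD.
  - move=> w _; rewrite -EFinM -EFinD lee_fin /f.
    have y0 := expR_gt0 (Zn n w).
    rewrite (_ : 2 * Zn n w = Zn n w + Zn n w); last by ring.
    rewrite expRD; move: (expR _) y0 => y y0.
    have [yK|Ky] := leP y K; first by rewrite lerDl mulr_ge0 ?mulr_ge0 ?invr_ge0 ?ltW.
    have : y <= K^-1 * (y * y) by rewrite mulrC ler_pdivlMr// ler_wpM2l ?ltW.
    by lra.
have kcv : (fun n => (expR (sn n / 2) - expR (2 * sn n) / K)%:E) @ \oo -->
    (expR (s / 2) - expR (2 * s) / K)%:E.
  apply: cvg_EFin; first by near=> n.
  apply: cvgB.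
    apply: (cvg_comp (fun n => sn n / 2) (@expR R)); last exact: continuous_expR.
    by apply: cvgM => //; exact: cvg_cst.
  apply: cvgM; last exact: cvg_cst.
  apply: (cvg_comp (fun n => 2 * sn n) (@expR R)); last exact: continuous_expR.
  by apply: cvgM => //; exact: cvg_cst.
have le1 : ((expR (s / 2) - expR (2 * s) / K)%:E <= \int[P]_w (f (Z w))%:E)%E.
  by apply: (lee_cvg_to kcv dct); near=> n; exact: key.
have le2 : (\int[P]_w (f (Z w))%:E <= \int[P]_w (expR (Z w))%:E)%E.
  apply: ge0_le_integral => //.
  - by move=> w _; rewrite lee_fin.
  - by apply/measurable_EFinP; exact: mf.
  - exact: mexp.
  - by move=> w _; rewrite lee_fin ge_min lexx.
have := le_trans le1 le2; rewrite EFinB leeBlDr// => /le_trans; apply.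
rewrite leeD2l// lee_fin /K invf_div mulrCA ler_piMr ?(ltW e0)//.
by rewrite ler_pdivrMr ?expR_gt0// mul1r ler_expR lerDl.
Unshelve. all: by end_near. Qed.

End GaussianMGF.

(** * Finite linear combinations of the field *)

Section FieldMGF.
Context {R : realType} {dO : measure_display} {Omega : measurableType dO}.
Context (P : probability Omega R) (d : nat) (T : 'rV[R]_(d.+1) -> Omega -> R) (K : R -> R).
Context (hT : continuous_centered_gaussian_field_on_sphere d P T K).

Definition qvar (s : seq (R * 'rV[R]_(d.+1))) : R :=
  \sum_(p <- s) \sum_(q <- s) p.1 * q.1 * K (dotv p.2 q.2).

Lemma measurable_field_sum (s : seq (R * 'rV[R]_(d.+1))) :
  (forall p, p \in s -> sphere d p.2) ->
  measurable_fun setT (fun w => \sum_(p <- s) p.1 * T p.2 w).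
Proof.
have [_ mT _] := hT; elim: s => [|p s IH] hs.
  by under eq_fun do rewrite big_nil; exact: measurable_cst.
under eq_fun do rewrite big_cons; apply: measurable_funD.
  apply: measurable_funM; first exact: measurable_cst.
  by apply: mT; apply: hs; rewrite mem_head.
by apply: IH => q qs; apply: hs; rewrite in_cons qs orbT.
Qed.

(** The factor [a] serves at 1 and -1 to show that the variance is nonnegative, and at 1 and 2 for
    the two exponential moments in [mgf_limit]. *)
Lemma field_sum_law (s : seq (R * 'rV[R]_(d.+1))) (a : R) :
  (forall p, p \in s -> sphere d p.2) -> forall A : set R, measurable A ->
  P ((fun w => \sum_(p <- s) (a * p.1) * T p.2 w) @^-1` A) =
  centered_gauss_law (a ^+ 2 * qvar s) A.
Proof.
move=> hs A mA; have [_ _ law] := hT.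
have hs' i : sphere d (tnth (in_tuple s) i).2 by apply: hs; exact: mem_tnth.
have := law (size s) (fun i => (tnth (in_tuple s) i).2)
  (fun i => a * (tnth (in_tuple s) i).1) hs' A mA.
have -> : (fun w => \sum_(p <- s) (a * p.1) * T p.2 w) =
  fun w => \sum_(i < size s) a * (tnth (in_tuple s) i).1 * T (tnth (in_tuple s) i).2 w.
  by apply/funext => w; rewrite big_tnth.
move=> ->; congr (centered_gauss_law _ A).
rewrite /qvar mulr_sumr [RHS]big_tnth; apply: eq_bigr => i _.
rewrite mulr_sumr [RHS]big_tnth; apply: eq_bigr => j _.
by ring.
Qed.

Lemma qvar_ge0 s : (forall p, p \in s -> sphere d p.2) -> 0 <= qvar s.
Proof.
move=> hs; apply: (@gauss_law_var_ge0 R _ _ P (fun w => \sum_(p <- s) p.1 * T p.2 w)).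
- exact: measurable_field_sum.
- move=> A mA; have := field_sum_law 1 hs mA; rewrite expr1n mul1r => <-.
  congr (P (_ @^-1` A)); apply/funext => w.
  by apply: eq_bigr => p _; rewrite mul1r.
- move=> A mA; have := field_sum_law (-1) hs mA; rewrite sqrrN expr1n mul1r => <-.
  congr (P (_ @^-1` A)); apply/funext => w.
  by rewrite -sumrN; apply: eq_bigr => p _; rewrite mulN1r mulNr.
Qed.

Lemma field_sum_mgf (s : seq (R * 'rV[R]_(d.+1))) (a : R) :
  (forall p, p \in s -> sphere d p.2) ->
  (\int[P]_w (expR (a * \sum_(p <- s) p.1 * T p.2 w))%:E =
   (expR (a ^+ 2 * qvar s / 2))%:E)%E.
Proof.
move=> hs; apply: gauss_law_mgf.
- by apply: measurable_funM; [exact: measurable_cst|exact: measurable_field_sum].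
- by rewrite mulr_ge0 ?sqr_ge0// qvar_ge0.
- move=> A mA; rewrite -(field_sum_law a hs mA); congr (P (_ @^-1` A)).
  by apply/funext => w; rewrite mulr_sumr; apply: eq_bigr => p _; rewrite mulrA.
Qed.

End FieldMGF.

(** * Quadratic rate functions *)

Section RateFunction.
Context {R : realType} {m : nat}.

Definition qf (A : 'M[R]_m) (t : 'rV[R]_m) : R := (t *m A *m t^T) 0 0.

Lemma qfE A t : qf A t = \sum_i \sum_j t 0 i * A i j * t 0 j.
Proof.
rewrite /qf mxE exchange_big /=; apply: eq_bigr => j _.
by rewrite mxE big_distrl /= mxE.
Qed.

Lemma dotvE (x y : 'rV[R]_m) : dotv x y = (x *m y^T) 0 0.
Proof. by rewrite /dotv mxE; apply: eq_bigr => i _; rewrite mxE. Qed.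

Lemma qfZ A (a : R) t : qf A (a *: t) = a ^+ 2 * qf A t.
Proof.
by rewrite /qf linearZ /= -!scalemxAl -scalemxAr !mxE mulrA -expr2.
Qed.

Lemma dotvZl (a : R) (x y : 'rV[R]_m) : dotv (a *: x) y = a * dotv x y.
Proof. by rewrite /dotv mulr_sumr; apply: eq_bigr => i _; rewrite mxE mulrA. Qed.

Lemma dotvDl (x z y : 'rV[R]_m) : dotv (x + z) y = dotv x y + dotv z y.
Proof. by rewrite /dotv -big_split; apply: eq_bigr => i _; rewrite mxE mulrDl. Qed.

Lemma dotv_delta i (y : 'rV[R]_m) : dotv (delta_mx 0 i) y = y 0 i.
Proof.
rewrite /dotv (bigD1 i)//= mxE !eqxx mul1r big1 ?addr0// => j ji.
by rewrite mxE (negbTE ji) andbF mul0r.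
Qed.

Lemma qf_delta A i : qf A (delta_mx 0 i) = A i i.
Proof. by rewrite /qf -rowE trmx_delta -colE !mxE. Qed.

Lemma qf_shift A (t : 'rV[R]_m) i (c : R) : A^T = A ->
  qf A (t + c *: delta_mx 0 i) = qf A t + 2 * c * (t *m A) 0 i + c ^+ 2 * A i i.
Proof.
move=> At.
have h1 : (t *m A *m (c *: (delta_mx 0 i : 'rV[R]_m))^T) 0 0 = c * (t *m A) 0 i.
  by rewrite linearZ /= -scalemxAr mxE trmx_delta -colE mxE.
have tr (M : 'M[R]_1) : M 0 0 = M^T 0 0 by rewrite mxE.
have h2 : ((c *: delta_mx 0 i : 'rV[R]_m) *m A *m t^T) 0 0 = c * (t *m A) 0 i.
  by rewrite tr !trmx_mul trmxK At mulmxA h1.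
have h3 : qf A (c *: delta_mx 0 i) = c ^+ 2 * A i i by rewrite qfZ qf_delta.
rewrite -h3 /qf linearD /= mulmxDr !mulmxDl [LHS]mxE [X in X + _]mxE [X in _ + X]mxE.
by rewrite h1 h2; ring.
Qed.

Context (B : 'M[R]_m).

Definition quad_rate (y : 'rV[R]_m) : \bar R :=
  ereal_sup (range (fun t : 'rV[R]_m => (dotv t y - 2^-1 * qf B t)%:E)).

Lemma quad_rate_ge (t y : 'rV[R]_m) : ((dotv t y - 2^-1 * qf B t)%:E <= quad_rate y)%E.
Proof. by apply: ereal_sup_ubound; exists t. Qed.

Lemma quad_rate_ge0 y : (0 <= quad_rate y)%E.
Proof.
apply: le_trans (quad_rate_ge 0 y).
by rewrite /qf mul0mx mul0mx mxE mulr0 subr0 /dotv big1// => i _; rewrite mxE mul0r.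
Qed.

Lemma quad_rate_gtP (a : R) y : (a%:E < quad_rate y)%E ->
  exists t : 'rV[R]_m, a < dotv t y - 2^-1 * qf B t.
Proof.
by move=> /ereal_sup_gt[_ [t _ <-]]; rewrite lte_fin => h; exists t.
Qed.

Lemma dotvr_continuous (x : 'rV[R]_m) : continuous (dotv x).
Proof.
move=> p; rewrite /dotv.
have : (\sum_i x 0 i * q 0 i : R) @[q --> nbhs p] --> (\sum_i x 0 i * p 0 i : R).
  apply: cvg_big; first exact: add_continuous.
  by move=> i _; apply: cvgM; [exact: cvg_cst|exact: coord_continuous].
exact.
Qed.

Lemma open_halfspace (t : 'rV[R]_m) (a : R) : open [set y | a < dotv t y].
Proof.
have -> : [set y | a < dotv t y] = dotv t @^-1` [set x | a < x] by [].
apply: open_comp; last exact: open_gt.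
by move=> y _; exact: dotvr_continuous.
Qed.

Lemma quad_rate_lsc : lower_semicontinuous quad_rate.
Proof.
move=> y a /quad_rate_gtP[t ht].
exists [set z | a + 2^-1 * qf B t < dotv t z].
  by apply: open_nbhs_nbhs; split; [exact: open_halfspace|rewrite /=; lra].
move=> z /= hz; apply: lt_le_trans (quad_rate_ge t z).
by rewrite lte_fin; lra.
Qed.

(** Testing the supremum at plus or minus a basis vector gives rate at least |y_i| - B_ii/2; this
    radius makes that exceed [a] outside the cube. *)
Definition quad_box (a : R) : R := `|a| + \sum_i `|B i i|.

Lemma quad_box_cover (a : R) (y : 'rV[R]_m) i : quad_box a < `|y 0 i| ->
  exists2 e : R, e ^+ 2 = 1 &
    a < dotv (e *: delta_mx 0 i) y - 2^-1 * qf B (e *: delta_mx 0 i).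
Proof.
move=> hy.
have [e e2 ey] : exists2 e : R, e ^+ 2 = 1 & e * y 0 i = `|y 0 i|.
  have [y0|y0] := leP 0 (y 0 i).
    by exists 1; rewrite ?expr1n ?mul1r ?ger0_norm.
  by exists (-1); rewrite ?sqrrN ?expr1n ?mulN1r ?ltr0_norm.
exists e => //; rewrite dotvZl dotv_delta qfZ qf_delta e2 mul1r ey.
have : \sum_i `|B i i| >= B i i.
  by rewrite (bigD1 i)//= (le_trans (ler_norm _))// lerDl sumr_ge0.
have := ler_norm a; have : 0 <= \sum_i `|B i i| by exact: sumr_ge0.
move: hy; rewrite /quad_box; lra.
Qed.

Lemma box_compact (M : R) : compact [set y : 'rV[R]_m | forall i, `|y 0 i| <= M].
Proof.
have := @rV_compact R m (fun=> `[- M, M]%classic) (fun=> @segment_compact R _ _).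
congr (compact _); apply/seteqP; split=> y /= h i; have := h i;
  by rewrite /= in_itv /= -ler_norml.
Qed.

Lemma quad_rate_good : good_rate_function quad_rate.
Proof.
split; [exact: quad_rate_ge0|exact: quad_rate_lsc|move=> a].
apply: (@subclosed_compact _ _ [set y : 'rV[R]_m | forall i, `|y 0 i| <= quad_box a]).
- have -> : [set y | (quad_rate y <= a%:E)%E] = ~` [set y | (a%:E < quad_rate y)%E].
    by apply/seteqP; split => y /=; [move=> h; apply/negP; rewrite -leNgt|move/negP; rewrite -leNgt].
  apply: open_closedC; rewrite openE => y /= /quad_rate_lsc[V nV hV].
  by apply: filterS nV.
- exact: box_compact.
move=> y /= hy i; rewrite leNgt; apply/negP => /quad_box_cover[e _ h].
have := lt_le_trans _ hy; have := quad_rate_ge (e *: delta_mx 0 i) y.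
move=> h1 h2; have := le_trans h1 hy; rewrite lee_fin; lra.
Qed.

(** If y is outside the row space of B, some column of the cokernel gives eta with B eta^T = 0 and
    <eta, y> nonzero; along multiples of eta the objective is linear and unbounded. *)
Lemma quad_rate_fin y : B^T = B -> (quad_rate y < +oo)%E -> exists t, y = t *m B.
Proof.
move=> Bt yfin.
suff : (y <= B)%MS by move=> /submxP[t ->]; exists t.
rewrite submxE; apply/eqP/matrixP => i j; rewrite ord1 [RHS]mxE.
set eta : 'rV[R]_m := (col j (cokermx B))^T.
have Be : B *m eta^T = 0 by rewrite trmxK colE mulmxA mulmx_coker mul0mx.
have ye : dotv eta y = (y *m cokermx B) 0 j.
  by rewrite /dotv mxE; apply: eq_bigr => k _; rewrite !mxE mulrC.
have qe s : qf B (s *: eta) = 0 by rewrite qfZ /qf -mulmxA Be mulmx0 mxE mulr0.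
rewrite -ye; apply/eqP/negPn/negP => ne0.
have [b hb] : exists b : R, quad_rate y = b%:E.
  have := quad_rate_ge0 y; move: yfin; case: (quad_rate y) => [b _ _|//|//].
  by exists b.
have := quad_rate_ge (((b + 1) / dotv eta y) *: eta) y.
rewrite hb qe mulr0 subr0 dotvZl mulfVK// lee_fin; lra.
Qed.

(** Inside the cube, compactness extracts finitely many half-spaces; outside it, the 2m coordinate
    directions suffice. This replaces a separate exponential tightness argument. *)
Lemma quad_rate_cover (C : set 'rV[R]_m) (a : R) : closed C ->
  (forall y, C y -> (a%:E < quad_rate y)%E) ->
  exists s : seq 'rV[R]_m, forall y, C y ->
    exists2 t, t \in s & a < dotv t y - 2^-1 * qf B t.
Proof.
move=> cC Ca.
pose K := C `&` [set y : 'rV[R]_m | forall i, `|y 0 i| <= quad_box a].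
have cK : compact K.
  apply: (@subclosed_compact _ _ [set y : 'rV[R]_m | forall i, `|y 0 i| <= quad_box a]);
    [|exact: box_compact|by move=> y []].
  by apply: closedI => //; apply: compact_closed; [exact: norm_hausdorff|exact: box_compact].
have := cK; rewrite compact_cover => /(_ _ setT
   (fun t : 'rV[R]_m => [set y | a + 2^-1 * qf B t < dotv t y])) [].
- by move=> t _; exact: open_halfspace.
- move=> y [Cy _]; have [t ht] := quad_rate_gtP (Ca y Cy).
  by exists t => //=; lra.
move=> s _ hs.
exists (finmap.enum_fset s ++ [seq (e *: delta_mx 0 i : 'rV[R]_m) | e <- [:: 1; -1], i <- enum 'I_m]).
move=> y Cy.
have [yb|] := pselect (forall i, `|y 0 i| <= quad_box a).
  have [t ts /= ht] := hs y (conj Cy yb).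
  by exists t; [rewrite mem_cat ts|lra].
move=> /existsNP[i /negP]; rewrite -ltNge => /quad_box_cover[e e2 he].
exists (e *: delta_mx 0 i) => //; rewrite mem_cat; apply/orP; right.
apply/allpairsP; exists (e, i); split => //=; last by rewrite mem_enum.
have : (e - 1) * (e + 1) == 0 by rewrite -subr_sqr e2 expr1n subrr.
by rewrite mulf_eq0 subr_eq0 addr_eq0 !inE.
Qed.

End RateFunction.

(** * Large deviations from Gaussian moment generating functions *)

Section VectorMeasurability.
Context {R : realType} {m : nat} {d : measure_display} {Omega : measurableType d}.

(** Measurability is known coordinatewise, so the open set is written as the countable union of the
    rational boxes that it contains. *)
Lemma measurable_preimage_open (X : Omega -> 'rV[R]_m) (O : set 'rV[R]_m) :
  (forall i, measurable_fun setT (fun w => X w 0 i)) -> open O ->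
  measurable (X @^-1` O).
Proof.
move=> mX oO.
pose box (c : {ffun 'I_m -> rat} * nat) : set 'rV[R]_m :=
  [set y | forall i, `|y 0 i - ratr (c.1 i)| < c.2.+1%:R^-1].
pose F c : set Omega := if pselect (box c `<=` O) then X @^-1` (box c) else set0.
have -> : X @^-1` O = \bigcup_c F c.
  apply/seteqP; split=> [w Ow|w [c _]]; last first.
    by rewrite /F; case: pselect => //= h hw; apply: (h _ hw).
  have /nbhs_ballP[r /= r0 hr] : nbhs (X w) O by apply: open_nbhs_nbhs.
  have [k hk] : exists k : nat, k.+1%:R^-1 < r / 2.
    have r2 : 0 < r / 2 by rewrite divr_gt0.
    by have /ltr_add_invr[k] := r2; rewrite add0r => ?; exists k.
  have kp : 0 < k.+1%:R^-1 :> R by rewrite invr_gt0.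
  have hq (i : 'I_m) : exists q : rat, `|X w 0 i - ratr q| < k.+1%:R^-1.
    have lt : X w 0 i - k.+1%:R^-1 < X w 0 i + k.+1%:R^-1.
      by move: (_^-1) kp => e; lra.
    have [q] := rat_in_itvoo lt; rewrite in_itv /= => hq; exists q; rewrite ltr_norml.
    by move: (_^-1) hq => e; lra.
  have [q qP] := choice hq.
  exists ([ffun i => q i], k) => //; rewrite /F; case: pselect => [h|].
    by move=> i /=; rewrite ffunE; exact: qP.
  case=> y yb; apply: hr; split=> // i j; rewrite ord1 /ball /=.
  have := yb j; have := qP j; rewrite /= ffunE !ltr_norml.
  by move: (_^-1) hk => e; lra.
apply: countable_bigcupT_measurable; first exact: countableP.
move=> c; rewrite /F; case: pselect => h //=.
have -> : X @^-1` box c = ~` (\bigcup_(i : 'I_m)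
    ~` ((fun w => X w 0 i) @^-1` (ball (ratr (c.1 i) : R) c.2.+1%:R^-1))).
  apply/seteqP; split=> [w hw [i _]|w hw i].
    by apply; have := hw i; rewrite /ball /= distrC.
  have : ball (ratr (c.1 i) : R) c.2.+1%:R^-1 (X w 0 i).
    by apply: contrapT => hb; apply: hw; exists i.
  by rewrite /ball /= distrC.
apply: measurableC; apply: countable_bigcupT_measurable; first exact: countableP.
move=> i; apply: measurableC; rewrite -[X in measurable X]setTI; apply: mX => //.
by apply: open_measurable; exact: ball_open.
Qed.

Lemma measurable_preimage_closed (X : Omega -> 'rV[R]_m) (C : set 'rV[R]_m) :
  (forall i, measurable_fun setT (fun w => X w 0 i)) -> closed C ->
  measurable (X @^-1` C).
Proof.
move=> mX cC.
have -> : X @^-1` C = ~` (X @^-1` (~` C)) by rewrite preimage_setC setCK.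
apply: measurableC; apply: measurable_preimage_open; first exact: mX.
exact: closed_openC.
Qed.

End VectorMeasurability.

(** * Normalized logarithms of probabilities *)

Section Elog.
Context {R : realType}.
Implicit Types (p : \bar R) (u : nat -> \bar R).

Lemma limn_esup_near_le u (c : \bar R) : (\forall n \near \oo, (u n <= c)%E) ->
  (limn_esup u <= c)%E.
Proof.
move=> h; apply: (@le_trans _ _ (ereal_sup (u @` [set n | (u n <= c)%E]))).
  by apply: ereal_inf_lbound; exists [set n | (u n <= c)%E].
by apply: ub_ereal_sup => _ [n hn <-].
Qed.

Lemma limn_einf_near_ge u (c : \bar R) : (\forall n \near \oo, (c <= u n)%E) ->
  (c <= limn_einf u)%E.
Proof.
move=> h; rewrite /limn_einf /limf_einf leeNr; apply: limn_esup_near_le.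
by apply: filterS h => n hn; rewrite leeN2.
Qed.

Lemma elog_le p (v b : R) : 0 < v -> (0 <= p)%E -> (p <= (expR (v * b))%:E)%E ->
  (elog p * (v^-1)%:E <= b%:E)%E.
Proof.
move=> v0 p0 pb; rewrite /elog; case: ifPn => [_|pn0].
  by rewrite gt0_mulNye ?lte_fin ?invr_gt0// leNye.
have [r pr] : exists r : R, p = r%:E.
  by move: p0 pb; case: p pn0 => [r| |]// _ _ _; exists r.
move: p0 pb pn0; rewrite pr !lee_fin eqe => r0 rb rn0.
have r1 : 0 < r by rewrite lt_neqAle eq_sym rn0.
rewrite /= ler_pdivrMr// mulrC.
by rewrite -ler_expR lnK.
Qed.

Lemma elog_ge p (v b : R) : 0 < v -> (p <= 1)%E -> ((expR (v * b))%:E <= p)%E ->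
  (b%:E <= elog p * (v^-1)%:E)%E.
Proof.
move=> v0 p1 pb.
have [r pr] : exists r : R, p = r%:E.
  by move: p1 pb; case: p => [r| |]// _ _; exists r.
move: pb; rewrite /elog pr lee_fin eqe => rb.
have r1 : 0 < r by apply: lt_le_trans rb; exact: expR_gt0.
rewrite gt_eqF// -EFinM lee_fin ler_pdivlMr// mulrC.
by rewrite -ler_expR lnK.
Qed.

Lemma near_all (I : eqType) (s : seq I) (Q : I -> nat -> Prop) :
  (forall i, i \in s -> \forall n \near \oo, Q i n) ->
  \forall n \near \oo, forall i, i \in s -> Q i n.
Proof.
elim: s => [|i s IH] h; first by near=> n.
have h1 := h i (mem_head _ _).
have h2 : \forall n \near \oo, forall j, j \in s -> Q j n.
  by apply: IH => j js; apply: h; rewrite in_cons js orbT.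
near=> n => j; rewrite in_cons => /predU1P[->|js]; first by near: n.
by move: j js; near: n.
Unshelve. all: by end_near. Qed.

End Elog.

(** * Upper and lower large deviation bounds *)

Section GaussianLDP.
Context {R : realType} {m : nat} (dO : nat -> measure_display)
  (Omega : forall L, measurableType (dO L)) (P : forall L, probability (Omega L) R)
  (X : forall L, Omega L -> 'rV[R]_m) (v : nat -> R) (Sig : nat -> 'M[R]_m) (B : 'M[R]_m).
Arguments X : clear implicits.
Context (mX : forall L, (0 < L)%N -> forall i, measurable_fun setT (fun w => X L w 0 i))
  (mgf : forall L, (0 < L)%N -> forall t,
    (\int[P L]_w (expR (dotv t (X L w)))%:E = (expR (qf (Sig L) t / 2))%:E)%E)
  (vcv : v @ \oo --> +oo)
  (Scv : forall i j, (fun L => v L * Sig L i j) @ \oo --> B i j)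
  (Bsym : B^T = B).

Lemma qf_cvg t : (fun L => v L * qf (Sig L) t) @ \oo --> qf B t.
Proof.
rewrite qfE.
have : (fun L => \sum_i \sum_j t 0 i * (v L * Sig L i j) * t 0 j) @ \oo -->
    \sum_i \sum_j t 0 i * B i j * t 0 j.
  apply: cvg_big; first exact: add_continuous.
  move=> i _; apply: cvg_big; first exact: add_continuous.
  move=> j _; apply: cvgM; last exact: cvg_cst.
  by apply: cvgM; [exact: cvg_cst|exact: Scv].
apply: cvg_trans; apply: near_eq_cvg; near=> L.
rewrite qfE mulr_sumr; apply: eq_bigr => i _; rewrite mulr_sumr.
by apply: eq_bigr => j _; ring.
Unshelve. all: by end_near. Qed.

Lemma measurable_dotv_X L (t : 'rV[R]_m) : (0 < L)%N ->
  measurable_fun setT (fun w => dotv t (X L w)).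
Proof.
move=> L0; rewrite /dotv; apply: measurable_sum => i.
by apply: measurable_funM; [exact: measurable_cst|exact: mX].
Qed.

Lemma measurable_exp_X L (t : 'rV[R]_m) (b : R) : (0 < L)%N ->
  measurable_fun setT (fun w => (expR (dotv t (X L w) + b))%:E).
Proof.
move=> L0; apply/measurable_EFinP; apply: measurableT_comp => //.
by apply: measurable_funD; [exact: measurable_dotv_X|exact: measurable_cst].
Qed.

Lemma mgf_shift L t b : (0 < L)%N ->
  (\int[P L]_w (expR (dotv t (X L w) + b))%:E = (expR (qf (Sig L) t / 2 + b))%:E)%E.
Proof.
move=> L0; under eq_integral do rewrite expRD EFinM muleC.
rewrite ge0_integralZl//.
- by rewrite mgf// -EFinM mulrC -expRD.
- have := measurable_exp_X t 0 L0; apply: eq_measurable_fun => w _.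
  by rewrite addr0.
Qed.

(** Shared by both bounds. The upper bound takes f to be the indicator of the closed set, with A
    empty; the lower bound takes f to be the exponential tilt, with A a ball around y. *)
Lemma exp_sum_bound L (A : set (Omega L)) (c : R) (f : Omega L -> R)
    (s : seq ('rV[R]_m * R)) : (0 < L)%N -> measurable A -> 0 <= c ->
  measurable_fun setT f -> (forall w, 0 <= f w) ->
  (forall w, f w <= c * \1_A w + \sum_(p <- s) expR (dotv p.1 (X L w) + p.2)) ->
  (\int[P L]_w (f w)%:E <=
   c%:E * P L A + (\sum_(p <- s) expR (qf (Sig L) p.1 / 2 + p.2))%:E)%E.
Proof.
move=> L0 mA c0 mf f0 hf.
have mI : measurable_fun setT (fun w => c%:E * (\1_A w : R)%:E)%E.
  apply: emeasurable_funM; first exact: measurable_cst.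
  by apply/measurable_EFinP; exact: measurable_indic.
have mS : measurable_fun setT (fun w => \sum_(p <- s) (expR (dotv p.1 (X L w) + p.2))%:E)%E.
  by apply: emeasurable_sum => p; exact: measurable_exp_X.
have pI w : [set: Omega L] w -> (0 <= c%:E * (\1_A w : R)%:E)%E.
  by move=> _; rewrite -EFinM lee_fin mulr_ge0.
have pS w : [set: Omega L] w ->
    (0 <= \sum_(p <- s) (expR (dotv p.1 (X L w) + p.2))%:E)%E.
  by move=> _; apply: sume_ge0 => p _; rewrite lee_fin expR_ge0.
have -> : (c%:E * P L A = \int[P L]_w (c%:E * (\1_A w : R)%:E))%E.
  rewrite ge0_integralZl// ?integral_indic ?setIT//.
  by apply/measurable_EFinP; exact: measurable_indic.
have -> : ((\sum_(p <- s) expR (qf (Sig L) p.1 / 2 + p.2))%:E =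
    \int[P L]_w (\sum_(p <- s) (expR (dotv p.1 (X L w) + p.2))%:E))%E.
  rewrite ge0_integral_sum//.
  - by rewrite -sumEFin; apply: eq_bigr => p _; rewrite mgf_shift.
  - by move=> p; exact: measurable_exp_X.
rewrite -(ge0_integralD (P L) measurableT pI mI pS mS).
apply: ge0_le_integral => //.
- by move=> w _; rewrite lee_fin.
- by apply/measurable_EFinP; exact: mf.
- exact: emeasurable_funD.
- by move=> w _; rewrite sumEFin -EFinM -EFinD lee_fin.
Qed.

Lemma near_v_gt (a : R) : \forall L \near \oo, a < v L.
Proof. by move/cvgryPgt : vcv; exact. Qed.

Lemma gaussian_upper (C : set 'rV[R]_m) (a e : R) : closed C -> 0 < e ->
  (forall y, C y -> (a%:E < quad_rate B y)%E) ->
  \forall L \near \oo, (elog (P L (X L @^-1` C)) * ((v L)^-1)%:E <= (- a + e)%:E)%E.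
Proof.
move=> cC e0 Ca; have [s hs] := quad_rate_cover cC Ca.
have e2 : 0 < e / 2 by rewrite divr_gt0.
have hq : \forall L \near \oo, forall t, t \in s -> v L * qf (Sig L) t - qf B t <= e.
  apply: near_all => t _.
  have /cvgrPdist_le /(_ e e0) := @qf_cvg t; apply: filterS => L.
  by rewrite distrC; apply: le_trans; exact: ler_norm.
near=> L.
have L0 : (0 < L)%N by near: L; exact: nbhs_infty_gt.
have v0 : 0 < v L by near: L; exact: near_v_gt.
have v1 : (size s)%:R / (e / 2) < v L by near: L; exact: near_v_gt.
have hqL : forall t, t \in s -> v L * qf (Sig L) t - qf B t <= e by near: L.
have mC := measurable_preimage_closed (mX L0) cC.
apply: elog_le => //.
(* Each exponential is at least 1 on its half-space a + qf B t / 2 < <t, y>, so their sum dominates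
   the indicator of the closed set. The number of terms is absorbed by e^(v e/2), by the choice of
   [v1]. *)
pose s' := [seq (v L *: t, - (v L * (a + 2^-1 * qf B t))) | t <- s].
have mI : measurable_fun setT (\1_(X L @^-1` C) : Omega L -> R).
  exact: measurable_indic.
have main := exp_sum_bound (s := s') L0 measurable0 (lexx 0) mI.
have {}main : (P L (X L @^-1` C) <= (\sum_(p <- s') expR (qf (Sig L) p.1 / 2 + p.2))%:E)%E.
  move: main; rewrite mul0e add0e integral_indic// setIT; apply.
    by move=> w; rewrite indicE.
  move=> w; rewrite mul0r add0r indicE.
  have [wC|_] := boolP (w \in _); last first.
    by apply: sumr_ge0 => p _; rewrite expR_ge0.
  move: wC; rewrite inE /= => /hs[t ts ht].
  rewrite big_map (perm_big _ (perm_to_rem ts)) big_cons /=.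
  apply: (@le_trans _ _ (expR (dotv (v L *: t) (X L w) - v L * (a + 2^-1 * qf B t)))).
    rewrite -[leLHS]expR0 ler_expR dotvZl -mulrBr mulr_ge0 ?(ltW v0)//; lra.
  by rewrite lerDl; apply: sumr_ge0 => p _; rewrite expR_ge0.
apply: (le_trans main); rewrite lee_fin big_map /=.
apply: (@le_trans _ _ (\sum_(t <- s) expR (v L * (e / 2 - a)))).
  rewrite big_seq [leRHS]big_seq; apply: ler_sum => t ts.
  rewrite ler_expR qfZ.
  have -> : v L ^+ 2 * qf (Sig L) t / 2 - v L * (a + 2^-1 * qf B t) =
    v L * ((v L * qf (Sig L) t - qf B t) / 2 - a) by field.
  by rewrite ler_wpM2l ?(ltW v0)//; have := hqL t ts; lra.
rewrite big_const_seq count_predT iter_addr_0 -[leLHS]mulr_natl.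
have -> : v L * (- a + e) = v L * (e / 2) + v L * (e / 2 - a) by field.
rewrite expRD ler_wpM2r ?expR_ge0//.
apply: le_trans (expR_ge1Dx _).
by move: v1; rewrite ltr_pdivrMr//; lra.
Unshelve. all: by end_near. Qed.

(** Let M be the exponential moment at v t. On the ball around y = t B the tilt is at most [c];
    outside it contributes at most M/2. Hence the ball has probability at least M/(2c), and M/c is
    about e^(-v qf B t / 2). *)
Lemma gaussian_lower (O : set 'rV[R]_m) (t : 'rV[R]_m) (e : R) : open O -> 0 < e ->
  O (t *m B) ->
  \forall L \near \oo,
    ((- (2^-1 * qf B t) - e)%:E <= elog (P L (X L @^-1` O)) * ((v L)^-1)%:E)%E.
Proof.
move=> oO e0; set y := t *m B => Oy.
have /nbhs_ballP[r0 /= r00 hr0] : nbhs y O by apply: open_nbhs_nbhs.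
pose N1 : R := \sum_i `|t 0 i|.
have N10 : 0 <= N1 by exact: sumr_ge0.
(* The second entry bounds by e/4 the variation of <t, .> on the ball. *)
pose r := Num.min r0 (e / 4 / (N1 + 1)).
have r_gt0 : 0 < r by rewrite lt_min r00 !divr_gt0// ltr_wpDl.
have rN1 : r * N1 <= e / 4.
  apply: (@le_trans _ _ (e / 4 / (N1 + 1) * N1)).
    by rewrite ler_wpM2r// ge_min lexx orbT.
  by rewrite mulrAC ler_pdivrMr ?ltr_wpDl// ler_wpM2l ?divr_ge0 ?(ltW e0)// lerDl.
pose bB : R := \sum_i `|B i i|.
have bB0 : 0 <= bB by exact: sumr_ge0.
(* Size of the extra tilt: since h B_ii <= r, the quadratic cost h^2 B_ii / 2 uses up at most half
   of the gain h r. *)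
pose h : R := r / (bB + 1).
have h0 : 0 < h by rewrite divr_gt0// ltr_wpDl.
have hB i : h * B i i <= r.
  apply: (@le_trans _ _ (h * (bB + 1))); last by rewrite mulfVK// gt_eqF// ltr_wpDl.
  rewrite ler_wpM2l ?(ltW h0)// (le_trans (ler_norm _))//.
  rewrite (@le_trans _ _ bB)// ?lerDl// /bB (bigD1 i)//= lerDl.
  exact: sumr_ge0.
have hr40 : 0 < h * r / 4 by apply: divr_gt0 => //; exact: mulr_gt0.
pose J := [seq (sg, i) | sg <- [:: 1 : R; -1], i <- enum 'I_m].
pose tp (p : R * 'I_m) : 'rV[R]_m := t + (p.1 * h) *: delta_mx 0 p.2.
have hq1 : \forall L \near \oo, forall p, p \in J ->
   v L * qf (Sig L) (tp p) - qf B (tp p) <= h * r / 4.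
  apply: near_all => p _.
  have /cvgrPdist_le /(_ _ hr40) := @qf_cvg (tp p); apply: filterS => L.
  by rewrite distrC; apply: le_trans; exact: ler_norm.
have hq2 : \forall L \near \oo, `|v L * qf (Sig L) t - qf B t| <= Num.min (h * r / 4) (e / 2).
  have hr4 : 0 < Num.min (h * r / 4) (e / 2).
    by rewrite lt_min hr40 divr_gt0.
  have /cvgrPdist_le /(_ _ hr4) := @qf_cvg t; apply: filterS => L.
  by rewrite distrC.
near=> L.
have L0 : (0 < L)%N by near: L; exact: nbhs_infty_gt.
have v0 : 0 < v L by near: L; exact: near_v_gt.
have v1 : (2 * (size J)%:R) / (h * r / 4) < v L by near: L; exact: near_v_gt.
have v2 : 2 / (e / 4) < v L by near: L; exact: near_v_gt.
have h1L : forall p, p \in J -> v L * qf (Sig L) (tp p) - qf B (tp p) <= h * r / 4.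
  by near: L.
have h2L : `|v L * qf (Sig L) t - qf B t| <= Num.min (h * r / 4) (e / 2) by near: L.
have mO := measurable_preimage_open (mX L0) oO.
apply: elog_ge => //; first exact: probability_le1.
pose A := X L @^-1` (ball y r).
have AO : A `<=` X L @^-1` O.
  move=> w [_ hw]; apply: hr0; split => // i j.
  by apply: le_ball (hw i j); rewrite ge_min lexx.
have mA : measurable A.
  by apply: measurable_preimage_open; [exact: mX|exact: ball_open].
apply: (@le_trans _ _ (P L A)); last by apply: le_measure; rewrite ?inE.
pose c := expR (v L * (dotv t y + r * N1)).
pose s' := [seq (v L *: tp p, - (v L * (p.1 * h * y 0 p.2 + h * r))) | p <- J].
have := @exp_sum_bound L A c (fun w => expR (dotv (v L *: t) (X L w))) s' L0 mA
  (expR_ge0 _) _ _ _.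
rewrite mgf// => main.
have {}main : ((expR (qf (Sig L) (v L *: t) / 2))%:E <= c%:E * P L A +
    (\sum_(p <- s') expR (qf (Sig L) p.1 / 2 + p.2))%:E)%E.
  apply: main.
  - by apply: measurableT_comp => //; exact: measurable_dotv_X.
  - by move=> w; exact: expR_ge0.
  - move=> w; rewrite indicE; have [wA|wA] := boolP (w \in A).
      rewrite mulr1 -[leLHS]addr0 lerD//; last first.
        by apply: sumr_ge0 => p _; rewrite expR_ge0.
      rewrite ler_expR dotvZl ler_wpM2l ?(ltW v0)//.
      rewrite -lerBlDl /dotv -sumrB mulr_sumr; apply: ler_sum => i _.
      rewrite -mulrBr (le_trans (ler_norm _))// normrM mulrC ler_wpM2r//.
      by move: wA; rewrite inE => -[_ /(_ 0 i)]; rewrite /ball /= distrC => /ltW.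
    rewrite mulr0 add0r.
    (* Outside the ball some coordinate is off by at least r, so adding the tilt by h in that signed
       direction and subtracting h r in the exponent still dominates the original tilt. *)
    have [i hi] : exists i, r <= `|X L w 0 i - y 0 i|.
      apply: contrapT => hn; move: wA; rewrite notin_setE; apply.
      split=> // i j; rewrite ord1 /ball /= distrC ltNge; apply/negP => hj.
      by apply: hn; exists j.
    have [sg sgJ sgE] : exists2 sg : R, sg \in [:: 1; -1] &
        sg * (X L w 0 i - y 0 i) = `|X L w 0 i - y 0 i|.
      have [y0|y0] := leP 0 (X L w 0 i - y 0 i).
        by exists 1; rewrite ?inE ?eqxx ?mul1r ?ger0_norm.
      by exists (-1); rewrite ?inE ?eqxx ?orbT ?mulN1r ?ltr0_norm.
    have pJ : (sg, i) \in J.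
      by apply/allpairsP; exists (sg, i); split => //=; rewrite mem_enum.
    rewrite big_map (perm_big _ (perm_to_rem pJ)) big_cons /=.
    apply: (@le_trans _ _ (expR (dotv (v L *: tp (sg, i)) (X L w) -
        v L * (sg * h * y 0 i + h * r)))); last first.
      by rewrite lerDl; apply: sumr_ge0 => p _; rewrite expR_ge0.
    rewrite ler_expR !dotvZl -mulrBr ler_wpM2l ?(ltW v0)//.
    rewrite /tp /= dotvDl dotvZl dotv_delta.
    have : h * r <= h * (sg * (X L w 0 i - y 0 i)) by rewrite ler_wpM2l ?(ltW h0)// sgE.
    by lra.
set M := expR (qf (Sig L) (v L *: t) / 2) in main.
have M0 : 0 < M by exact: expR_gt0.
have tail : \sum_(p <- s') expR (qf (Sig L) p.1 / 2 + p.2) <= M / 2.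
  rewrite big_map /=.
  apply: (@le_trans _ _ (\sum_(p <- J) M * expR (- (v L * (h * r / 4))))).
    rewrite big_seq [leRHS]big_seq; apply: ler_sum => p pJ.
    rewrite /M -expRD ler_expR !qfZ.
    have sg2 : p.1 ^+ 2 = 1.
      case/allpairsP : pJ => -[sg i] [/=]; rewrite !inE => /orP[]/eqP-> _ ->;
      by rewrite ?sqrrN expr1n.
    (* The cross term is linear in y = t B, so it cancels the shift in the exponent of [s']. There
       remains h^2 B_ii / 2 - h r, at most -h r / 2; the h r / 4 tolerances reduce this to a decay
       rate h r / 4. *)
    have qB : qf B (tp p) = qf B t + 2 * (p.1 * h) * y 0 p.2 + h ^+ 2 * B p.2 p.2.
      by rewrite /tp qf_shift// exprMn sg2 mul1r.
    have := h1L p pJ; rewrite qB.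
    have : h ^+ 2 * B p.2 p.2 <= h * r by rewrite expr2 -mulrA ler_wpM2l ?(ltW h0).
    have : qf B t - v L * qf (Sig L) t <= h * r / 4.
      rewrite (le_trans (ler_norm _))// distrC (le_trans h2L)// ge_min lexx//.
    move: (qf B t) (qf (Sig L) (tp p)) (qf (Sig L) t) (h ^+ 2 * _) (y 0 p.2) => q1 q2 q3 q4 yy a1 a2 a3.
    have -> : v L ^+ 2 * q2 / 2 - v L * (p.1 * h * yy + h * r) =
      v L * (v L * q2 / 2 - p.1 * h * yy - h * r) by field.
    have -> : v L ^+ 2 * q3 / 2 - v L * (h * r / 4) =
      v L * (v L * q3 / 2 - h * r / 4) by field.
    by rewrite ler_wpM2l ?(ltW v0)//; lra.
  rewrite big_const_seq count_predT iter_addr_0 -[leLHS]mulr_natl mulrCA ler_wpM2l ?(ltW M0)//.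
  rewrite expRN ler_pdivrMr ?expR_gt0//.
  have := expR_ge1Dx (v L * (h * r / 4)).
  by move: v1; rewrite ltr_pdivrMr//; lra.
have pfin : P L A \is a fin_num by exact: fin_num_measure.
move: main; rewrite -(fineK pfin); set p := fine _.
rewrite -EFinM -EFinD !lee_fin => main.
have cp : M / 2 <= c * p by move: main tail; lra.
have c0 : 0 < c by exact: expR_gt0.
rewrite -(ler_pM2l c0); apply: le_trans cp.
have ty : dotv t y = qf B t.
  by rewrite dotvE /y /qf trmx_mul Bsym mulmxA.
have : M = expR (v L * (v L * qf (Sig L) t / 2)).
  by rewrite /M qfZ; congr (expR _); field.
move=> ->; rewrite /c ty -expRD ler_pdivlMr//.
have e8 : 2 <= expR (v L * (e / 2)).
  apply: le_trans (expR_ge1Dx _); move: v2; rewrite ltr_pdivrMr ?divr_gt0//.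
  by nra.
apply: (@le_trans _ _ (expR (v L * (qf B t + r * N1) + v L * (- (2^-1 * qf B t) - e)) *
   expR (v L * (e / 2)))); first by rewrite ler_wpM2l ?expR_ge0.
rewrite -expRD ler_expR -!mulrDr ler_wpM2l ?(ltW v0)//.
have : qf B t - v L * qf (Sig L) t <= e / 2.
  by rewrite (le_trans (ler_norm _))// distrC (le_trans h2L)// ge_min lexx orbT.
by move: rN1; lra.
Unshelve. all: by end_near. Qed.

Lemma gaussian_LDP : LDP dO Omega P X v (quad_rate B).
Proof.
split=> [C cC|O oO].
  set J := ereal_inf _; set u := fun L => _.
  have key (a e : R) : (a%:E < J)%E -> 0 < e -> (limn_esup u <= (- a + e)%:E)%E.
    move=> aJ e0; apply: limn_esup_near_le; apply: gaussian_upper => // y Cy.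
    by apply: lt_le_trans aJ _; apply: ereal_inf_lbound; exists y.
  have : (0 <= J)%E by apply: le_ereal_inf_tmp => _ [y _ <-]; exact: quad_rate_ge0.
  (* For an infinite infimum, [key] holds at every finite level and forces the limsup to be -oo. *)
  move: key; case: J => [j| |] key //= _; last first.
    move: (limn_esup u) key => [l| |] key //.
      by have := key (- l + 2) 1 (ltry _) ltr01; rewrite lee_fin => hl; exfalso; lra.
    by have := key 0 1 (ltry _) ltr01.
  apply/lee_addgt0Pr => e e0.
  have e2 : 0 < e / 2 by rewrite divr_gt0.
  have := key (j - e / 2) (e / 2) _ e2; rewrite lte_fin ltrBlDr ltrDl e2 => /(_ isT).
  by move/le_trans; apply; rewrite -EFinD lee_fin; lra.
rewrite leeNl; apply: le_ereal_inf_tmp => _ [y Oy <-]; rewrite leeNl.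
have [yoo|yfin] := eqVneq (quad_rate B y) +oo%E; first by rewrite yoo leNye.
have [t yt] : exists t, y = t *m B by apply: quad_rate_fin => //; rewrite ltey.
(* Evaluating the supremum at t itself bounds the rate below by qf B t / 2, the direction needed
   here. *)
have yI : (- quad_rate B y <= (- (2^-1 * qf B t))%:E)%E.
  rewrite EFinN leeN2; apply: le_trans (quad_rate_ge B t y).
  rewrite lee_fin yt dotvE /qf trmx_mul Bsym mulmxA; lra.
apply: (le_trans yI); apply/lee_addgt0Pr => e e0.
rewrite -leeBlDr// -EFinB; apply: limn_einf_near_ge.
by apply: gaussian_lower => //; rewrite -yt.
Qed.

End GaussianLDP.

(** * The centered field *)

Section ZonalAverage.
Context {R : realType}.

Lemma dotvC n (x y : 'rV[R]_n) : dotv x y = dotv y x.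
Proof. by apply: eq_bigr => i _; rewrite mulrC. Qed.

Definition quadrature n (C : R) (s : nat -> seq (R * 'rV[R]_(n.+1))) := [/\ 0 <= C,
  forall N p, p \in s N -> 0 <= p.1 /\ sphere n p.2 &
  forall N (f : 'rV[R]_(n.+1) -> R) e, usph f -> 0 <= e ->
    (forall p q, sphere n p -> sphere n q ->
      (forall i, `|p 0 i - q 0 i| <= harmonic N) -> `|f p - f q| <= e) ->
    `|sphere_int n f - \sum_(p <- s N) p.1 * f p.2| <= e * C].

Lemma quadrature_ex n : exists C s, @quadrature n C s.
Proof.
have [C C0 h] := @sphere_discretize R n.
have h1 N := h (harmonic N) (harmonic_gt0 N).
have [s sP] := choice h1; exists C, s.
by split=> [//|N|N]; have [] := sP N.
Qed.

Section Quadrature.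
Context n (C : R) (s : nat -> seq (R * 'rV[R]_(n.+1))) (qs : quadrature C s).

Lemma quadrature_mass N : \sum_(p <- s N) p.1 = sph_mass n.
Proof.
have [C0 _ h] := qs.
have := h N (fun=> 1) 0 (@usph_cst R n 1) (lexx _); rewrite mul0r => /(_ _)/wrap[].
  by move=> *; rewrite subrr normr0.
rewrite normr_le0 subr_eq0 => /eqP; rewrite -/(sph_mass n) => ->.
by apply: eq_bigr => p _; rewrite mulr1.
Qed.

Lemma quadrature_cvg (f : 'rV[R]_(n.+1) -> R) : usph f ->
  (fun N => \sum_(p <- s N) p.1 * f p.2) @ \oo --> sphere_int n f.
Proof.
have [C0 _ h] := qs; move=> uf; apply/cvgrPdist_le => e e0.
have C1 : 0 < C + 1 by rewrite ltr_wpDl.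
have e1 : 0 < e / (C + 1) by rewrite divr_gt0.
have [d d0 hd] := uf _ e1.
have hN : \forall N \near \oo, harmonic N <= d.
  have /cvgrPdist_le/(_ d d0) := @cvg_harmonic R; apply: filterS => N.
  by rewrite sub0r normrN ger0_norm// harmonic_ge0.
near=> N; have Nd : harmonic N <= d by near: N.
apply: (@le_trans _ _ (e / (C + 1) * C)).
  apply: h => //; first exact: ltW.
  by move=> p q sp sq hi; apply: hd => // i; exact: le_trans (hi i) Nd.
by rewrite mulrAC ler_pdivrMr// ler_wpM2l ?(ltW e0)// lerDl.
Unshelve. all: by end_near. Qed.

End Quadrature.

(** By Funk-Hecke this is the average of K(<x, .>) over the sphere of dimension n + 1, for every
    unit x. *)
Definition wavg n (K : R -> R) : R := wint (sph_weight n) K / smoment n 0 0.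

Context (K : R -> R)
  (Klip : forall s t : R, `|s| <= 1 -> `|t| <= 1 -> `|K s - K t| <= `|s - t|)
  (Kpa : poly_approx K).

Lemma bmeas_lip : bmeas K.
Proof.
apply: bmeas_unif_cont => e e0; exists e => // s t Ds Dt st.
apply: le_trans st; apply: Klip; rewrite ler_norml.
  by move: Ds; rewrite /= in_itv.
by move: Dt; rewrite /= in_itv.
Qed.

Lemma zonal_mod n (x p q : 'rV[R]_(n.+1)) (e : R) : sphere n x -> sphere n p ->
  sphere n q -> (forall i, `|p 0 i - q 0 i| <= e) ->
  `|K (dotv x p) - K (dotv x q)| <= n.+1%:R * e.
Proof.
move=> sx sp sq hi; apply: le_trans (Klip (sphere_dotv sx sp) (sphere_dotv sx sq)) _.
rewrite /dotv -sumrB; apply: le_trans (ler_norm_sum _ _ _) _.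
rewrite mulr_natl -[in leRHS](card_ord n.+1) -sumr_const; apply: ler_sum => i _.
rewrite -mulrBr normrM -[leRHS]mul1r ler_pM//; exact: sphere_coord.
Qed.

Lemma usph_zonal n (x : 'rV[R]_(n.+1)) : sphere n x -> usph (fun p => K (dotv x p)).
Proof.
move=> sx e e0; exists (e / n.+1%:R); first by rewrite divr_gt0.
move=> p q sp sq hi; apply: le_trans (zonal_mod sx sp sq hi) _.
by rewrite mulrC mulfVK// pnatr_eq0.
Qed.

Lemma sphere_int_zonal n (x : 'rV[R]_(n.+2)) : sphere n.+1 x ->
  sphere_int n.+1 (fun p => K (dotv x p)) = sph_mass n.+1 * wavg n K.
Proof.
move=> sx; rewrite (funk_hecke sx Kpa bmeas_lip (usph_zonal sx)) sph_massS /wavg.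
by have := @smoment00_gt0 R n => w0; field; rewrite gt_eqF.
Qed.

(** * Exponential moments of the centered field *)

Section CenteredField.
Context {dO : measure_display} {Omega : measurableType dO}
  (P : probability Omega R) (n : nat) (T : 'rV[R]_(n.+2) -> Omega -> R)
  (hT : continuous_centered_gaussian_field_on_sphere n.+1 P T K)
  (m : nat) (xs : 'I_m -> 'rV[R]_(n.+2)) (hxs : forall i, sphere n.+1 (xs i)).
Notation c := (sph_mass n.+1 : R).
Notation Xc w := (\row_(i < m) (T (xs i) w - sphere_avg n.+1 (fun y => T y w))).

(** The covariance of T(x) with the spherical average and the variance of that average both equal A
    = [wavg n K], so the centered covariance is K - A - A + A. *)
Definition centered_cov : 'M[R]_m := \matrix_(i, j) (K (dotv (xs i) (xs j)) - wavg n K).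

Section Approximation.
Context (C : R) (s : nat -> seq (R * 'rV[R]_(n.+2))) (qs : quadrature C s)
  (t : 'rV[R]_m).
Let Th := \sum_i t 0 i.

(** The signed measure representing <t, X>: point masses t_i at x_i minus (sum of t)/c times the
    quadrature of the surface measure. *)
Definition approx_list N : seq (R * 'rV[R]_(n.+2)) :=
  [seq (t 0 i, xs i) | i <- enum 'I_m] ++ [seq (- (Th / c) * p.1, p.2) | p <- s N].

Lemma approx_list_sphere N p : p \in approx_list N -> sphere n.+1 p.2.
Proof.
have [_ sP _] := qs.
rewrite mem_cat => /orP[] /mapP[q qN ->] /=; first exact: hxs.
by have [] := sP _ _ qN.
Qed.

Lemma sum_approx_list N (f : 'rV[R]_(n.+2) -> R) : \sum_(p <- approx_list N) p.1 * f p.2 =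
  \sum_i t 0 i * f (xs i) - Th / c * \sum_(p <- s N) p.1 * f p.2.
Proof.
rewrite /approx_list big_cat big_map big_enum big_map /=; congr (_ + _).
by rewrite mulr_sumr -sumrN; apply: eq_bigr => p _; ring.
Qed.

Lemma approx_field_cvg w :
  (fun N => \sum_(p <- approx_list N) p.1 * T p.2 w) @ \oo --> dotv t (Xc w).
Proof.
have [cT _ _] := hT; have uT := within_continuous_usph (cT w).
under eq_fun do rewrite (sum_approx_list _ (T^~ w)).
have -> : dotv t (Xc w) = \sum_i t 0 i * T (xs i) w -
    Th / c * sphere_int n.+1 (fun y => T y w).
  rewrite /dotv (eq_bigr (fun i => t 0 i * T (xs i) w -
    t 0 i * (sphere_int n.+1 (fun y => T y w) / c))); last first.
    by move=> i _; rewrite mxE mulrBr.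
  by rewrite sumrB -mulr_suml -/Th mulrAC mulrA.
apply: cvgB; first exact: cvg_cst.
by apply: cvgM; [exact: cvg_cst|exact: (quadrature_cvg qs uT)].
Qed.

Let A := wavg n K.
(** The covariance of T(x) with <t, X>; [phi N] is the same with <t, X> replaced by its finite
    approximation. *)
Let psi (x : 'rV[R]_(n.+2)) := \sum_i t 0 i * K (dotv (xs i) x) - Th * A.
Let phi N (x : 'rV[R]_(n.+2)) := \sum_(q <- approx_list N) q.1 * K (dotv x q.2).

(** K is 1-Lipschitz, so the modulus of K(<x, .>) and with it the quadrature error are uniform in
    x. *)
Lemma phi_near N x : sphere n.+1 x ->
  `|phi N x - psi x| <= `|Th / c| * (n.+2%:R * C) * harmonic N.
Proof.
move=> sx; rewrite /phi (sum_approx_list N (fun y => K (dotv x y))) /psi.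
have c0 : c != 0 by rewrite gt_eqF// sph_mass_gt0.
have -> : \sum_i t 0 i * K (dotv x (xs i)) = \sum_i t 0 i * K (dotv (xs i) x).
  by apply: eq_bigr => i _; rewrite dotvC.
set S := \sum_i _; set Q := \sum_(p <- _) _.
have -> : S - Th / c * Q - (S - Th * A) = Th / c * (c * A - Q) by field.
rewrite normrM -[leRHS]mulrA ler_wpM2l// /A -(sphere_int_zonal sx).
have [_ _ h] := qs.
have := h N _ (n.+2%:R * harmonic N) (usph_zonal sx).
rewrite mulrAC; apply; first by rewrite mulr_ge0// harmonic_ge0.
by move=> p q sp sq; exact: zonal_mod.
Qed.

Lemma phi_cvg x : sphere n.+1 x -> phi ^~ x @ \oo --> psi x.
Proof.
move=> sx; set b := `|Th / c| * (n.+2%:R * C).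
have hb : (fun N => b * harmonic N) @ \oo --> (0 : R).
  by rewrite -(mulr0 b); apply: cvgM; [exact: cvg_cst|exact: cvg_harmonic].
apply/cvgrPdist_le => e e0.
have /cvgrPdist_le/(_ e e0) := hb; apply: filterS => N.
rewrite sub0r normrN distrC => hN; apply: le_trans (phi_near N sx) _.
exact: le_trans (ler_norm _) hN.
Qed.

Lemma usph_psi : usph psi.
Proof.
apply: usphD; last exact: usph_cst.
by apply: usph_sum => i; apply: usphZ; exact: usph_zonal.
Qed.

(** The sphere integral of K(<x_i, .>) is c A for each i, so the subtracted constant cancels it: <t,
    X> is uncorrelated with the spherical average. *)
Lemma sphere_int_psi : sphere_int n.+1 psi = 0.
Proof.
rewrite sphere_intD; [|by apply: usph_sum => i; apply: usphZ; exact: usph_zonal|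
  exact: usph_cst].
have uz i := usphZ (t 0 i) (usph_zonal (hxs i)).
rewrite sphere_int_sum//.
rewrite (eq_bigr (fun i => t 0 i * (c * A))); last first.
  by move=> i _; rewrite sphere_intZ ?sphere_int_zonal//; exact: usph_zonal.
have -> : sphere_int n.+1 (fun=> - (Th * A)) = - (Th * A) * c.
  rewrite -(sphere_intZ _ (@usph_cst R n.+1 1)); apply: eq_sphere_int => p _.
  by rewrite mulr1.
by rewrite -mulr_suml -/Th /A; ring.
Qed.

(** The variance is the sum of [phi N] against the approximating measure. Its quadrature part tends
    to the integral of [psi], which vanishes; the point masses give the quadratic form. *)
Lemma approx_qvar_cvg : (fun N => qvar K (approx_list N)) @ \oo --> qf centered_cov t.
Proof.
have [C0 sP _] := qs.
have eqN N : qvar K (approx_list N) =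
    \sum_i t 0 i * phi N (xs i) - Th / c * \sum_(p <- s N) p.1 * phi N p.2.
  rewrite -(sum_approx_list N (phi N)); apply: eq_bigr => p _.
  by rewrite /phi mulr_sumr; apply: eq_bigr => q _; rewrite mulrA.
under eq_fun do rewrite eqN.
have -> : qf centered_cov t = \sum_i t 0 i * psi (xs i) - Th / c * 0.
  rewrite mulr0 subr0 qfE; apply: eq_bigr => i _.
  rewrite /psi mulrBr mulr_suml mulr_sumr mulr_sumr -sumrB; apply: eq_bigr => j _.
  by rewrite mxE (dotvC (xs j)) /A; ring.
apply: cvgB.
  apply: cvg_big; first exact: add_continuous.
  by move=> i _; apply: cvgM; [exact: cvg_cst|exact: phi_cvg].
apply: cvgM; first exact: cvg_cst.
have -> : (fun N => \sum_(p <- s N) p.1 * phi N p.2) = (fun N =>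
    \sum_(p <- s N) p.1 * psi p.2 + \sum_(p <- s N) p.1 * (phi N p.2 - psi p.2)).
  apply/funext => N; rewrite -big_split /=; apply: eq_bigr => p _; ring.
have h1 := quadrature_cvg qs usph_psi; rewrite sphere_int_psi in h1.
(* Nodes and [phi N] vary together, so pointwise convergence would not do; the uniform [phi_near]
   and the fixed total mass of the nodes close the gap. *)
suff h2 : (fun N => \sum_(p <- s N) p.1 * (phi N p.2 - psi p.2)) @ \oo --> (0 : R).
  by have := cvgD h1 h2; rewrite addr0; exact.
set b := `|Th / c| * (n.+2%:R * C).
have hb : (fun N => c * (b * harmonic N)) @ \oo --> (0 : R).
  rewrite -(mulr0 c); apply: cvgM; first exact: cvg_cst.
  by rewrite -(mulr0 b); apply: cvgM; [exact: cvg_cst|exact: cvg_harmonic].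
apply/cvgrPdist_le => e e0.
have /cvgrPdist_le/(_ e e0) := hb; apply: filterS => N.
rewrite !sub0r !normrN => hN; apply: le_trans (le_trans (ler_norm _) hN).
apply: le_trans (ler_norm_sum _ _ _) _.
rewrite -(quadrature_mass qs N) mulr_suml big_seq [leRHS]big_seq.
apply: ler_sum => p pN; have [p0 sp] := sP _ _ pN.
by rewrite normrM ger0_norm// ler_wpM2l//; exact: phi_near.
Qed.

End Approximation.

Lemma centered_field_mgf (t : 'rV[R]_m) :
  (\int[P]_w (expR (dotv t (Xc w)))%:E = (expR (qf centered_cov t / 2))%:E)%E.
Proof.
have [C [s qs]] := quadrature_ex n.+1.
have sl N := @approx_list_sphere _ _ qs t N.
apply: (mgf_limit (Zn := fun N w => \sum_(p <- approx_list s t N) p.1 * T p.2 w)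
  (sn := fun N => qvar K (approx_list s t N))).
- by move=> N; exact: (measurable_field_sum hT (sl N)).
- by move=> w; exact: (approx_field_cvg qs).
- move=> N; have := field_sum_mgf hT 1 (sl N).
  by rewrite expr1n mul1r; under eq_integral do rewrite mul1r.
- move=> N; have := field_sum_mgf hT 2 (sl N) => ->.
  by congr (expR _)%:E; field.
- exact: (approx_qvar_cvg qs).
Qed.

(** The spherical average inherits measurability as a pointwise limit of quadrature sums, here with
    t a basis vector. *)
Lemma measurable_centered_field i : measurable_fun setT (fun w => Xc w 0 i).
Proof.
have [C [s qs]] := quadrature_ex n.+1.
apply: (@measurable_fun_cvg _ _ _ _ (fun N w =>
    \sum_(p <- approx_list s (delta_mx 0 i) N) p.1 * T p.2 w)).
- move=> N; apply: measurable_field_sum; first exact: hT.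
  exact: (@approx_list_sphere _ _ qs).
- move=> w _; have -> : Xc w 0 i = dotv (delta_mx 0 i) (Xc w) by rewrite dotv_delta.
  exact: (approx_field_cvg qs).
Qed.

End CenteredField.
End ZonalAverage.

(** * Limit of the rescaled covariances *)

Section SpeedLimit.
Context {R : realType}.
Notation mu := (@lebesgue_measure R).
Notation D := (`[-1, 1]%classic : set R).

Lemma wint_cvg (w : R -> R) (f : nat -> R -> R) (g : R -> R) (M : R) :
  (forall t, 0 <= w t) -> mu.-integrable D (EFin \o w) ->
  (forall L, measurable_fun D (f L)) ->
  (forall L t, D t -> `|f L t| <= M) ->
  (forall t, D t -> f ^~ t @ \oo --> g t) ->
  (fun L => wint w (f L)) @ \oo --> wint w g.
Proof.
move=> w0 wi mf fM fg.
have mg : measurable_fun D g by exact: (measurable_fun_cvg mf).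
have gM t : D t -> `|g t| <= M.
  move=> Dt; have : (fun L => `|f L t|) @ \oo --> `|g t|.
    by apply: cvg_norm; exact: fg.
  by move=> h; apply: (cvgr_to_le h); near=> L; exact: fM.
have mw : measurable_fun D w by have /integrableP[/measurable_EFinP] := wi.
have gb : bmeas g by split=> //; exists M.
have fb : (\int[mu]_(t in D) (w t * g t)%:E)%E \is a fin_num.
  by apply: integrable_fin_num => //; exact: wint_integrable.
rewrite /wint /Rintegral.
apply: (@fine_cvg _ _ _ _ (fun L => \int[mu]_(t in D) (w t * f L t)%:E)%E).
rewrite (fineK fb).
apply: (@dominated_cvg _ _ _ mu D _ _ _ (fun t => (w t * M)%:E)) => //.
- move=> L; apply/measurable_EFinP; apply: measurable_funM; [exact: mw|exact: mf].
- move=> t Dt; apply: cvg_EFin; first by near=> L.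
  by apply: cvgM; [exact: cvg_cst|exact: fg].
- by apply: wint_integrable => //; exact: bmeas_cst.
- move=> L t Dt; rewrite abse_EFin lee_fin normrM ger0_norm// ler_wpM2l//.
  exact: fM.
Unshelve. all: by end_near. Qed.

Lemma gegen_avgE n (f : R -> R) : gegen_avg n.+1 f = wavg n f.
Proof.
have e : n.+1%:R / 2 - 1 = (n%:R - 1) / 2 :> R by rewrite -natr1; field.
rewrite /gegen_avg /wavg /smoment /wint e; congr (_ / _); apply: eq_Rintegral => t _.
  by rewrite mulrC.
by rewrite !expr0 !mulr1.
Qed.

Lemma wavg_gap n (v : R) (K : R -> R) : bmeas K ->
  wavg n (fun t => v * (1 - K t)) = v * (1 - wavg n K).
Proof.
move=> bK; rewrite /wavg.
have w0 := @smoment00_gt0 R n.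
have wge := @sph_weight_ge0 R n; have wi := @integrable_sph_weight R n.
have bc := @bmeas_cst R 1.
have bN : bmeas (fun t => -1 * K t) by apply: bmeasM => //; exact: bmeas_cst.
rewrite (@eq_wint _ _ _ (fun t => v * (1 + -1 * K t))); last first.
  by move=> t _; rewrite mulN1r.
rewrite wintZ//; last by apply: bmeasD.
rewrite wintD// wintZ//.
have -> : wint (sph_weight n) (fun=> 1 : R) = smoment n 0 0.
  by apply: eq_wint => t _; rewrite !expr0 mulr1.
by field; rewrite gt_eqF.
Qed.

End SpeedLimit.

(** * Convergence of the rescaled covariance matrices *)

Section CovarianceLimit.
Context {R : realType} (a : nat -> R).
Context (a_ge0 : forall q, 0 <= a q) (a_sum1 : series a @ \oo --> (1 : R)).
Context (k1 : R)
  (hk1 : (fun t : R => (1 - pser a t) / (1 - t)) @ (1 : R)^'- --> k1).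
Context (k1_le1 : k1 <= 1) (q0 : nat) (q0_ge2 : (2 <= q0)%N) (aq0 : 0 < a q0).
Context (c rho : R) (hcrho : k1 = 1 ->
     [/\ c != 0, 1 < rho &
         (fun t : R => (1 - pser a t - (k1 * (1 - t) - c * (1 - t) `^ rho))
                       / (1 - t) `^ rho) @ (1 : R)^'- --> (0 : R)]).
Notation v := (speed k1 rho).
Notation g := (g_of (pser a) v).

Lemma speed_wavg_cvg n :
  (fun L => v L * (1 - wavg n (iter L (pser a)))) @ \oo --> wavg n g.
Proof.
have bK L : bmeas (iter L (pser a)).
  by apply: bmeas_lip => s t s1 t1; exact: (iter_pser_lip a_ge0 a_sum1 hk1).
under eq_fun do rewrite -wavg_gap//.
apply: cvgM; last exact: cvg_cst.
have [M hM] := speed_gap_bounded a_ge0 a_sum1 hk1 k1_le1 q0_ge2 aq0 hcrho.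
apply: (@wint_cvg _ _ _ _ M).
- exact: sph_weight_ge0.
- exact: integrable_sph_weight.
- move=> L; apply: measurable_funM; first exact: measurable_cst.
  by apply: measurable_funB; [exact: measurable_cst|have [] := bK L].
- move=> L t /=; rewrite in_itv /= -ler_norml => t1.
  rewrite ger0_norm; first exact: hM.
  rewrite mulr_ge0// ?(speed_ge0 a_ge0 a_sum1 hk1)//.
  exact: (iter_pser_gap_ge0 a_ge0 a_sum1).
- move=> t /=; rewrite in_itv /= -ler_norml => t1.
  exact: (speed_gap_cvg a_ge0 a_sum1 hk1 k1_le1 q0_ge2 aq0 hcrho t1).
Qed.

Lemma speed_centered_cov_cvg n m (xs : 'I_m -> 'rV[R]_(n.+2)) :
  (forall i, sphere n.+1 (xs i)) -> forall i j,
  (fun L => v L * centered_cov (iter L (pser a)) xs i j) @ \oo --> B2 n.+1 g xs i j.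
Proof.
move=> hxs i j; rewrite mxE gegen_avgE.
(* Writing K - A = (1 - A) - (1 - K) reduces everything to gaps from 1, which are what the speed
   rescales. *)
have -> : (fun L => v L * centered_cov (iter L (pser a)) xs i j) = (fun L =>
    v L * (1 - wavg n (iter L (pser a))) -
    v L * (1 - iter L (pser a) (dotv (xs i) (xs j)))).
  by apply/funext => L; rewrite mxE; ring.
apply: cvgB; first exact: speed_wavg_cvg.
have ij := sphere_dotv (hxs i) (hxs j).
exact: (speed_gap_cvg a_ge0 a_sum1 hk1 k1_le1 q0_ge2 aq0 hcrho ij).
Qed.

End CovarianceLimit.

Theorem theorem3p4 (R : realType) (d : nat) (hd : (0 < d)%N)
  (J : nat -> R)
  (hJinf : forall N : nat, exists q : nat, (N <= q)%N /\ J q != 0)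
  (hJsum : cvgn (series (fun q : nat => `|J q.+1| / (q`!)%:R)))
  (hkappa1 : series (fun q : nat => J q ^+ 2 / (q`!)%:R) @ \oo --> (1 : R))
  (k1 : R)
  (hk1 : (fun t : R => (1 - kappa_of J t) / (1 - t)) @ (1 : R)^'- --> k1)
  (hk1le : k1 <= 1)
  (c rho : R)
  (hcrho : k1 = 1 ->
     [/\ c != 0, 1 < rho &
         (fun t : R => (1 - kappa_of J t - (k1 * (1 - t) - c * (1 - t) `^ rho))
                       / (1 - t) `^ rho) @ (1 : R)^'- --> (0 : R)])
  (dO : nat -> measure_display) (Omega : forall L : nat, measurableType (dO L))
  (P : forall L : nat, probability (Omega L) R)
  (T : forall L : nat, 'rV[R]_(d.+1) -> Omega L -> R)
  (hT : forall L : nat, (0 < L)%N ->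
     continuous_centered_gaussian_field_on_sphere d (P L) (T L)
       (iter L (kappa_of J)))
  (m : nat) (hm : (0 < m)%N) (xs : 'I_m -> 'rV[R]_(d.+1))
  (hxs : forall i, sphere d (xs i)) (hinj : injective xs) :
  (forall t : R, -1 <= t <= 1 ->
     cvgn (fun L : nat => speed k1 rho L * (1 - iter L (kappa_of J) t))) /\
  good_rate_function (I2 d (g_of (kappa_of J) (speed k1 rho)) xs) /\
  LDP dO Omega P
    (fun L (w : Omega L) =>
       \row_(i < m) (T L (xs i) w - sphere_avg d (fun y => T L y w)))
    (speed k1 rho) (I2 d (g_of (kappa_of J) (speed k1 rho)) xs).
Proof.
pose a q := J q ^+ 2 / (q`!)%:R.
have a_ge0 q : 0 <= a q by rewrite divr_ge0 ?sqr_ge0.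
(* Infinitely many nonzero J_q supply the index q0 >= 2 on which the fixed-point analysis rests. *)
have [q0 [q0_ge2 Jq0]] := hJinf 2%N.
have aq0 : 0 < a q0 by rewrite divr_gt0 ?exprn_even_gt0// ltr0n fact_gt0.
have kE : kappa_of J = pser a by [].
rewrite !kE in hk1 hcrho hT *.
split; last split.
- move=> t; rewrite -ler_norml => t1.
  exact: (speed_gap_cvg a_ge0 hkappa1 hk1 hk1le q0_ge2 aq0 hcrho t1).
- exact: quad_rate_good.
(* Writing d = n + 1 exposes the slice formula for [sphere_int], with [sph_weight n] as weight. *)
case: d hd T hT xs hxs hinj => // n _ T hT xs hxs _.
have Klip L s t := @iter_pser_lip R a a_ge0 hkappa1 k1 hk1 hk1le L s t.
have Kpa L := poly_approx_iter_pser L a_ge0 hkappa1.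
apply: (gaussian_LDP (Sig := fun L => centered_cov (iter L (pser a)) xs)).
- by move=> L L0 i; exact: (measurable_centered_field (hT L L0)).
- by move=> L L0 t; exact: (centered_field_mgf (Klip L) (Kpa L) (hT L L0)).
- exact: (speed_cvgy a_ge0 hkappa1 hk1 hk1le q0_ge2 aq0 hcrho).
- exact: (speed_centered_cov_cvg a_ge0 hkappa1 hk1 hk1le q0_ge2 aq0 hcrho hxs).
- by apply/matrixP => i j; rewrite !mxE dotvC.
Qed.
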